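(* Let $p>1$, $C>0$, and let $(\mathcal{X},\mathcal{F},\{\mathcal{F}_n\}_{n\ge0},\mu)$ be any discrete-time filtered probability space. For all $(F,\mathbf{f},M)$ with $\mathbf{f}\ge0$, $\mathbf{f}^p\le F$, $0\le M\le C$, $$\mathcal{B}^{\mathcal{F}}_\mu(F,\mathbf{f},M;C)\le\mathcal{B}(F,\mathbf{f},M;C).$$ Moreover, if $\{\mathcal{F}_n\}_{n\ge0}$ is an infinitely refining filtration, then $\mathcal{B}^{\mathcal{F}}_\mu(F,\mathbf{f},M;C)=\mathcal{B}(F,\mathbf{f},M;C)$ for all such $(F,\mathbf{f},M)$.
   Context: Dyadic Bellman function: $\mathcal{D}$ is the standard dyadic lattice on $\mathbb{R}$, $\langle f\rangle_J=|J|^{-1}\int_J f$. For a fixed $I\in\mathcal{D}$ (the value does not depend on $I$), $\mathcal{B}(F,\mathbf{f},M;C)$ is the supremum of $|I|^{-1}\sum_{J\in\mathcal{D},J\subseteq I}\alpha_J\langle f\rangle_J^p$ over all non-negative $f\in L^p(I)$ and non-negative numbers $\{\alpha_J\}_{J\in\mathcal{D},J\subseteq I}$ such that $\langle f^p\rangle_I=F$, $\langle f\rangle_I=\mathbf{f}$, $|I|^{-1}\sum_{J\subseteq I}\alpha_J=M$, and $\sum_{J'\in\mathcal{D},J'\subseteq J}\alpha_{J'}\le C|J|$ for all dyadic $J\subseteq I$. Martingale Bellman function: on a filtered probability space with filtration $\{\emptyset,\mathcal{X}\}=\mathcal{F}_0\subseteq\mathcal{F}_1\subseteq\cdots\subseteq\mathcal{F}$,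 with $f_n=\mathbb{E}^\mu[f\mid\mathcal{F}_n]$, $\mathcal{B}^{\mathcal{F}}_\mu(F,\mathbf{f},M;C)$ is the supremum of $\mathbb{E}^\mu[\sum_{n\ge0}\alpha_nf_n^p]$ over all non-negative $f$ and all Carleson sequences $\{\alpha_n\}$ with constant $C$ such that $\mathbb{E}^\mu[f^p]=F$, $\mathbb{E}^\mu[f]=\mathbf{f}$, $\mathbb{E}^\mu[\sum_{n\ge0}\alpha_n]=M$. A Carleson sequence with constant $C$ is a sequence of non-negative random variables with $\alpha_n$ $\mathcal{F}_n$-measurable and $\mathbb{E}^\mu[\sum_{k\ge n}\alpha_k\mid\mathcal{F}_n]\le C$ for all $n\ge0$. The filtration is infinitely refining if for every $\varepsilon>0$, every $n\ge0$ and every $E\in\mathcal{F}_n$ there exist $k>n$ and a real-valued $\mathcal{F}_k$-measurable $h$ with $|h\mathbf{1}_E|=\mathbf{1}_E$ and $\int_E|\mathbb{E}^\mu[h\mid\mathcal{F}_n]|\,d\mu\le\varepsilon$. *)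

(* Defs.v *)
From HB Require Import structures.
From mathcomp Require Import all_boot all_order all_algebra.
From mathcomp Require Import all_classical all_reals all_analysis measurable_realfun.
Set Implicit Arguments. Unset Strict Implicit. Unset Printing Implicit Defensive.
Import Order.TTheory GRing.Theory Num.Theory.
Local Open Scope classical_set_scope.
Local Open Scope ring_scope.

Section Defs.
Context {R : realType}.

Definition I01 : set R := `[(0:R), (1:R)[%classic.

Definition dyad (k j : nat) : set R :=
  `[(j%:R / 2 ^+ k : R), (j.+1%:R / 2 ^+ k : R)[%classic.

Definition dyad_avg (f : R -> R) (k j : nat) : \bar R :=
  ((2 ^+ k)%:E * \int[lebesgue_measure]_(x in dyad k j) (f x)%:E)%E.

(* sum over dyadic J' \subseteq J_{k,j} of alpha_{J'} *)
Definition dyad_subsum (a : nat -> nat -> R) (k j : nat) : \bar R :=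
  (\sum_(k <= k' <oo) \sum_(j' < 2 ^ k' | (j' %/ 2 ^ (k' - k) == j)%N) (a k' j')%:E)%E.

Definition dyad_vals (p C F fv M : R) : set (\bar R) :=
  [set v | exists (f : R -> R) (a : nat -> nat -> R),
    measurable_fun I01 f /\
        (forall x, I01 x -> 0 <= f x) /\
        (\int[lebesgue_measure]_(x in I01) ((f x) `^ p)%:E = F%:E)%E /\
        (\int[lebesgue_measure]_(x in I01) (f x)%:E = fv%:E)%E /\
        (forall k j, 0 <= a k j) /\
        (\sum_(0 <= k <oo) \sum_(j < 2 ^ k) (a k j)%:E)%E = M%:E /\
        (forall k j, (j < 2 ^ k)%N -> (dyad_subsum a k j <= (C / 2 ^+ k)%:E)%E) /\
        v = (\sum_(0 <= k <oo) \sum_(j < 2 ^ k)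
               ((a k j)%:E * poweR (dyad_avg f k j) p))%E].

Definition dyadic_bellman (p C F fv M : R) : \bar R :=
  ereal_sup (dyad_vals p C F fv M).

Context {d : measure_display} {T : measurableType d}.

Definition meas_wrt {d' : measure_display} {U : measurableType d'}
    (G : set (set T)) (g : T -> U) : Prop :=
  forall B : set U, measurable B -> G (g @^-1` B).

Definition filtration (F : nat -> set (set T)) : Prop :=
  [/\ (forall n, sigma_algebra setT (F n)),
      (forall n, F n `<=` measurable),
      (forall n m, (n <= m)%N -> F n `<=` F m) &
      F 0%N = [set A | A = set0 \/ A = setT]].

Definition is_cond_exp (mu : {measure set T -> \bar R}) (G : set (set T))
    (X Y : T -> R) : Prop :=
  [/\ meas_wrt G Y,
      mu.-integrable setT (EFin \o Y) &
      forall A, G A -> (\int[mu]_(x in A) (Y x)%:E = \int[mu]_(x in A) (X x)%:E)%E].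

Definition is_cond_exp_nonneg (mu : {measure set T -> \bar R}) (G : set (set T))
    (X Y : T -> \bar R) : Prop :=
  [/\ (forall x, (0 <= Y x)%E), meas_wrt G Y &
      forall A, G A -> (\int[mu]_(x in A) Y x = \int[mu]_(x in A) X x)%E].

Definition carleson (mu : {measure set T -> \bar R}) (F : nat -> set (set T))
    (C : R) (a : nat -> T -> R) : Prop :=
  [/\ (forall n x, 0 <= a n x),
      (forall n, meas_wrt (F n) (a n)) &
      forall n, exists h : T -> \bar R,
        is_cond_exp_nonneg mu (F n) (fun x => \sum_(n <= k <oo) (a k x)%:E)%E h
        /\ forall x, (h x <= C%:E)%E].

Definition mart_vals (mu : probability T R) (F : nat -> set (set T))
    (p C Fv fv M : R) : set (\bar R) :=
  [set v | exists (f : T -> R) (fn : nat -> T -> R) (a : nat -> T -> R),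
    measurable_fun setT f /\
        (forall x, 0 <= f x) /\
        (\int[mu]_x ((f x) `^ p)%:E = Fv%:E)%E /\
        (\int[mu]_x (f x)%:E = fv%:E)%E /\
        (forall n, is_cond_exp mu (F n) f (fn n)) /\
        carleson mu F C a /\
        (\int[mu]_x \sum_(0 <= n <oo) (a n x)%:E = M%:E)%E /\
        v = (\int[mu]_x \sum_(0 <= n <oo) ((a n x) * (fn n x) `^ p)%:E)%E].

Definition mart_bellman (mu : probability T R) (F : nat -> set (set T))
    (p C Fv fv M : R) : \bar R :=
  ereal_sup (mart_vals mu F p C Fv fv M).

Definition infinitely_refining (mu : probability T R) (F : nat -> set (set T)) : Prop :=
  forall (eps : R), 0 < eps -> forall n E, F n E ->
    exists k (h : T -> R), [/\ (n < k)%N, meas_wrt (F k) h,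
      mu.-integrable setT (EFin \o h),
      (forall x, `|h x * \1_E x| = \1_E x) &
      exists g : T -> R, is_cond_exp mu (F n) h g /\
        (\int[mu]_(x in E) `|g x|%:E <= eps%:E)%E].

End Defs.

(* Main.v *)
Require Import Defs.
From HB Require Import structures.
From mathcomp Require Import all_boot all_order all_algebra.
From mathcomp Require Import all_classical all_reals all_analysis measurable_realfun.
From mathcomp Require Import ring lra zify.
Set Implicit Arguments. Unset Strict Implicit. Unset Printing Implicit Defensive.
Import Order.TTheory GRing.Theory Num.Theory numFieldNormedType.Exports.
Local Open Scope classical_set_scope.
Local Open Scope ring_scope.

(** Both inequalities compare suprema, and each rests on one structural fact about how candidates
    can be built.

    Upper bound. The dyadic Bellman function B is concave in (F, f, M), and it grows by at least al
    f^p when M grows by al. Midpoint concavity comes from placing two dyadic candidates on the two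
    halves of [0,1) ([dyad_vals_midpoint]); general weights follow by binary approximation
    ([bellman_lb_concave]). The jump comes from raising the coefficient of the root interval
    ([dyad_vals_jump]). Given martingale data, f_k is replaced by a finitely valued approximation
    from below. Backward induction on time ([cell_lb_all]) shows, for every A in F_n of positive
    measure, that the truncated sum of the discretized terms from time n on, averaged over A, is at
    most B at the averages over A of f^p, f and the tail of the Carleson sequence. On a cell where
    the time-n approximation is constant the jump inequality accounts for the term alpha_n, and
    concavity joins the cells. Taking A to be the whole space and n = 0, then refining the
    approximation (Fatou) and lengthening the sum, gives [mart_bellman_le_dyadic].

    Lower bound. A dyadic candidate is truncated to a finite binary tree with almost the same value
    ([dyadic_dtree_approx]). In an infinitely refining filtration every set of F_n is cut, up to a
    small loss, into two later sets of nearly equal conditional probability given F_n ([halving]).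
    Iterating this copies the tree into the filtration with all errors controlled by a factor lam >
    1 ([embeds_exists]). The copy misses the prescribed moments slightly. They are restored exactly
    by a two-valued function on a small set kept aside, which is possible when f^p < F
    ([mart_bellman_ge_dtree]); the missing mass is added as a constant at time 0
    ([mart_bellman_ge]). When f^p = F, equality in Jensen makes all averages equal, so a tree has
    value at most M f^p, and the constant function already attains this
    ([mart_bellman_ge_const]). *)

(** * Convexity of the power function and Jensen's inequality *)

Section convexity_of_powers.
Context {R : realType}.
Implicit Types (p c x y : R).

(** For y = exp r with r nonzero, y^p = y exp((p - 1) r) exceeds y (1 + (p - 1) r), and y (1 - r) <=
    y exp(-r) = 1 bounds y r from below. *)
Lemma powR_bernoulli_lt p y : 1 < p -> 0 <= y -> y != 1 ->
  p * y < y `^ p + (p - 1).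
Proof.
move=> p1; rewrite le_eqVlt => /predU1P[<- _|y0 y1].
  by rewrite powR0 ?mulr0; lra.
set r := ln y.
have yE : expR r = y by rewrite lnK.
have r0 : r != 0 by apply: contra y1 => /eqP r0; rewrite -yE r0 expR0.
have E1 : y * (1 + (p - 1) * r) < y `^ p.
  rewrite /powR gt_eqF// -/r (_ : p * r = r + (p - 1) * r); last by ring.
  rewrite expRD yE ltr_pM2l// expR_gt1Dx// mulf_neq0//.
  by rewrite gt_eqF// subr_gt0.
have E2 : y * (1 - r) <= 1.
  rewrite -[leRHS](expRxMexpNx_1 r) yE ler_pM2l//.
  exact: expR_ge1Dx.
have p10 : 0 <= p - 1 by lra.
have := ler_wpM2l p10 E2.
lra.
Qed.

(** Bernoulli's inequality for y / c, multiplied by c^p: the graph lies strictly above its tangent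
    at c. *)
Lemma powR_tangent_lt p c y : 1 < p -> 0 <= c -> 0 <= y -> y != c ->
  p * c `^ (p - 1) * y < y `^ p + (p - 1) * c `^ p.
Proof.
move=> p1; rewrite le_eqVlt => /predU1P[<- y0 yc|c0 y0 yc].
  rewrite !powR0 ?gt_eqF ?subr_gt0//; last by lra.
  by rewrite !mulr0 mul0r addr0 powR_gt0// lt_neqAle eq_sym yc.
have cN0 : c != 0 by rewrite gt_eqF.
have yc1 : y / c != 1.
  by apply: contra yc => /eqP/divr1_eq/eqP.
have := powR_bernoulli_lt p1 (divr_ge0 y0 (ltW c0)) yc1.
have -> : y = y / c * c by rewrite divfK.
rewrite mulfK//; set u := y / c => H.
rewrite (powRM _ _ (ltW c0)) ?divr_ge0 ?(ltW c0)// -mulrDl.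
rewrite -mulrA [X in _ * X](_ : _ = u * c `^ p); last first.
  by rewrite -(@mulr_powRB1 _ c p) ?(ltW c0)//; [ring|lra].
by rewrite mulrA ltr_pM2r ?powR_gt0.
Qed.

Lemma powR_tangent p c y : 1 < p -> 0 <= c -> 0 <= y ->
  p * c `^ (p - 1) * y <= y `^ p + (p - 1) * c `^ p.
Proof.
move=> p1 c0 y0; have [->|yc] := eqVneq y c; last exact/ltW/powR_tangent_lt.
rewrite -mulrA [c `^ _ * c]mulrC mulr_powRB1//; [|lra].
by rewrite le_eqVlt; apply/orP; left; apply/eqP; ring.
Qed.

(** Add the tangent inequalities at the midpoint. The equality case is recorded because it decides
    the boundary f^p = F. *)
Lemma powR_midpoint p x y : 1 < p -> 0 <= x -> 0 <= y ->
  ((x + y) / 2) `^ p <= (x `^ p + y `^ p) / 2 ?= iff (x == y).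
Proof.
move=> p1 x0 y0; set c := (x + y) / 2.
have c0 : 0 <= c by rewrite divr_ge0// addr_ge0.
have cE : p * c `^ (p - 1) * x + p * c `^ (p - 1) * y = 2 * p * c `^ p.
  rewrite -(@mulr_powRB1 _ c p)//; [|lra].
  by rewrite -mulrDr (_ : x + y = 2 * c); [ring|rewrite /c; field].
split.
  have := powR_tangent p1 c0 x0; have := powR_tangent p1 c0 y0; lra.
have [xy|xy] := eqVneq x y.
  by apply/eqP; rewrite /c xy (_ : (y + y) / 2 = y); field.
apply/lt_eqF.
have xc : x != c.
  by apply: contra xy => /eqP h; apply/eqP; move: h; rewrite /c; lra.
have := powR_tangent_lt p1 c0 x0 xc; have := powR_tangent p1 c0 y0; lra.
Qed.

End convexity_of_powers.

Section jensen.
Local Open Scope ereal_scope.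
Context d (T : measurableType d) (R : realType).
Variable mu : {measure set T -> \bar R}.

(** The tangent at c is integrated over A. Its slope is nonnegative, so c may be any lower bound of
    the mean; this is the form required when the mean is known only up to a factor. *)
Lemma jensen_powR (p c m : R) (A : set T) (f : T -> R) :
  (1 < p)%R -> (0 <= c)%R -> measurable A -> mu A = m%:E ->
  measurable_fun A f -> (forall x, A x -> (0 <= f x)%R) ->
  (c * m)%:E <= \int[mu]_(x in A) (f x)%:E ->
  (c `^ p * m)%:E <= \int[mu]_(x in A) (f x `^ p)%:E.
Proof.
move=> p1 c0 mA muA mf f0 cf.
have m0 : (0 <= m)%R by rewrite -lee_fin -muA.
have mfp : measurable_fun A (fun x => (f x `^ p)%:E).
  by apply/measurable_EFinP; exact: (measurableT_comp (measurable_powR p) mf).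
have pc0 : (0 <= p * c `^ (p - 1))%R by rewrite mulr_ge0 ?powR_ge0//; lra.
have pp0 : (0 <= (p - 1) * c `^ p)%R by rewrite mulr_ge0 ?powR_ge0//; lra.
have H : (p * c `^ (p - 1))%:E * \int[mu]_(x in A) (f x)%:E <=
  \int[mu]_(x in A) (f x `^ p)%:E + ((p - 1) * c `^ p * m)%:E.
  rewrite -ge0_integralZl//; last exact/measurable_EFinP.
  rewrite [X in _ + X]EFinM -muA -integral_cst// -ge0_integralD//.
  apply: ge0_le_integral => //.
  - by move=> x Ax; rewrite -EFinM lee_fin mulr_ge0// f0.
  - by apply/measurable_EFinP; apply: measurable_funM.
  - by apply: emeasurable_funD.
  - by move=> x Ax; rewrite -EFinM -EFinD lee_fin powR_tangent// f0.
  - by move=> x Ax; rewrite lee_fin powR_ge0.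
have H' : (p * c `^ (p - 1) * (c * m))%:E <=
  \int[mu]_(x in A) (f x `^ p)%:E + ((p - 1) * c `^ p * m)%:E.
  by apply: le_trans H; rewrite EFinM lee_wpmul2l.
have := leeB H' (lexx ((p - 1) * c `^ p * m)%:E).
rewrite addeK// -EFinB; apply: le_trans; rewrite lee_fin.
rewrite -(@mulr_powRB1 _ c p)//; [|lra].
rewrite le_eqVlt; apply/orP; left; apply/eqP; ring.
Qed.

End jensen.

(** * Sub-sigma-algebras and conditional expectations *)

Section sub_sigma_algebra_closure.
Context d (T : measurableType d) (G : set (set T)).
Hypothesis sG : sigma_algebra setT G.
Let GE : G.-sigma.-measurable = G := measurable_g_measurableTypeE sG.

Lemma sigalgT : G setT.
Proof. by rewrite -GE; exact: (@measurableT _ (g_sigma_algebraType G)). Qed.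

Lemma sigalg0 : G set0.
Proof. by rewrite -GE; exact: (@measurable0 _ (g_sigma_algebraType G)). Qed.

Lemma sigalgI A B : G A -> G B -> G (A `&` B).
Proof. by rewrite -GE; exact: (@measurableI _ (g_sigma_algebraType G)). Qed.

Lemma sigalgU A B : G A -> G B -> G (A `|` B).
Proof. by rewrite -GE; exact: (@measurableU _ (g_sigma_algebraType G)). Qed.

Lemma sigalgC A : G A -> G (~` A).
Proof. by rewrite -GE; exact: (@measurableC _ (g_sigma_algebraType G)). Qed.

Lemma sigalgD A B : G A -> G B -> G (A `\` B).
Proof. by rewrite -GE; exact: (@measurableD _ (g_sigma_algebraType G)). Qed.

Lemma meas_wrtP d' (U : measurableType d') (g : T -> U) :
  meas_wrt G g <-> measurable_fun setT (g : g_sigma_algebraType G -> U).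
Proof.
split=> [mg _ B mB|mg B mB].
  rewrite setTI; have : G (g @^-1` B) by exact: mg.
  by rewrite -[in G _]GE.
by have := mg measurableT B mB; rewrite setTI GE.
Qed.

End sub_sigma_algebra_closure.

Section conditional_expectation.
Local Open Scope ereal_scope.
Context d (T : measurableType d) (R : realType) (mu : probability T R).
Variable G : set (set T).
Hypotheses (sG : sigma_algebra setT G) (Gm : G `<=` measurable).
Let T' := g_sigma_algebraType G.
Let GE : G.-sigma.-measurable = G := measurable_g_measurableTypeE sG.

Lemma meas_wrt_measurable d' (U : measurableType d') (g : T -> U) :
  meas_wrt G g -> measurable_fun setT g.
Proof. by move=> mg _ B mB; rewrite setTI; exact/Gm/mg. Qed.

Lemma meas_wrt_comp d' d'' (U : measurableType d') (V : measurableType d'')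
    (g : T -> U) (h : U -> V) :
  meas_wrt G g -> measurable_fun setT h -> meas_wrt G (h \o g).
Proof.
move=> mg mh B mB; rewrite comp_preimage; apply: mg.
by rewrite -[X in measurable X]setTI; exact: mh.
Qed.

Lemma meas_wrt_lt (Y : T -> R) (c : R) : meas_wrt G Y -> G [set x | (Y x < c)%R].
Proof.
move=> mY; rewrite (_ : [set _ | _] = Y @^-1` `]-oo, c[); first exact: mY.
by apply/seteqP; split=> x /=; rewrite in_itv.
Qed.

Lemma meas_wrt_gt (Y : T -> R) (c : R) : meas_wrt G Y -> G [set x | (c < Y x)%R].
Proof.
move=> mY; rewrite (_ : [set _ | _] = Y @^-1` `]c, +oo[); first exact: mY.
by apply/seteqP; split=> x /=; rewrite in_itv/= andbT.
Qed.

(** Radon-Nikodym on G: the charge with density X and the measure [mu] are both transported to the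
    space carrying G by the identity [phi], and the derivative there is the conditional
    expectation. *)
Lemma cond_exp_exists (X : T -> R) : mu.-integrable setT (EFin \o X) ->
  exists Y, is_cond_exp mu G X Y.
Proof.
move=> iX.
pose phi : T -> T' := id.
have mphi : measurable_fun setT phi.
  by move=> _ B mB; rewrite setTI; apply: Gm; rewrite -GE.
pose nu : {charge set T -> \bar R} := induced_charge iX.
pose mu0 : {measure set T' -> \bar R} := pushforward mu phi.
pose mu' := mu0 mphi.
have fin_mu' : fin_num_fun mu'.
  by move=> A mA; apply: fin_num_measure; apply: Gm; rewrite -GE.
pose mfin := @Measure_isFinite.Build _ _ _ mu' fin_mu'.
pose mu2 : {finite_measure set T' -> \bar R} := HB.pack (Measure.sort mu') mfin.
pose nu0 : {charge set T' -> \bar R} := pushforward nu phi.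
pose nu' := nu0 mphi.
have dom : nu' `<< mu2.
  apply/null_content_dominatesP => A mA muA.
  have GA : G A by rewrite -GE.
  apply: null_set_integral => //; first exact: Gm.
  by apply: measurable_funTS; exact: (measurable_int mu).
pose Y := Radon_Nikodym nu' mu2.
have iY : mu2.-integrable setT Y := Radon_Nikodym_integrable dom.
have mY : measurable_fun setT Y := measurable_int _ iY.
have YfE x : (fine (Y x))%:E = Y x by rewrite fineK// Radon_Nikodym_fin_num.
have iY' : mu.-integrable setT (Y \o phi).
  apply/integrableP; split; first exact: measurableT_comp mY mphi.
  move/integrableP : iY => [_]; apply: le_lt_trans.
  rewrite [leRHS](@ge0_integral_pushforward _ _ _ _ _ _ mphi mu setT (abse \o Y))//.
    exact: measurableT_comp.
  by move=> y _ /=.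
exists (fun x => fine (Y x)); split.
- by apply/(meas_wrtP sG); exact: measurableT_comp.
- by apply: eq_integrable iY' => // x _ /=; rewrite YfE.
- move=> A GA.
  have mA : measurable (A : set T') by rewrite GE.
  transitivity (nu' A); last by [].
  rewrite (Radon_Nikodym_integral dom)//.
  rewrite [RHS](@integral_pushforward _ _ _ _ _ _ mphi mu A Y)//.
    by apply: eq_integral => x _ /=; rewrite YfE.
  by apply: (integrableS measurableT) => //; exact: Gm.
Qed.

Lemma null_of_integral_le0 (Z : T -> R) : mu.-integrable setT (EFin \o Z) ->
  \int[mu]_(x in [set x | (0 < Z x)%R]) (Z x)%:E <= 0 ->
  mu [set x | (0 < Z x)%R] = 0.
Proof.
move=> iZ; set N := [set x | _] => Z0.
have mZ : measurable_fun setT Z by exact/measurable_EFinP/(measurable_int mu).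
have mN : measurable N.
  have := mZ measurableT `]0%R, +oo[%classic (measurable_itv _).
  rewrite setTI; congr (measurable _).
  by apply/seteqP; split=> x /=; rewrite in_itv/= andbT.
have : ae_eq mu N (EFin \o Z) (cst 0).
  apply/ae_eq_integral_abs => //.
    apply: measurable_funTS; exact: (measurable_int mu).
  rewrite (eq_integral (EFin \o Z)); last first.
    by move=> x /[!inE] Nx; rewrite gee0_abs// lee_fin ltW.
  by apply/eqP; rewrite eq_le Z0/= integral_ge0// => x Nx; rewrite lee_fin ltW.
move=> [A [mA A0 NA]].
apply: (subset_measure0 _ _ _ A0) => // x Nx; apply: NA => /= /(_ Nx)[] Zx.
by move: Nx; rewrite /N/= Zx ltxx.
Qed.

Lemma cond_exp_ge0_ae (X Y : T -> R) : (forall x, (0 <= X x)%R) ->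
  is_cond_exp mu G X Y -> mu [set x | (Y x < 0)%R] = 0.
Proof.
move=> X0 [mY iY YE].
have -> : [set x | (Y x < 0)%R] = [set x | (0 < - Y x)%R].
  by apply/seteqP; split=> x /=; rewrite oppr_gt0.
apply: null_of_integral_le0.
  by apply: eq_integrable (integrableN iY).
set N := [set x | _].
have GN : G N.
  rewrite (_ : N = [set x | (Y x < 0)%R]); first exact: meas_wrt_lt.
  by apply/seteqP; split=> x; rewrite /N/= oppr_gt0.
have mN := Gm GN.
under eq_integral do rewrite EFinN.
rewrite integralN/=; last first.
  by apply: integrable_add_def => //; exact: (integrableS measurableT).
by rewrite YE// leeNl oppe0 integral_ge0// => x _; rewrite lee_fin.
Qed.

Lemma cond_exp_ae_eq (X Y Y' : T -> R) :
  is_cond_exp mu G X Y -> meas_wrt G Y' ->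
  mu.-integrable setT (EFin \o Y') ->
  (exists2 N, measurable N & mu N = 0 /\ forall x, ~ N x -> Y x = Y' x) ->
  is_cond_exp mu G X Y'.
Proof.
move=> [mY iY YE] mY' iY' [N mN [N0 NE]]; split=> // A GA.
rewrite -YE//; have mA := Gm GA; apply: ae_eq_integral => //.
- by apply: measurable_funTS; exact: (measurable_int mu).
- by apply: measurable_funTS; exact: (measurable_int mu).
- exists N; split=> // x /= h; apply: contrapT => nNx; apply: h => _.
  by rewrite NE.
Qed.

Lemma cond_exp_exists_ge0 (X : T -> R) : mu.-integrable setT (EFin \o X) ->
  (forall x, (0 <= X x)%R) ->
  exists2 Y, is_cond_exp mu G X Y & forall x, (0 <= Y x)%R.
Proof.
move=> iX X0; have [Y YE] := cond_exp_exists iX; have [mY iY _] := YE.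
have m0 : measurable_fun setT (fun y : R => Num.max y 0%R).
  by apply: measurable_maxr.
exists (fun x => Num.max (Y x) 0%R); last by move=> x; rewrite le_max lexx orbT.
have mY' : meas_wrt G (fun x => Num.max (Y x) 0%R) := meas_wrt_comp mY m0.
apply: (cond_exp_ae_eq YE) => //.
  apply: le_integrable iY => //.
    exact/measurable_EFinP/meas_wrt_measurable.
  move=> x _ /=; rewrite lee_fin ger0_norm ?le_max ?lexx ?orbT//.
  by rewrite ge_max ler_norm normr_ge0.
exists [set x | (Y x < 0)%R].
  by apply: Gm; exact: meas_wrt_lt.
split; first exact: cond_exp_ge0_ae YE.
by move=> x /= /negP; rewrite -leNgt => Y0; rewrite max_l.
Qed.

(** A nonnegative version is cut off at c. The set where it exceeds c belongs to G, and testing the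
    integral bound on that set shows that it is null. *)
Lemma cond_exp_exists_bounded (X : T -> R) (c : R) :
  mu.-integrable setT (EFin \o X) ->
  (forall x, (0 <= X x)%R) -> (0 <= c)%R ->
  (forall A, G A -> \int[mu]_(x in A) (X x)%:E <= c%:E * mu A) ->
  exists2 Y, is_cond_exp mu G X Y & forall x, (0 <= Y x <= c)%R.
Proof.
move=> iX X0 c0 Xc; have [Y YE Y0] := cond_exp_exists_ge0 iX X0.
have [mY iY YA] := YE.
have m0 : measurable_fun setT (fun y : R => Num.min y c).
  by apply: measurable_minr.
exists (fun x => Num.min (Y x) c); last first.
  by move=> x; rewrite le_min Y0 c0/= ge_min lexx orbT.
have mY' : meas_wrt G (fun x => Num.min (Y x) c) := meas_wrt_comp mY m0.
apply: (cond_exp_ae_eq YE) => //.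
  apply: le_integrable iY => //.
    exact/measurable_EFinP/meas_wrt_measurable.
  move=> x _ /=; rewrite lee_fin !ger0_norm ?le_min ?Y0 ?c0//.
  by rewrite ge_min lexx.
have GN : G [set x | (0 < Y x - c)%R].
  rewrite (_ : [set _ | _] = [set x | (c < Y x)%R]); first exact: meas_wrt_gt.
  by apply/seteqP; split=> x /=; rewrite subr_gt0.
exists [set x | (0 < Y x - c)%R]; first exact: Gm.
split; last by move=> x /= /negP; rewrite -leNgt subr_le0 => Yc; rewrite min_l.
have ic : mu.-integrable setT (EFin \o cst c) by exact: finite_measure_integrable_cst.
apply: null_of_integral_le0.
  by apply: eq_integrable (integrableB _ iY ic).
have mN := Gm GN; set N := [set x | _] in GN mN *.
under eq_integral do rewrite EFinB.
rewrite integralB//=; [|exact: (integrableS measurableT)..].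
rewrite YA// [X in _ - X]integral_cst// sube_le0 ?Xc//.
Qed.

End conditional_expectation.

(** * Cutting a set into two nearly equal conditional halves *)

Section halving.
Context d (T : measurableType d) (R : realType) (mu : probability T R).
Variable F : nat -> set (set T).
Hypothesis filF : filtration F.

Lemma filtration_sigma n : sigma_algebra setT (F n). Proof. by case: filF. Qed.
Lemma filtration_measurable n : F n `<=` measurable. Proof. by case: filF. Qed.
Lemma filtration_mono n m : (n <= m)%N -> F n `<=` F m.
Proof. by case: filF => _ _ + _; apply. Qed.

Let P A : R := fine (mu A).

Let PE A : measurable A -> mu A = (P A)%:E.
Proof. by move=> mA; rewrite /P fineK// fin_num_measure. Qed.

Let P_ge0 A : 0 <= P A.
Proof. by rewrite /P fine_ge0. Qed.

(** The halves are the sets where the refining function h is 1 and -1. The difference of their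
    measures inside D in F_n is the integral of h over D, hence of E[h | F_n], which is small. To
    have this relative to every D, the part of E where the conditional expectation is not small is
    thrown away first. *)
Lemma halving n E (kap : R) : infinitely_refining mu F -> F n E -> 1 < kap ->
  exists k E1 E2, [/\ (n < k)%N, F k E1, F k E2 & E1 `<=` E /\ E2 `<=` E] /\
    [/\ E1 `&` E2 = set0,
        forall D, F n D -> (mu (D `&` E1) <= (kap / 2)%:E * mu (D `&` E))%E,
        forall D, F n D -> (mu (D `&` E2) <= (kap / 2)%:E * mu (D `&` E))%E,
        (mu E <= (2 * kap)%:E * mu E1)%E & (mu E <= (2 * kap)%:E * mu E2)%E].
Proof.
move=> refF FE k1.
have mE := filtration_measurable FE.
have [E0|E0] := eqVneq (mu E) 0%E.
  exists n.+1, set0, set0; split.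
    by split=> //; [exact: (sigalg0 (filtration_sigma _))..|split; exact: sub0set].
  by split=> //; rewrite ?set0I// ?E0 ?measure0 ?mule0// => D FD;
    rewrite setI0 measure0 mule_ge0// lee_fin; lra.
(* This choice gives both 1 + del <= kap, for the upper bounds, and (1 - del)^2 kap >= 1, for the
   lower ones: one factor 1 - del is the discarded part, the other the imbalance of the halves. *)
pose del := (kap - 1) / (3 * kap).
have kap0 : 0 < kap by lra.
have del0 : 0 < del by rewrite divr_gt0//; lra.
have delE : del * (3 * kap) = kap - 1 by rewrite /del divfK//; apply: lt0r_neq0; lra.
have delk : 1 + del <= kap by nra.
have del1 : del < 1 by nra.
have PE0 : 0 < P E by rewrite lt_neqAle P_ge0 andbT eq_sym -eqe -PE.
have eps0 : 0 < del ^+ 2 * P E by rewrite mulr_gt0// exprn_gt0.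
have [k [h [nk mh ih hE [g [[mg ig gE] gi]]]]] := refF _ eps0 n E FE.
have gs := filtration_sigma n; have ks := filtration_sigma k.
(* [G0] stays in F_n, so integrals of h over D and [G0] can be replaced by integrals of g. *)
pose G0 := E `&` [set x | `|g x| <= del].
have FG0 : F n G0.
  apply: sigalgI => //.
  rewrite (_ : [set _ | _] = g @^-1` `[- del, del]); first exact: mg.
  by apply/seteqP; split=> x /=; rewrite in_itv/= ler_norml.
have kG0 := filtration_mono (ltnW nk) FG0.
pose E1 := G0 `&` [set x | 0 < h x].
pose E2 := G0 `&` [set x | h x < 0].
have FE1 : F k E1 by apply: sigalgI => //; exact: meas_wrt_gt.
have FE2 : F k E2 by apply: sigalgI => //; exact: meas_wrt_lt.
have h1 x : E x -> `|h x| = 1 by move=> Ex; have := hE x; rewrite indicE mem_set// mulr1.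
have E12 : E1 `&` E2 = set0.
  by apply/seteqP; split=> // x [[_ /= h0] [_ /= h0']]; lra.
have E12U : E1 `|` E2 = G0.
  apply/seteqP; split=> [x [[]|[]]//|x G0x].
  have [h0|h0|h0] := ltgtP (h x) 0; [by right|by left|].
  by have := h1 x G0x.1; rewrite h0 normr0 => /eqP; rewrite eq_sym oner_eq0.
have key D : F n D -> [/\ P (D `&` E1) <= kap / 2 * P (D `&` G0),
    P (D `&` E2) <= kap / 2 * P (D `&` G0),
    (1 - del) * P (D `&` G0) <= 2 * P (D `&` E1) &
    (1 - del) * P (D `&` G0) <= 2 * P (D `&` E2)].
  move=> FD; have FDG := sigalgI gs FD FG0.
  have kD := filtration_mono (ltnW nk) FD.
  have mDG := filtration_measurable FDG.
  have mD1 := filtration_measurable (sigalgI ks kD FE1).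
  have mD2 := filtration_measurable (sigalgI ks kD FE2).
  have disj : [disjoint D `&` E1 & D `&` E2].
    apply/disj_setPS => x [[_ e1] [_ e2]].
    by have : (E1 `&` E2) x by []; rewrite E12.
  have DU : D `&` G0 = (D `&` E1) `|` (D `&` E2) by rewrite -setIUr E12U.
  have e1 : P (D `&` G0) = P (D `&` E1) + P (D `&` E2).
    by apply: EFin_inj; rewrite EFinD -!PE// DU measureU//; apply/eqP; rewrite -disj_set2E.
  have e2 : (\int[mu]_(x in D `&` G0) (h x)%:E = (P (D `&` E1) - P (D `&` E2))%:E)%E.
    rewrite DU integral_setU//; last first.
      by rewrite -DU; apply: measurable_funTS; exact: (measurable_int mu).
    rewrite EFinB -!PE//; congr (_ + _)%E.
      rewrite (eq_integral (cst 1%E)) ?integral_cst ?mul1e// => x /[!inE] -[_ [xG0 hx]].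
      by have := h1 x xG0.1; rewrite gtr0_norm// => ->.
    rewrite (eq_integral (cst (-1)%:E)) ?integral_cst ?mulN1e// => x /[!inE] -[_ [xG0 hx]].
    by have := h1 x xG0.1; rewrite ltr0_norm//= => /eqP; rewrite eqr_oppLR => /eqP ->.
  have e3 : (`| \int[mu]_(x in D `&` G0) (h x)%:E | <= (del * P (D `&` G0))%:E)%E.
    rewrite -gE// EFinM -PE//; apply: le_trans (le_abse_integral _ _ _) _ => //.
      by apply: measurable_funTS; exact: (measurable_int mu).
    rewrite -integral_cst//; apply: ge0_le_integral => //.
    - by apply: measurableT_comp => //; apply: measurable_funTS; exact: (measurable_int mu).
    - by move=> x [_ [_]] /=; rewrite lee_fin.
  move: e3; rewrite e2 abse_EFin lee_fin ler_norml => /andP[a1 a2].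
  have := P_ge0 (D `&` G0); rewrite e1 in a1 a2 *.
  split; nra.
have mG0 := filtration_measurable FG0.
have mag : measurable_fun setT (fun x => `|g x|%:E).
  apply/measurable_EFinP; apply: measurableT_comp => //.
  exact: meas_wrt_measurable (@filtration_measurable n) _ _ _ mg.
(* Chebyshev: |g| > del on the discarded part, while its integral over E is at most del^2 P(E). *)
have lost : P E - P G0 <= del * P E.
  have mEG : measurable (E `\` G0) by exact: measurableD.
  have -> : P E - P G0 = P (E `\` G0).
    apply: EFin_inj; rewrite -PE// measureD//; last by rewrite ltey_eq fin_num_measure.
    by rewrite (setIidr (@subIsetl _ _ _)) EFinB -!PE. 
  rewrite -(ler_pM2l del0) mulrA -expr2 -lee_fin; apply: le_trans gi.
  rewrite EFinM -PE// -integral_cst//.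
  apply: (@le_trans _ _ (\int[mu]_(x in E `\` G0) `|g x|%:E)%E).
    apply: ge0_le_integral => //.
    - by move=> x _; rewrite lee_fin ltW.
    - exact: measurable_funTS.
    - move=> x [Ex nG]; rewrite lee_fin leNgt; apply/negP => gx; apply: nG; split=> //=.
      exact: ltW.
  apply: ge0_subset_integral => //.
  - exact: measurable_funTS.
have low X : (1 - del) * P G0 <= 2 * X -> P E <= 2 * kap * X.
  move=> hX; have : (1 - del) * ((1 - del) * P E) <= 2 * X.
    by apply: le_trans hX; rewrite ler_wpM2l; lra.
  have : 1 <= (1 - del) ^+ 2 * kap by nra.
  move=> a b; have := ler_wpM2r (P_ge0 E) a; nra.
have up D X : F n D -> P X <= kap / 2 * P (D `&` G0) -> measurable X ->
    (mu X <= (kap / 2)%:E * mu (D `&` E))%E.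
  move=> FD hX mX; have mD := filtration_measurable FD.
  rewrite !PE//; last exact: measurableI.
  rewrite -EFinM lee_fin; apply: le_trans hX _; rewrite ler_pM2l ?divr_gt0//.
  rewrite -lee_fin -!PE//; [|exact: measurableI..].
  by apply: le_measure; rewrite ?inE; [exact: measurableI..|move=> x [? []]].
exists k, E1, E2; split; first by split=> //; split=> x [[]].
have mE1 := filtration_measurable FE1; have mE2 := filtration_measurable FE2.
have [_ _ c1 c2] := key _ (sigalgT gs); rewrite !setTI in c1 c2.
split=> //.
- move=> D FD; have [a1 _ _ _] := key D FD; apply: up => //.
  by apply: measurableI => //; exact: filtration_measurable FD.
- move=> D FD; have [_ a1 _ _] := key D FD; apply: up => //.
  by apply: measurableI => //; exact: filtration_measurable FD.
- by rewrite !PE// -EFinM lee_fin low.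
- by rewrite !PE// -EFinM lee_fin low.
Qed.

End halving.

(** * Finite binary trees as truncated dyadic candidates *)

Section trees.
Context {R : realType}.

Inductive dtree := Leaf of R | Node of R & dtree & dtree.

Fixpoint tavg t : R :=
  match t with Leaf v => v | Node _ l r => (tavg l + tavg r) / 2 end.

Fixpoint tpow (p : R) t : R :=
  match t with Leaf v => v `^ p | Node _ l r => (tpow p l + tpow p r) / 2 end.

Fixpoint tmass t : R :=
  match t with Leaf _ => 0 | Node al l r => al + (tmass l + tmass r) / 2 end.

Fixpoint tvalue (p : R) t : R :=
  match t with
  | Leaf _ => 0
  | Node al l r => al * ((tavg l + tavg r) / 2) `^ p + (tvalue p l + tvalue p r) / 2
  end.

Fixpoint tcarleson (C : R) t : Prop :=
  match t with
  | Leaf v => 0 <= v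
  | Node al l r => [/\ 0 <= al, al + (tmass l + tmass r) / 2 <= C,
                       tcarleson C l & tcarleson C r]
  end.

Lemma tavg_ge0 C t : tcarleson C t -> 0 <= tavg t.
Proof.
by elim: t => //= al l ihl r ihr [_ _ /ihl l0 /ihr r0]; rewrite divr_ge0 ?addr_ge0.
Qed.

Lemma tmass_ge0 C t : tcarleson C t -> 0 <= tmass t.
Proof.
elim: t => //= al l ihl r ihr [al0 _ /ihl l0 /ihr r0].
by rewrite addr_ge0 ?divr_ge0 ?addr_ge0.
Qed.

Lemma tpow_ge0 p t : 0 <= tpow p t.
Proof.
by elim: t => [v|al l ihl r ihr] /=; rewrite ?powR_ge0// divr_ge0 ?addr_ge0.
Qed.

Lemma tvalue_ge0 p C t : tcarleson C t -> 0 <= tvalue p t.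
Proof.
elim: t => //= al l ihl r ihr [al0 _ /ihl l0 /ihr r0].
by rewrite addr_ge0 ?divr_ge0 ?addr_ge0// mulr_ge0 ?powR_ge0.
Qed.

Lemma tavg_powR_le p C t : 1 < p -> tcarleson C t -> tavg t `^ p <= tpow p t.
Proof.
move=> p1; elim: t => //= al l ihl r ihr [_ _ cl cr].
have [h _] := powR_midpoint p1 (tavg_ge0 cl) (tavg_ge0 cr).
by apply: le_trans h _; rewrite ler_pM2r ?invr_gt0// lerD ?ihl ?ihr.
Qed.

(** Equality in Jensen at the root forces equality at every midpoint, so both subtrees have the same
    average and again satisfy the hypothesis; every coefficient is then weighted by the same
    power. *)
Lemma tvalue_le_of_tpow_eq p C t : 1 < p -> tcarleson C t ->
  tpow p t <= tavg t `^ p -> tvalue p t <= tmass t * tavg t `^ p.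
Proof.
move=> p1; elim: t => [v|al l ihl r ihr] /=; first by rewrite mul0r.
move=> [al0 _ cl cr] tp.
have [h1 h2] := powR_midpoint p1 (tavg_ge0 cl) (tavg_ge0 cr).
have hl := tavg_powR_le p1 cl; have hr := tavg_powR_le p1 cr.
have lr : tavg l = tavg r.
  apply/eqP; rewrite -h2; apply/eqP.
  lra.
move: tp hr; rewrite -lr (_ : (tavg l + tavg l) / 2 = tavg l); last by field.
move=> tp hr.
have := ihl cl; have := ihr cr; rewrite -lr.
have -> : tpow p l <= tavg l `^ p by lra.
have -> : tpow p r <= tavg l `^ p by lra.
move=> /(_ isT) a /(_ isT) b.
lra.
Qed.

End trees.
Arguments dtree : clear implicits.

(** * Embedding a tree into an infinitely refining filtration *)

Section embedding.
Local Open Scope ereal_scope.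
Context d (T : measurableType d) (R : realType) (mu : probability T R).
Variable F : nat -> set (set T).
Hypothesis filF : filtration F.

Implicit Types (b w : nat -> T -> R) (D E : set T).

(** With w = 1 this is the Carleson mass over D from time m on; with w_i = f_i^p it is the
    functional being maximised. *)
Definition wseries (b w : nat -> T -> R) (m : nat) (D : set T) : \bar R :=
  \sum_(m <= i <oo) \int[mu]_(x in D) (b i x * w i x)%:E.

Lemma wseries_ge0 b w m D : (forall i x, (0 <= b i x)%R) ->
  (forall i x, (0 <= w i x)%R) -> 0 <= wseries b w m D.
Proof.
move=> b0 w0; apply: nneseries_ge0 => i _ _.
by apply: integral_ge0 => x _; rewrite lee_fin mulr_ge0.
Qed.

Lemma wseriesD b (b' : nat -> T -> R) w m D : measurable D ->
  (forall i x, (0 <= b i x)%R) -> (forall i x, (0 <= b' i x)%R) ->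
  (forall i x, (0 <= w i x)%R) ->
  (forall i, measurable_fun setT (b i)) ->
  (forall i, measurable_fun setT (b' i)) ->
  (forall i, measurable_fun setT (w i)) ->
  wseries (fun i x => (b i x + b' i x)%R) w m D = wseries b w m D + wseries b' w m D.
Proof.
move=> mD b0 b'0 w0 mb mb' mw; rewrite /wseries -nneseriesD; last 2 first.
- by move=> i _ _; apply: integral_ge0 => x _; rewrite lee_fin mulr_ge0.
- by move=> i _ _; apply: integral_ge0 => x _; rewrite lee_fin mulr_ge0.
apply: eq_eseriesr => i _; rewrite -ge0_integralD//.
- by apply: eq_integral => x _; rewrite mulrDl EFinD.
- by move=> x _; rewrite lee_fin mulr_ge0.
- exact/measurable_EFinP/measurable_funTS/measurable_funM.
- by move=> x _; rewrite lee_fin mulr_ge0.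
- exact/measurable_EFinP/measurable_funTS/measurable_funM.
Qed.

Lemma le_wseries b w m D : (forall i x, (0 <= b i x)%R) ->
  (forall i x, (0 <= w i x)%R) -> wseries b w m D <= wseries b w 0 D.
Proof.
move=> b0 w0; have t0 i : 0 <= \int[mu]_(x in D) (b i x * w i x)%:E.
  by apply: integral_ge0 => x _; rewrite lee_fin mulr_ge0.
rewrite [leRHS]/wseries (nneseries_split 0 m)//= add0n leeDr// sume_ge0//.
Qed.

Lemma wseries_single (n m : nat) (a : T -> R) w D : (forall x, (0 <= a x)%R) ->
  (forall i x, (0 <= w i x)%R) ->
  wseries (fun i x => if i == n then a x else 0%R) w m D =
  if (m <= n)%N then \int[mu]_(x in D) (a x * w n x)%:E else 0.
Proof.
move=> a0 w0; have t0 i : 0 <= \int[mu]_(x in D) ((if i == n then a x else 0%R) * w i x)%:E.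
  by apply: integral_ge0 => x _; rewrite lee_fin mulr_ge0//; case: ifP.
have z i : i != n -> \int[mu]_(x in D) ((if i == n then a x else 0%R) * w i x)%:E = 0.
  move=> /negbTE ->; rewrite (eq_integral (cst 0)) ?integral0// => x _.
  by rewrite mul0r.
case: leqP => mn; last first.
  by apply: eseries0 => i mi _; apply: z; rewrite gtn_eqF// (leq_trans mn).
rewrite /wseries (nneseries_split m (n - m))//= subnKC//.
rewrite big_nat_cond big1 ?add0e; last first.
  by move=> i /andP[/andP[_ ni] _]; apply: z; rewrite ltn_eqF.
rewrite (nneseries_split n 1)//= addn1 big_nat1 eqxx eseries0 ?adde0//.
by move=> i ni _; apply: z; rewrite gtn_eqF.
Qed.

(** A copy of t living on E, with all errors absorbed in lam. The upper bounds on mean and mass are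
    tested on every D in F_n, because the Carleson condition of an enclosing node has to be checked
    on earlier sigma-algebras. [emb_val] holds for every majorant f of g on E, so that the sibling's
    part and later corrections may be added to g. *)
Record embeds (p C lam : R) (t : dtree R) (n : nat) (E : set T)
    (g : T -> R) (b : nat -> T -> R) : Prop := Embeds {
  emb_ge0 : forall x, (0 <= g x)%R ;
  emb_supp : forall x, ~ E x -> g x = 0%R ;
  emb_meas : measurable_fun setT g ;
  emb_bge0 : forall i x, (0 <= b i x)%R ;
  emb_bmeas : forall i, meas_wrt (F i) (b i) ;
  emb_le : forall D, F n D ->
    \int[mu]_(x in D) (g x)%:E <= (lam * tavg t)%:E * mu (D `&` E) ;
  emb_pow : \int[mu]_x (g x `^ p)%:E <= (lam * tpow p t)%:E * mu E ;
  emb_ge : (tavg t)%:E * mu E <= lam%:E * \int[mu]_x (g x)%:E ;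
  emb_mass : forall D, F n D ->
    wseries b (fun _ _ => 1%R) 0 D <= (lam * tmass t)%:E * mu (D `&` E) ;
  emb_carl : forall m D, F m D ->
    wseries b (fun _ _ => 1%R) m D <= (lam * C)%:E * mu (D `&` E) ;
  emb_val : forall (f : T -> R) (fn : nat -> T -> R),
    (forall x, (0 <= f x)%R) -> measurable_fun setT f ->
    (forall x, E x -> (g x <= f x)%R) ->
    (forall i, is_cond_exp mu (F i) f (fn i)) ->
    (forall i x, (0 <= fn i x)%R) ->
    (tvalue p t)%:E * mu E <= lam%:E * wseries b (fun i x => fn i x `^ p)%R 0 setT }.

Lemma embeds_leaf (p C lam v : R) n E : (1 < p)%R -> (0 < C)%R -> (1 < lam)%R ->
  F n E -> (0 <= v)%R ->
  embeds p C lam (Leaf v) n E (fun x => v * \1_E x)%R (fun _ _ => 0%R).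
Proof.
move=> p1 C0 lam1 FE v0; have mE := filtration_measurable filF FE.
have lam0 : (0 < lam)%R by lra.
have ws w m D : wseries (fun _ _ => 0%R) w m D = 0.
  apply: eseries0 => i _ _; rewrite (eq_integral (cst 0)) ?integral0// => x _.
  by rewrite mul0r.
have intE D : measurable D -> \int[mu]_(x in D) (v * \1_E x)%:E = v%:E * mu (D `&` E).
  move=> mD; under eq_integral do rewrite EFinM.
  rewrite ge0_integralZl//; last first.
    by apply/measurable_EFinP; exact: measurable_indic.
  by rewrite integral_indic// setIC.
have vlam : (v <= lam * v)%R by nra.
split => //=.
- by move=> x; rewrite mulr_ge0// indicE.
- by move=> x nE; rewrite indicE memNset// mulr0.
- by apply: measurable_funM => //; exact: measurable_indic.
- move=> i B mB; have [B0|B0] := pselect (B 0%R).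
    rewrite (_ : _ @^-1` _ = setT); first exact: (sigalgT (filtration_sigma filF _)).
    by apply/seteqP; split.
  rewrite (_ : _ @^-1` _ = set0); first exact: (sigalg0 (filtration_sigma filF _)).
  by apply/seteqP; split.
- move=> D /(filtration_measurable filF) mD; rewrite intE//.
  by apply: lee_wpmul2r; rewrite ?lee_fin.
- rewrite (eq_integral (fun x => (v `^ p * \1_E x)%:E)); last first.
    move=> x _; rewrite indicE; case: (x \in E); rewrite ?mulr1// !mulr0 powR0//.
    by apply: lt0r_neq0; lra.
  under eq_integral do rewrite EFinM.
  rewrite ge0_integralZl//; last 2 first.
    by apply/measurable_EFinP; exact: measurable_indic.
    by rewrite lee_fin powR_ge0.
  rewrite integral_indic// setIT; apply: lee_wpmul2r => //.
  by rewrite lee_fin; have := powR_ge0 v p; nra.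
- rewrite intE// setTI muleA -EFinM; apply: lee_wpmul2r => //.
- by move=> D _; rewrite ws mule_ge0// lee_fin mulr_ge0//; lra.
- by move=> m D _; rewrite ws mule_ge0// lee_fin mulr_ge0//; lra.
- by move=> f fn _ _ _ _ _; rewrite mul0e ws mule0.
Qed.

(** Halve E, embed the two subtrees in the halves from the later time k on, and put the node's
    coefficient on E at time n. *)
Lemma embeds_node (p C lam al : R) (l r : dtree R) n E :
  infinitely_refining mu F ->
  (1 < p)%R -> (0 < C)%R -> (1 < lam)%R -> F n E -> tcarleson C (Node al l r) ->
  (forall lam n E, (1 < lam)%R -> F n E -> exists g b, embeds p C lam l n E g b) ->
  (forall lam n E, (1 < lam)%R -> F n E -> exists g b, embeds p C lam r n E g b) ->
  exists g b, embeds p C lam (Node al l r) n E g b.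
Proof.
move=> refF p1 C0 lam1 FE ct ihl ihr.
have [al0 massC cl cr] : [/\ 0 <= al, al + (tmass l + tmass r) / 2 <= C,
  tcarleson C l & tcarleson C r]%R := ct.
have lam0 : (0 < lam)%R by lra.
have p0 : (0 < p)%R by lra.
(* Halving and the embeddings of the subtrees each cost a factor [kap], together [kap2]. Jensen
   raises the error in the mean to the power p, hence the p-th root of lam. *)
pose kap2 := (lam `^ p^-1)%R.
have kap2p : (kap2 `^ p = lam)%R.
  by rewrite /kap2 -powRrM mulVf ?powRr1 ?(ltW lam0)// gt_eqF.
have kap21 : (1 < kap2)%R.
  rewrite ltNge; apply/negP => k1.
  have : (kap2 `^ p <= 1 `^ p)%R.
    by rewrite ge0_ler_powR ?nnegrE ?powR_ge0// ltW.
  by rewrite kap2p powR1 leNgt lam1.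
have kap2lam : (kap2 <= lam)%R by rewrite -[leRHS]kap2p le1r_powR// ltW.
pose kap := Num.sqrt kap2.
have kapE : (kap * kap = kap2)%R by rewrite -expr2 sqr_sqrtr//; lra.
have kap1 : (1 < kap)%R by rewrite -sqrtr1 ltr_sqrt//; lra.
have [k [E1 [E2 [[nk FE1 FE2 [E1E E2E]] [E12 up1 up2 lo1 lo2]]]]] :=
  halving filF refF FE kap1.
have [gl [bl embl]] := ihl kap k E1 kap1 FE1.
have [gr [br embr]] := ihr kap k E2 kap1 FE2.
have mFE := filtration_measurable filF; have mE := mFE _ _ FE.
have mE1 := mFE _ _ FE1; have mE2 := mFE _ _ FE2.
have nkF := filtration_mono filF (ltnW nk).
have al_ge0 := tavg_ge0 cl; have ar_ge0 := tavg_ge0 cr.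
have ml_ge0 := tmass_ge0 cl; have mr_ge0 := tmass_ge0 cr.
have pl_ge0 := tpow_ge0 p l; have pr_ge0 := tpow_ge0 p r.
have vl_ge0 := tvalue_ge0 p cl; have vr_ge0 := tvalue_ge0 p cr.
pose P A : R := fine (mu A).
have PE A : measurable A -> mu A = (P A)%:E.
  by move=> mA; rewrite /P fineK// fin_num_measure.
have P0 A : (0 <= P A)%R by rewrite /P fine_ge0.
have up (x y a c : R) D (X Y : \bar R) : F n D -> (0 <= a)%R -> (0 <= c)%R ->
    X <= (kap * a)%:E * mu (D `&` E1) ->
    Y <= (kap * c)%:E * mu (D `&` E2) ->
    X + Y <= (kap2 * ((a + c) / 2))%:E * mu (D `&` E).
  move=> FD a0 c0 hX hY; apply: le_trans (leeD hX hY) _.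
  have mD := mFE _ _ FD; move: (up1 D FD) (up2 D FD).
  rewrite !PE; [|exact: measurableI..].
  rewrite -!EFinM -EFinD !lee_fin => h1 h2.
  have := ler_wpM2l (mulr_ge0 (ltW (lt_trans ltr01 kap1)) a0) h1.
  have := ler_wpM2l (mulr_ge0 (ltW (lt_trans ltr01 kap1)) c0) h2.
  rewrite -kapE; lra.
have lo (a c : R) (X Y : \bar R) : (0 <= a)%R -> (0 <= c)%R -> 0 <= X -> 0 <= Y ->
    a%:E * mu E1 <= kap%:E * X -> c%:E * mu E2 <= kap%:E * Y ->
    ((a + c) / 2)%:E * mu E <= kap2%:E * (X + Y).
  move=> a0 c0; move: lo1 lo2; rewrite !PE// -!EFinM !lee_fin => h1 h2.
  have kk : (0 < kap)%R by lra.
  have kk2 : 0 < kap2%:E by rewrite lte_fin; lra.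
  case: X => [X| |]// _; case: Y => [Y| |]// _;
    try by move=> _ _; rewrite ?addye ?addey// gt0_muley ?leey.
  rewrite -EFinD -!EFinM !lee_fin -kapE => h3 h4.
  have := ler_wpM2l a0 h1; have := ler_wpM2l c0 h2.
  have := ler_wpM2l (ltW kk) h3; have := ler_wpM2l (ltW kk) h4; lra.
exists (fun x => gl x + gr x)%R,
  (fun i x => bl i x + br i x + (if i == n then al * \1_E x else 0))%R.
have gl0 := emb_ge0 embl; have gr0 := emb_ge0 embr.
have mgl := emb_meas embl; have mgr := emb_meas embr.
have bl0 := emb_bge0 embl; have br0 := emb_bge0 embr.
have mbl i := meas_wrt_measurable (@mFE i) (emb_bmeas embl i).
have mbr i := meas_wrt_measurable (@mFE i) (emb_bmeas embr i).
have ind0 x : (0 <= al * \1_E x)%R by rewrite mulr_ge0// indicE.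
have mind : measurable_fun setT (fun x => al * \1_E x)%R.
  by apply: measurable_funM => //; exact: measurable_indic.
have ws w m D : measurable D -> (forall i x, (0 <= w i x)%R) ->
    (forall i, measurable_fun setT (w i)) ->
    wseries (fun i x => bl i x + br i x + (if i == n then al * \1_E x else 0))%R w m D =
    wseries bl w m D + wseries br w m D +
    (if (m <= n)%N then \int[mu]_(x in D) (al * \1_E x * w n x)%:E else 0).
  move=> mD w0 mw.
  have b10 i x : (0 <= bl i x + br i x)%R by rewrite addr_ge0.
  have s0 i x : (0 <= if i == n then al * \1_E x else 0)%R by case: ifP.
  have mb1 i : measurable_fun setT (fun x => bl i x + br i x)%R by exact: measurable_funD.
  have ms i : measurable_fun setT (fun x => if i == n then al * \1_E x else 0)%R.
    by case: eqP => _.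
  rewrite (wseriesD m mD b10 s0 w0 mb1 ms mw).
  by rewrite wseriesD// wseries_single.
have avg_le D : F n D -> \int[mu]_(x in D) (gl x + gr x)%:E <=
    (kap2 * ((tavg l + tavg r) / 2))%:E * mu (D `&` E).
  move=> FD; have mD := mFE _ _ FD; under eq_integral do rewrite EFinD.
  rewrite ge0_integralD//; try by [move=> x _; rewrite lee_fin|
    apply/measurable_EFinP; exact: measurable_funTS].
  by apply: (up 0%R 0%R) => //; [exact: (emb_le embl (nkF _ FD))|exact: (emb_le embr (nkF _ FD))].
have avg_ge : ((tavg l + tavg r) / 2)%:E * mu E <=
    kap2%:E * \int[mu]_x (gl x + gr x)%:E.
  under eq_integral do rewrite EFinD.
  rewrite ge0_integralD//; try by [move=> x _; rewrite lee_fin|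
    apply/measurable_EFinP; exact: measurable_funTS].
  apply: lo => //; [| |exact: (emb_ge embl)|exact: (emb_ge embr)];
    by apply: integral_ge0 => x _; rewrite lee_fin.
have mass_le D : F n D ->
  wseries (fun i x => bl i x + br i x + (if i == n then al * \1_E x else 0))%R
    (fun _ _ => 1%R) 0 D <= (lam * (al + (tmass l + tmass r) / 2))%:E * mu (D `&` E).
  move=> FD; have mD := mFE _ _ FD; rewrite ws//=.
  have -> : (lam * (al + (tmass l + tmass r) / 2))%:E * mu (D `&` E) =
      (lam * al)%:E * mu (D `&` E) + (lam * ((tmass l + tmass r) / 2))%:E * mu (D `&` E).
    by rewrite PE; [rewrite -!EFinM -EFinD mulrDr mulrDl|exact: measurableI].
  rewrite addeC; apply: leeD.
    under eq_integral do rewrite mulr1 EFinM.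
    rewrite ge0_integralZl//; last first.
      by apply/measurable_EFinP; exact: measurable_indic.
    rewrite integral_indic// setIC; apply: lee_wpmul2r => //.
    by rewrite lee_fin; nra.
  apply: le_trans (up 0%R 0%R _ _ D _ _ FD ml_ge0 mr_ge0 (emb_mass embl (nkF _ FD))
     (emb_mass embr (nkF _ FD))) _.
  apply: lee_wpmul2r => //; rewrite lee_fin ler_wpM2r// divr_ge0// addr_ge0//.
have kk : (0 < kap)%R by lra.
have kaplam : (kap <= lam)%R by nra.
split => //=.
- by move=> x; rewrite addr_ge0.
- move=> x nE; rewrite (emb_supp embl) ?(emb_supp embr) ?addr0//.
    by move/E2E.
  by move/E1E.
- exact: measurable_funD.
- by move=> i x; rewrite !addr_ge0//; case: ifP.
- move=> i; apply/(meas_wrtP (filtration_sigma filF i)).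
  apply: measurable_funD; first apply: measurable_funD.
  + exact/(meas_wrtP (filtration_sigma filF i))/(emb_bmeas embl).
  + exact/(meas_wrtP (filtration_sigma filF i))/(emb_bmeas embr).
  + case: eqP => [->|_]; last exact: measurable_cst.
    apply: measurable_funM; first exact: measurable_cst.
    apply: (@measurable_indic _ (g_sigma_algebraType (F n))).
    by rewrite (measurable_g_measurableTypeE (filtration_sigma filF n)).
- move=> D FD; apply: le_trans (avg_le _ FD) _; apply: lee_wpmul2r => //.
  by rewrite lee_fin ler_wpM2r// divr_ge0// addr_ge0//.
- have pN0 : p != 0%R by rewrite gt_eqF.
  rewrite (eq_integral (fun x => (gl x `^ p)%:E + (gr x `^ p)%:E)); last first.
    move=> x _; have [E1x|nE1x] := pselect (E1 x).
      rewrite (emb_supp embr) ?addr0 ?powR0 ?adde0// => E2x.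
      by have : (E1 `&` E2) x by []; rewrite E12.
    by rewrite (emb_supp embl)// add0r powR0// add0e.
  have mpow (g : T -> R) : measurable_fun setT g ->
      measurable_fun setT (fun x => (g x `^ p)%:E).
    by move=> mg; apply/measurable_EFinP; exact: (measurableT_comp (measurable_powR p) mg).
  rewrite ge0_integralD//; try by [move=> x _; rewrite lee_fin powR_ge0|exact: mpow].
  have := up 0%R 0%R _ _ setT _ _ (sigalgT (filtration_sigma filF n)) pl_ge0 pr_ge0.
  rewrite !setTI => h; apply: le_trans (h _ _ (emb_pow embl) (emb_pow embr)) _.
  apply: lee_wpmul2r => //; rewrite lee_fin ler_wpM2r// divr_ge0// addr_ge0//.
- apply: le_trans avg_ge _; apply: lee_wpmul2r; last by rewrite lee_fin.
  by apply: integral_ge0 => x _; rewrite lee_fin addr_ge0.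
(* Up to time n the set D lies in F_n and the mass bound with total mass at most C applies. After
   time n the node's own coefficient is gone, and the bounds of the subtrees add up because [E1] and
   [E2] are disjoint. *)
- move=> m D FD; case: (leqP m n) => mn.
    apply: le_trans (le_wseries _ _ _ _) _ => //.
      by move=> i x; rewrite !addr_ge0//; case: ifP.
    apply: le_trans (mass_le D (filtration_mono filF mn FD)) _.
    apply: lee_wpmul2r => //; rewrite lee_fin ler_wpM2l// ltW//.
  have mD := mFE _ _ FD.
  rewrite ws// leqNgt mn/= adde0.
  apply: le_trans (leeD (emb_carl embl FD) (emb_carl embr FD)) _.
  have : mu (D `&` E1) + mu (D `&` E2) <= mu (D `&` E).
    rewrite -measureU; [|exact: measurableI|exact: measurableI|]; last first.
      by rewrite setIACA setIid E12 setI0.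
    apply: le_measure; rewrite ?inE; [|exact: measurableI|].
      by apply: measurableU; exact: measurableI.
    by move=> x [[Dx /E1E]|[Dx /E2E]].
  rewrite !PE; [|exact: measurableI..].
  rewrite -!EFinM -!EFinD !lee_fin -mulrDr => h.
  apply: le_trans (ler_wpM2l _ h) _; first by rewrite mulr_ge0// ltW.
  by rewrite ler_wpM2r// ler_wpM2r// ltW.
- move=> f fn f0 mf gf ce fn0.
  have [mfn ifn fnE] := ce n.
  have mfnp i : measurable_fun setT (fun x => fn i x `^ p)%R.
    have [mfni _ _] := ce i; apply: (measurableT_comp (measurable_powR p)).
    exact: meas_wrt_measurable (@mFE i) _ _ _ mfni.
  rewrite ws//; last by move=> i x; exact: powR_ge0.
  have -> : (al * ((tavg l + tavg r) / 2) `^ p + (tvalue p l + tvalue p r) / 2)%:E * mu E =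
      (al * ((tavg l + tavg r) / 2) `^ p)%:E * mu E + ((tvalue p l + tvalue p r) / 2)%:E * mu E.
    by rewrite PE// -!EFinM -EFinD mulrDl.
  have w0 b : (forall i x, (0 <= b i x)%R) -> 0 <= wseries b (fun i x => fn i x `^ p)%R 0 setT.
    by move=> b0; apply: wseries_ge0 => // i x; exact: powR_ge0.
  have wl := w0 _ bl0; have wr := w0 _ br0.
  have i0 : 0 <= \int[mu]_x (al * \1_E x * fn n x `^ p)%:E.
    by apply: integral_ge0 => x _; rewrite lee_fin !mulr_ge0 ?powR_ge0.
  rewrite addeC (ge0_muleDr _ (adde_ge0 wl wr) i0); apply: leeD; last first.
    (* Jensen on E for the conditional expectation at time n *)
    set c := ((tavg l + tavg r) / 2)%R.
    have c0 : (0 <= c)%R by rewrite divr_ge0// addr_ge0//.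
    have ge1 : (c / kap2 * P E)%:E <= \int[mu]_(x in E) (f x)%:E.
      apply: (@le_trans _ _ (\int[mu]_(x in E) (gl x + gr x)%:E)).
        rewrite [leRHS]integral_mkcond (eq_integral (fun x => (gl x + gr x)%:E)).
          move: avg_ge; rewrite PE// -/c.
          rewrite -lee_pdivrMl; last lra.
          by rewrite -EFinM; congr (_%:E <= _); field; lra.
        move=> x _; rewrite patchE; case: ifPn => //; rewrite notin_setE => nE.
        rewrite (emb_supp embl) ?(emb_supp embr) ?addr0//; first by move/E2E.
        by move/E1E.
      apply: ge0_le_integral => //.
      - by move=> x _; rewrite lee_fin addr_ge0.
      - by apply/measurable_EFinP; exact/measurable_funTS/measurable_funD.
      - by apply/measurable_EFinP; exact/measurable_funTS.
    have J : (((c / kap2) `^ p) * P E)%:E <= \int[mu]_(x in E) (fn n x `^ p)%:E.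
      apply: (jensen_powR p1) => //; first by rewrite divr_ge0//; lra.
        exact: PE.
        by apply: measurable_funTS; exact: meas_wrt_measurable (@mFE n) _ _ _ mfn.
      by rewrite fnE.
    (* The loss [kap2] in the mean becomes exactly lam after taking p-th powers. *)
    have {}J : (c `^ p * P E)%:E <= lam%:E * \int[mu]_(x in E) (fn n x `^ p)%:E.
      move: J; rewrite powRM ?invr_ge0//; last lra.
      rewrite -(@powR_inv1 _ kap2); last lra.
      rewrite powRAC kap2p powR_inv1 ?(ltW lam0)// -lee_pdivrMl// -EFinM.
      by rewrite mulrA [(lam^-1 * _)%R]mulrC.
    have -> : \int[mu]_x (al * \1_E x * fn n x `^ p)%:E =
        al%:E * \int[mu]_(x in E) (fn n x `^ p)%:E.
      rewrite [in RHS]integral_mkcond -ge0_integralZl//.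
      - apply: eq_integral => x _; rewrite patchE indicE.
        by case: ifP => _; [rewrite mulr1 EFinM|rewrite mulr0 mul0r mule0].
      - apply/(measurable_restrictT _ mE)/measurable_EFinP/measurable_funTS/mfnp.
      - by move=> x _; rewrite patchE; case: ifP => // _; rewrite lee_fin powR_ge0.
    by rewrite PE// -EFinM -mulrA EFinM muleCA; apply: lee_wpmul2l.
  apply: le_trans (lo _ _ _ _ vl_ge0 vr_ge0 wl wr (emb_val embl f0 mf _ ce fn0)
    (emb_val embr f0 mf _ ce fn0)) _.
  + move=> x /E1E Ex; apply: le_trans (gf x Ex); by rewrite lerDl.
  + move=> x /E2E Ex; apply: le_trans (gf x Ex); by rewrite lerDr.
  + by apply: lee_wpmul2r; rewrite ?adde_ge0// lee_fin.
Qed.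

Theorem embeds_exists (p C lam : R) t n E : infinitely_refining mu F ->
  (1 < p)%R -> (0 < C)%R -> (1 < lam)%R -> F n E -> tcarleson C t ->
  exists g b, embeds p C lam t n E g b.
Proof.
move=> refF p1 C0 lam1 FE ct.
elim: t lam n E lam1 FE ct => [v|al l ihl r ihr] lam n E lam1 FE ct.
  by exists (fun x => v * \1_E x)%R, (fun _ _ => 0%R); exact: embeds_leaf.
apply: embeds_node => //; case: ct => _ _ cl cr lam' n' E' lam'1 FE'.
  exact: ihl.
exact: ihr.
Qed.

End embedding.

(** * Dyadic intervals and truncation of a dyadic candidate to a tree *)

Section dyadic_intervals.
Context {R : realType}.

Lemma dyad_measurable k j : measurable (dyad k j : set R).
Proof. exact: measurable_itv. Qed.

Lemma exp2_gt0 k : 0 < (2 ^+ k : R).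
Proof. by rewrite exprn_gt0. Qed.

Lemma dyad_sub k j : (j < 2 ^ k)%N -> (dyad k j : set R) `<=` I01.
Proof.
move=> jk x; rewrite /dyad /I01 /= !in_itv/= => /andP[h1 h2].
apply/andP; split; first by apply: le_trans h1; rewrite divr_ge0// exprn_ge0.
apply: lt_le_trans h2 _; rewrite ler_pdivrMr ?exp2_gt0// mul1r -natrX ler_nat.
exact: jk.
Qed.

Lemma dyad_half k j : (j.*2%:R / 2 ^+ k.+1 : R) = j%:R / 2 ^+ k.
Proof.
rewrite -muln2 natrM exprSr -mulf_div divff ?mulr1// pnatr_eq0//.
Qed.

Lemma dyad_split k j :
  (dyad k j : set R) = dyad k.+1 j.*2 `|` dyad k.+1 j.*2.+1.
Proof.
have e : (j.*2.+2%:R / 2 ^+ k.+1 : R) = j.+1%:R / 2 ^+ k by rewrite -(dyad_half k j.+1) doubleS.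
rewrite /dyad e dyad_half; set m := (_.+1%:R / 2 ^+ k.+1).
rewrite -itv_bndbnd_setU// bnd_simp /m.
  by rewrite -dyad_half ler_pM2r ?invr_gt0 ?exp2_gt0// ler_nat.
by rewrite -e ler_pM2r ?invr_gt0 ?exp2_gt0// ler_nat.
Qed.

Lemma dyad_disj k j : [disjoint (dyad k.+1 j.*2 : set R) & dyad k.+1 j.*2.+1].
Proof.
apply/disj_setPS => x []; rewrite /dyad /= !in_itv/= => /andP[_ h1] /andP[h2 _].
by move: (lt_le_trans h1 h2); rewrite ltxx.
Qed.

Lemma dyad_lebesgue k j :
  lebesgue_measure (dyad k j : set R) = ((2 ^+ k)^-1)%:E.
Proof.
rewrite /dyad lebesgue_measure_itv/= lte_fin ltr_pM2r ?invr_gt0 ?exp2_gt0//.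
rewrite ltr_nat ltnSn -EFinD -mulrBl -natrB// subSnn mul1r//.
Qed.

Lemma dyad00 : (dyad 0 0 : set R) = I01.
Proof. by rewrite /dyad /I01 !expr0 !divr1. Qed.

(** The level-k ancestor of an interval is obtained from its level-(k+1) ancestor by halving the
    index, so the proper descendants of (k, j) split between its two children. *)
Lemma dyad_subsum_recl (a : nat -> nat -> R) k j : (forall k j, 0 <= a k j) ->
  (j < 2 ^ k)%N ->
  dyad_subsum a k j = ((a k j)%:E + (dyad_subsum a k.+1 j.*2 +
                       dyad_subsum a k.+1 j.*2.+1))%E.
Proof.
move=> a0 jk; rewrite /dyad_subsum.
have s0 k' (P : pred nat) : (0 <= \sum_(j' < 2 ^ k' | P j') (a k' j')%:E)%E.
  by apply: sume_ge0 => i _; rewrite lee_fin.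
rewrite (nneseries_split k 1)//=; last by move=> k' _; exact: (s0 k' (fun j' => (j' %/ 2 ^ (k' - k) == j)%N)).
rewrite addn1 big_nat1; congr (_ + _)%E.
  rewrite subnn expn0 (eq_bigl (fun i : 'I__ => i == Ordinal jk)) ?big_pred1_eq//.
  by move=> i; rewrite divn1 -val_eqE.
rewrite -nneseriesD; last 2 first.
- by move=> k' _ _; exact: (s0 k' (fun j' => (j' %/ 2 ^ (k' - k.+1) == j.*2)%N)).
- by move=> k' _ _; exact: (s0 k' (fun j' => (j' %/ 2 ^ (k' - k.+1) == j.*2.+1)%N)).
rewrite eseries_cond [RHS]eseries_cond; apply: eq_eseriesr => k'; rewrite andTb => kk'.
have e : (k' - k = (k' - k.+1).+1)%N by lia.
rewrite e; set m := (k' - k.+1)%N.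
rewrite (bigID (fun j' : 'I__ => (j' %/ 2 ^ m == j.*2)%N))/=.
have h (j' : nat) : (j' %/ 2 ^ m.+1 = (j' %/ 2 ^ m) %/ 2)%N.
  by rewrite expnSr divnMA.
congr (_ + _)%E; apply: eq_bigl => j'; rewrite h; move: (j' %/ 2 ^ m)%N => q;
  rewrite -!muln2; apply/idP/idP; lia.
Qed.

Lemma sum_double n (G : nat -> R) :
  \sum_(j < n.*2) G j = \sum_(j < n) (G j.*2 + G j.*2.+1).
Proof.
elim: n => [|n ih]; first by rewrite !big_ord0.
by rewrite doubleS !big_ord_recr/= ih addrA.
Qed.

Lemma sum_exp2S k (G : nat -> R) :
  \sum_(j < 2 ^ k.+1) G j = \sum_(j < 2 ^ k) (G j.*2 + G j.*2.+1).
Proof. by rewrite -sum_double -!(big_mkord xpredT G) expnSr muln2. Qed.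

End dyadic_intervals.

Section dyadic_tree.
Context {R : realType}.
Variables (p C Fv fv M : R) (f : R -> R) (a : nat -> nat -> R).
Hypotheses (p1 : 1 < p) (C0 : 0 < C).
Hypotheses (mf : measurable_fun I01 f) (f0 : forall x, I01 x -> 0 <= f x).
Hypothesis fF : (\int[lebesgue_measure]_(x in I01) ((f x) `^ p)%:E = Fv%:E)%E.
Hypothesis ff : (\int[lebesgue_measure]_(x in I01) (f x)%:E = fv%:E)%E.
Hypothesis a0 : forall k j, 0 <= a k j.
Hypothesis aM : (\sum_(0 <= k <oo) \sum_(j < 2 ^ k) (a k j)%:E)%E = M%:E.
Hypothesis aC : forall k j, (j < 2 ^ k)%N -> (dyad_subsum a k j <= (C / 2 ^+ k)%:E)%E.

Let A k j : R := fine (dyad_avg f k j).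

Let mI01 : measurable (@I01 R). Proof. exact: measurable_itv. Qed.

Let double_lt k j : (j < 2 ^ k)%N -> (j.*2 < 2 ^ k.+1)%N /\ (j.*2.+1 < 2 ^ k.+1)%N.
Proof. by rewrite expnSr muln2 -!muln2 => h; split; lia. Qed.

Lemma dyad_int_split (h : R -> R) k j : measurable_fun I01 h ->
  (forall x, I01 x -> 0 <= h x) -> (j < 2 ^ k)%N ->
  (\int[lebesgue_measure]_(x in dyad k j) (h x)%:E =
   \int[lebesgue_measure]_(x in dyad k.+1 j.*2) (h x)%:E +
   \int[lebesgue_measure]_(x in dyad k.+1 j.*2.+1) (h x)%:E)%E.
Proof.
move=> mh h0 jk; rewrite dyad_split ge0_integral_setU//.
- exact: dyad_measurable.
- exact: dyad_measurable.
- by rewrite -dyad_split; apply/measurable_EFinP; apply: measurable_funS mh => //; exact: dyad_sub.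
- by move=> x; rewrite -dyad_split => /(dyad_sub jk) ?; rewrite lee_fin h0.
- exact: dyad_disj.
Qed.

Lemma dyad_int_fin (h : R -> R) c k j : measurable_fun I01 h ->
  (forall x, I01 x -> 0 <= h x) -> (j < 2 ^ k)%N ->
  (\int[lebesgue_measure]_(x in I01) (h x)%:E = c%:E)%E ->
  (\int[lebesgue_measure]_(x in dyad k j) (h x)%:E)%E \is a fin_num.
Proof.
move=> mh h0 jk hc; rewrite ge0_fin_numE; last first.
  by apply: integral_ge0 => x /(dyad_sub jk) ?; rewrite lee_fin h0.
apply: (@le_lt_trans _ _ c%:E); last by rewrite ltry.
rewrite -hc; apply: ge0_subset_integral => //.
- exact: dyad_measurable.
- exact/measurable_EFinP.
- exact: dyad_sub.
Qed.

Lemma dyad_avgE k j : (j < 2 ^ k)%N -> dyad_avg f k j = (A k j)%:E.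
Proof.
by move=> jk; rewrite /A fineK// /dyad_avg fin_numM// (dyad_int_fin mf f0 jk ff).
Qed.

Lemma dyad_avg_ge0 k j : (j < 2 ^ k)%N -> 0 <= A k j.
Proof.
move=> jk; rewrite fine_ge0// mule_ge0// ?lee_fin ?(ltW (exp2_gt0 _))//.
by apply: integral_ge0 => x /(dyad_sub jk) ?; rewrite lee_fin f0.
Qed.

Let intA k j : (j < 2 ^ k)%N ->
  (\int[lebesgue_measure]_(x in dyad k j) (f x)%:E = (A k j / 2 ^+ k)%:E)%E.
Proof.
move=> jk; have := dyad_avgE jk; rewrite /dyad_avg.
rewrite -(fineK (dyad_int_fin mf f0 jk ff)) -EFinM => -[<-].
by rewrite mulrAC divff ?mul1r// gt_eqF// exp2_gt0.
Qed.

Lemma dyad_avg_split k j : (j < 2 ^ k)%N ->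
  A k j = (A k.+1 j.*2 + A k.+1 j.*2.+1) / 2.
Proof.
move=> jk; have [j1 j2] := double_lt jk.
have := dyad_int_split mf f0 jk; rewrite !intA// -EFinD -mulrDl exprSr => -[].
have k0 := exp2_gt0 (R := R) k; move=> e.
by apply: (mulIf (x := (2 ^+ k)^-1)); rewrite ?invr_neq0 ?gt_eqF// e; field; lra.
Qed.

(** The factor 2^k divides the coefficient by the interval length; dividing [tmass] or [tvalue] by
    2^k recovers unnormalised sums. *)
Fixpoint dyadic_dtree N k j : dtree R :=
  if N is N'.+1 then
    Node (2 ^+ k * a k j) (dyadic_dtree N' k.+1 j.*2) (dyadic_dtree N' k.+1 j.*2.+1)
  else Leaf (A k j).

Lemma tavg_dyadic_dtree N k j : (j < 2 ^ k)%N -> tavg (dyadic_dtree N k j) = A k j.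
Proof.
elim: N k j => //= N ih k j jk; have [j1 j2] := double_lt jk.
by rewrite !ih// -dyad_avg_split.
Qed.

Let mfp : measurable_fun I01 (fun x => f x `^ p).
Proof. exact: (measurableT_comp (measurable_powR p) mf). Qed.

Let fp0 x : I01 x -> 0 <= f x `^ p. Proof. by rewrite powR_ge0. Qed.

(** Jensen on each leaf interval: replacing f by its averages can only lower the p-th moment. *)
Lemma tpow_dyadic_dtree N k j : (j < 2 ^ k)%N ->
  ((tpow p (dyadic_dtree N k j) / 2 ^+ k)%:E <=
   \int[lebesgue_measure]_(x in dyad k j) ((f x) `^ p)%:E)%E.
Proof.
elim: N k j => [|N ih] k j jk /=.
  apply: (jensen_powR p1 (dyad_avg_ge0 jk) _ (dyad_lebesgue _ _)).
  - exact: dyad_measurable.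
  - by apply: measurable_funS mf => //; exact: dyad_sub.
  - by move=> x /(dyad_sub jk); exact: f0.
  - by rewrite intA.
have [j1 j2] := double_lt jk.
rewrite (dyad_int_split mfp fp0 jk); apply: le_trans (leeD (ih _ _ j1) (ih _ _ j2)).
rewrite -EFinD lee_fin le_eqVlt; apply/orP; left; apply/eqP.
by rewrite exprSr; field; rewrite gt_eqF// exp2_gt0.
Qed.

Lemma dyad_subsum_ge0 k j : (0 <= dyad_subsum a k j)%E.
Proof.
by apply: nneseries_ge0 => k' _ _; apply: sume_ge0 => i _; rewrite lee_fin.
Qed.

Lemma tmass_dyadic_dtree N k j : (j < 2 ^ k)%N ->
  ((tmass (dyadic_dtree N k j) / 2 ^+ k)%:E <= dyad_subsum a k j)%E.
Proof.
elim: N k j => [|N ih] k j jk /=; first by rewrite mul0r dyad_subsum_ge0.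
have [j1 j2] := double_lt jk.
rewrite dyad_subsum_recl//.
apply: le_trans (leeD (lexx _) (leeD (ih _ _ j1) (ih _ _ j2))).
rewrite -!EFinD lee_fin le_eqVlt; apply/orP; left; apply/eqP.
by rewrite exprSr; field; rewrite gt_eqF// exp2_gt0.
Qed.

Lemma tcarleson_dyadic_dtree N k j : (j < 2 ^ k)%N ->
  tcarleson C (dyadic_dtree N k j).
Proof.
elim: N k j => [|N ih] k j jk; first exact: dyad_avg_ge0.
have [j1 j2] := double_lt jk.
split; [|  |exact: ih|exact: ih].
  by rewrite mulr_ge0// ltW// exp2_gt0.
have := le_trans (tmass_dyadic_dtree N.+1 jk) (aC jk).
by rewrite lee_fin ler_pM2r// invr_gt0 exp2_gt0.
Qed.

(** Stated for a whole generation at once, since the partial sums of the series run over whole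
    generations. *)
Lemma tvalue_dyadic_dtree N k :
  \sum_(j < 2 ^ k) tvalue p (dyadic_dtree N k j) / 2 ^+ k =
  \sum_(k <= k' < k + N) \sum_(j < 2 ^ k') a k' j * A k' j `^ p.
Proof.
elim: N k => [|N ih] k.
  by rewrite addn0 big_geq// big1// => j _ /=; rewrite mul0r.
rewrite addnS big_nat_recl ?leq_addr//.
rewrite -(big_add1 _ _ k (k + N).+1 xpredT (fun i => \sum_(j < 2 ^ i) a i j * A i j `^ p)).
rewrite -addSn -ih.
rewrite (sum_exp2S _ (fun j => tvalue p (dyadic_dtree N k.+1 j) / 2 ^+ k.+1)).
rewrite -big_split/=; apply: eq_bigr => -[j jk] _ /=; have [j1 j2] := double_lt jk.
rewrite !tavg_dyadic_dtree// -dyad_avg_split// exprSr.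
by field; rewrite gt_eqF// exp2_gt0.
Qed.

(** The values of the truncations are the partial sums of v, so one of them reaches b. Truncation
    keeps the mean exactly but may lower the p-th moment and the mass, hence the inequalities. *)
Lemma dyadic_dtree_approx (v : \bar R) (b : R) :
  v = (\sum_(0 <= k <oo) \sum_(j < 2 ^ k)
         ((a k j)%:E * poweR (dyad_avg f k j) p))%E ->
  (b%:E < v)%E ->
  exists t : dtree R, [/\ tcarleson C t, tavg t = fv, tpow p t <= Fv,
                          tmass t <= M & b <= tvalue p t].
Proof.
move=> -> bv.
have z1 : (0 < 2 ^ 0)%N by [].
have [N bN] : exists N, b <= tvalue p (dyadic_dtree N 0 0).
  apply: contrapT => nN; move: bv; rewrite ltNge => /negP; apply.
  have t0 k : (0 <= \sum_(j < 2 ^ k) ((a k j)%:E * poweR (dyad_avg f k j) p))%E.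
    by apply: sume_ge0 => j _; rewrite mule_ge0// ?lee_fin// poweR_ge0.
  apply: lime_le; first by apply: is_cvg_nneseries => k _ _; exact: t0.
  apply: nearW => N.
  have -> : (\sum_(0 <= k < N) \sum_(j < 2 ^ k) ((a k j)%:E * poweR (dyad_avg f k j) p) =
      (\sum_(0 <= k < N) \sum_(j < 2 ^ k) a k j * A k j `^ p)%:E)%E.
    rewrite -sumEFin; apply: eq_bigr => k _; rewrite -sumEFin; apply: eq_bigr => -[j jk] _ /=.
    by rewrite dyad_avgE.
  rewrite -[N]add0n -tvalue_dyadic_dtree expn0 big_ord_recl big_ord0 addr0 expr0 divr1 lee_fin.
  by rewrite leNgt; apply/negP => h; apply: nN; exists N; exact: ltW.
exists (dyadic_dtree N 0 0); split => //.
- exact: tcarleson_dyadic_dtree.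
- by rewrite tavg_dyadic_dtree// /A /dyad_avg expr0 mul1e dyad00 ff.
- by have := tpow_dyadic_dtree N z1; rewrite dyad00 fF expr0 divr1 lee_fin.
- have := tmass_dyadic_dtree N z1; rewrite expr0 divr1 -lee_fin -aM.
  move/le_trans; apply; rewrite le_eqVlt; apply/orP; left; apply/eqP.
  apply: eq_eseriesr => k _; apply: eq_bigl => j; rewrite subn0 divn_small//.
Qed.

End dyadic_tree.

(** * Building admissible martingale data *)

Section martingale_lower_bound.
Local Open Scope ereal_scope.
Context d (T : measurableType d) (R : realType) (mu : probability T R).
Variable F : nat -> set (set T).
Hypothesis filF : filtration F.
Let mFE := filtration_measurable filF.
Let one : nat -> T -> R := fun _ _ => 1%R.

Let one0 i x : (0 <= one i x)%R. Proof. exact: ler01. Qed.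
Let mone i : measurable_fun setT (one i). Proof. exact: measurable_cst. Qed.

Lemma integral_series_wseries (b w : nat -> T -> R) m D : measurable D ->
  (forall i x, (0 <= b i x)%R) -> (forall i x, (0 <= w i x)%R) ->
  (forall i, measurable_fun setT (b i)) ->
  (forall i, measurable_fun setT (w i)) ->
  \int[mu]_(x in D) (\sum_(m <= i <oo) (b i x * w i x)%:E) = wseries mu b w m D.
Proof.
move=> mD b0 w0 mb mw.
have t0 i x : 0 <= (b i x * w i x)%:E by rewrite lee_fin mulr_ge0.
under eq_integral do rewrite -nneseries_addn//.
rewrite integral_nneseries//; last first.
  move=> i; apply/measurable_EFinP; exact/measurable_funTS/measurable_funM.
by rewrite /wseries -[RHS]nneseries_addn// => i; apply: integral_ge0 => x _.
Qed.

Lemma wseriesZ (c : R) (b w : nat -> T -> R) m D : measurable D -> (0 <= c)%R ->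
  (forall i x, (0 <= b i x)%R) -> (forall i x, (0 <= w i x)%R) ->
  (forall i, measurable_fun setT (b i)) ->
  (forall i, measurable_fun setT (w i)) ->
  wseries mu (fun i x => c * b i x)%R w m D = c%:E * wseries mu b w m D.
Proof.
move=> mD c0 b0 w0 mb mw; rewrite /wseries -nneseriesZl; last first.
  by move=> i _; apply: integral_ge0 => x _; rewrite lee_fin mulr_ge0.
apply: eq_eseriesr => i _; rewrite -ge0_integralZl//.
- by apply: eq_integral => x _; rewrite -mulrA EFinM.
- by apply/measurable_EFinP; exact/measurable_funTS/measurable_funM.
- by move=> x _; rewrite lee_fin mulr_ge0.
Qed.

Lemma wseries_powRZ (p c : R) (b w : nat -> T -> R) m D : measurable D -> (0 <= c)%R ->
  (forall i x, (0 <= b i x)%R) -> (forall i x, (0 <= w i x)%R) ->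
  (forall i, measurable_fun setT (b i)) ->
  (forall i, measurable_fun setT (fun x => w i x `^ p)%R) ->
  wseries mu b (fun i x => (c * w i x) `^ p)%R m D =
  (c `^ p)%:E * wseries mu b (fun i x => w i x `^ p)%R m D.
Proof.
move=> mD c0 b0 w0 mb mw.
have wp0 i x : (0 <= w i x `^ p)%R by exact: powR_ge0.
rewrite -(wseriesZ m mD (powR_ge0 c p) b0 wp0 mb mw).
apply: eq_eseriesr => i _; apply: eq_integral => x _.
by rewrite powRM// mulrCA mulrA.
Qed.

Lemma cond_expZ (G : set (set T)) (c : R) (X Y : T -> R) :
  G `<=` measurable ->
  mu.-integrable setT (EFin \o X) -> is_cond_exp mu G X Y ->
  is_cond_exp mu G (fun x => c * X x)%R (fun x => c * Y x)%R.
Proof.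
move=> Gm iX [mY iY YE]; split.
- by apply: (meas_wrt_comp (h := fun y : R => c * y)%R mY); exact: measurable_funM.
- by apply: eq_integrable (integrableZl measurableT c iY).
- move=> A GA; have mA := Gm _ GA.
  under eq_integral do rewrite EFinM.
  under [RHS]eq_integral do rewrite EFinM.
  rewrite !integralZl//; [by rewrite YE|exact: (integrableS measurableT)..].
Qed.

(* A Carleson sequence only needs the bound in integrated form: the conditional
   expectations of its tails then exist, and can be chosen bounded by C. *)
Lemma carleson_of_integrals (C : R) (b : nat -> T -> R) :
  (0 < C)%R -> (forall i x, (0 <= b i x)%R) -> (forall i, meas_wrt (F i) (b i)) ->
  (forall n A, F n A -> wseries mu b one n A <= C%:E * mu A) ->
  carleson mu F C b.
Proof.
move=> C0 b0 mb bC; split=> // n.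
have mb' i := meas_wrt_measurable (@mFE i) (mb i).
pose X x := \sum_(n <= k <oo) (b k x)%:E.
have X0 x : 0 <= X x by apply: nneseries_ge0 => i _ _; rewrite lee_fin.
have XE A : measurable A -> \int[mu]_(x in A) X x = wseries mu b one n A.
  move=> mA; rewrite -integral_series_wseries//; apply: eq_integral => x _.
  by apply: eq_eseriesr => i _; rewrite mulr1.
have mX : measurable_fun setT X.
  rewrite (_ : X = (fun x => \sum_(0 <= i <oo) (b (i + n)%N x)%:E)).
    apply: ge0_emeasurable_sum => //.
      by move=> i x _ _; rewrite lee_fin.
    by move=> i _; apply/measurable_EFinP.
  by apply/funext => x; rewrite /X -nneseries_addn// => i; rewrite lee_fin.
have iX : mu.-integrable setT X.
  apply/integrableP; split=> //.
  under eq_integral do rewrite gee0_abs//.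
  rewrite XE//; apply: le_lt_trans (bC n _ (sigalgT (filtration_sigma filF n))) _.
  by rewrite probability_setT mule1 ltry.
have aeX A : measurable A -> \int[mu]_(x in A) (fine (X x))%:E = \int[mu]_(x in A) X x.
  move=> mA; apply: ae_eq_integral => //.
  - by apply/measurable_funTS; apply/measurable_EFinP; exact: measurableT_comp.
  - exact: measurable_funTS.
  - have [N [mN N0 NE]] := integrable_ae measurableT iX.
    exists N; split=> // x /= h; apply: NE => /= h'; apply: h => _.
    by rewrite fineK// h'.
have iX' : mu.-integrable setT (EFin \o (fine \o X)).
  apply/integrableP; split.
    by apply/measurable_EFinP; exact: measurableT_comp.
  under eq_integral do rewrite /= ger0_norm ?fine_ge0//.
  rewrite aeX// XE//; apply: le_lt_trans (bC n _ (sigalgT (filtration_sigma filF n))) _.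
  by rewrite probability_setT mule1 ltry.
have XC A : F n A -> \int[mu]_(x in A) ((fine \o X) x)%:E <= C%:E * mu A.
  by move=> FA; have mA := mFE FA; rewrite aeX// XE//; exact: bC.
have [Y [mY iY YE] Y0] := @cond_exp_exists_bounded _ _ _ mu (F n)
  (filtration_sigma filF n) (@mFE n) (fine \o X) C iX' (fun x => fine_ge0 (X0 x)) (ltW C0) XC.
exists (EFin \o Y); split; [split|].
- by move=> x /=; rewrite lee_fin; have /andP[] := Y0 x.
- by apply: (meas_wrt_comp mY); exact: EFin_measurable.
- by move=> A FA; rewrite YE// aeX//; exact: mFE FA.
- by move=> x /=; rewrite lee_fin; have /andP[] := Y0 x.
Qed.

(** Adding the constant M minus the mass of b at time 0 makes the total mass exactly M. It affects
    the Carleson condition at time 0 only, where F_0 is trivial and the condition reads M <= C. *)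
Lemma mart_bellman_ge (p C Fv fv M : R) (f : T -> R) (b : nat -> T -> R) (z : \bar R) :
  (0 < C)%R -> (0 <= M <= C)%R ->
  (forall x, (0 <= f x)%R) -> measurable_fun setT f ->
  \int[mu]_x ((f x) `^ p)%:E = Fv%:E -> \int[mu]_x (f x)%:E = fv%:E ->
  (forall i x, (0 <= b i x)%R) -> (forall i, meas_wrt (F i) (b i)) ->
  (forall n A, (0 < n)%N -> F n A -> wseries mu b one n A <= C%:E * mu A) ->
  wseries mu b one 0 setT <= M%:E ->
  (forall fn, (forall i, is_cond_exp mu (F i) f (fn i)) ->
    (forall i x, (0 <= fn i x)%R) ->
    z <= wseries mu (fun i x => b i x + (if i == 0%N then
             M - fine (wseries mu b one 0 setT) else 0))%R
           (fun i x => fn i x `^ p)%R 0 setT) ->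
  z <= mart_bellman mu F p C Fv fv M.
Proof.
move=> C0 /andP[M0 MC] f0 mf fF ff b0 mb bC bM zle.
have mb' i := meas_wrt_measurable (@mFE i) (mb i).
have if_ : mu.-integrable setT (EFin \o f).
  apply/integrableP; split; first exact/measurable_EFinP.
  under eq_integral do rewrite /= ger0_norm//.
  by rewrite ff ltry.
have /choice[fn fnP] : forall i, exists fi,
    is_cond_exp mu (F i) f fi /\ forall x, (0 <= fi x)%R.
  move=> i; have [Y YE Y0] := cond_exp_exists_ge0 (filtration_sigma filF i) (@mFE i) if_ f0.
  by exists Y.
pose tot := fine (wseries mu b one 0 setT).
have ws0 : 0 <= wseries mu b one 0 setT by apply: wseries_ge0.
have totE : wseries mu b one 0 setT = tot%:E.
  by rewrite /tot fineK// ge0_fin_numE// (le_lt_trans bM)// ltry.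
have totM : (tot <= M)%R by rewrite -lee_fin -totE.
pose r := (M - tot)%R; have r0 : (0 <= r)%R by rewrite subr_ge0.
pose a i x := (b i x + (if i == 0%N then r else 0))%R.
have s0 i (x : T) : (0 <= if i == 0%N then r else 0)%R by case: ifP.
have ms i : measurable_fun setT (fun x : T => if i == 0%N then r else 0)%R by [].
have aw (w : nat -> T -> R) n A : measurable A -> (forall i x, (0 <= w i x)%R) ->
    (forall i, measurable_fun setT (w i)) ->
    wseries mu a w n A = wseries mu b w n A +
      (if (n <= 0)%N then \int[mu]_(x in A) (r * w 0%N x)%:E else 0).
  move=> mA w0 mw; rewrite (@wseriesD _ _ _ mu b (fun i _ => if i == 0%N then r else 0)%R w n A mA b0 s0 w0 mb' ms mw).
  by rewrite (@wseries_single _ _ _ mu 0%N n (cst r)).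
have a0 i x : (0 <= a i x)%R by apply: addr_ge0 => //; exact: (s0 i x).
have ma i : meas_wrt (F i) (a i).
  apply: (meas_wrt_comp (h := fun y : R => y + (if i == 0%N then r else 0))%R (mb i)).
  exact: measurable_funD.
have aM : wseries mu a one 0 setT = M%:E.
  rewrite aw//= totE; under eq_integral do rewrite mulr1.
  by rewrite integral_cst//= [X in _ * X](_ : _ = 1) ?mule1 -?EFinD /r ?[RHS]addrC ?subrK//; [congr (_%:E); lra|exact: probability_setT].
have fn0 i x : (0 <= fn i x)%R by have [_] := fnP i; apply.
have mfn i : measurable_fun setT (fun x => fn i x `^ p)%R.
  have [[mfni _ _] _] := fnP i; apply: (measurableT_comp (measurable_powR p)).
  exact: meas_wrt_measurable (@mFE i) _ _ _ mfni.
apply: le_trans (zle fn (fun i => (fnP i).1) fn0) _.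
rewrite -/tot -/r -/a.
apply: ereal_sup_ubound; exists f, fn, a; split=> //; split=> //; split=> //; split=> //.
split; first by move=> i; have [] := fnP i.
split.
  apply: carleson_of_integrals => // n A FA; have mA := mFE FA.
  case: n FA => [|n] FA; last first.
    by rewrite aw//= adde0; exact: bC.
  case: filF => _ _ _ F0; move: FA; rewrite F0 => -[->|->].
    by rewrite measure0 mule0 /wseries eseries0// => i _ _; rewrite integral_set0.
  by rewrite aM probability_setT mule1 lee_fin.
split.
  rewrite -aM -integral_series_wseries//; last by move=> i; exact: meas_wrt_measurable (@mFE i) _ _ _ (ma i).
  by apply: eq_integral => x _; apply: eq_eseriesr => i _; rewrite mulr1.
rewrite -integral_series_wseries//; first by move=> i x; exact: powR_ge0.
by move=> i; exact: meas_wrt_measurable (@mFE i) _ _ _ (ma i).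
Qed.

End martingale_lower_bound.

(** * Correcting both moments on a small set *)

Section two_values.
Context {R : realType}.

Lemma powR_continuous (p x : R) : 0 < x -> {for x, continuous (fun y : R => y `^ p)}.
Proof.
move=> x0; apply: differentiable_continuous; apply/derivable1_diffP.
by apply: derivable_powR; rewrite in_itv/= x0.
Qed.

(** Intermediate value theorem along the line x s1 + y s2 = A. At x = y the p-th moment is the
    constant function's, at most B; at x = A / (2 s1) the first term alone is at least B. Both
    values stay positive in between, where the power is continuous. *)
Lemma two_values_exist (p A B s1 s2 : R) : 1 < p -> 0 < A -> 0 < s1 -> 0 < s2 ->
  s1 <= s2 ->
  (A / (s1 + s2)) `^ p * (s1 + s2) <= B -> B <= (A / (2 * s1)) `^ p * s1 ->
  exists x y, [/\ 0 <= x, 0 <= y, x * s1 + y * s2 = A &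
    x `^ p * s1 + y `^ p * s2 = B].
Proof.
move=> p1 A0 s10 s20 s12 hl hr.
pose Y (x : R) := (A - x * s1) / s2.
pose psi (x : R) := x `^ p * s1 + Y x `^ p * s2.
pose a := A / (s1 + s2); pose b := A / (2 * s1).
have s0 : 0 < s1 + s2 by lra.
have a0 : 0 < a by rewrite divr_gt0.
have ab : a <= b by rewrite ler_pM2l// lef_pV2 ?posrE ?mulr_gt0//; lra.
have bE : b * s1 = A / 2 by rewrite /b; field; lra.
have Yx x : x <= b -> 0 < Y x.
  by move=> xb; rewrite divr_gt0// subr_gt0; have := ler_wpM2r (ltW s10) xb; lra.
have Ya : Y a = a by rewrite /Y /a; field; rewrite !gt_eqF.
have cont : {within `[a, b], continuous psi}.
  apply: continuous_in_subspaceT => x /set_mem/=; rewrite in_itv/= => /andP[ax xb].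
  change (psi y @[y --> x] --> psi x); rewrite /psi.
  have cY : Y y @[y --> x] --> Y x.
    apply: cvgM; last exact: cvg_cst.
    apply: cvgB; first exact: cvg_cst.
    by apply: cvgM; [exact: cvg_id|exact: cvg_cst].
  apply: cvgD; apply: cvgM; try exact: cvg_cst.
    by apply: powR_continuous; lra.
  by apply: (@cvg_comp _ _ _ Y (fun y : R => y `^ p) _ _ _ cY); exact/powR_continuous/Yx.
have psia : psi a <= B.
  by rewrite /psi Ya -mulrDr.
have psib : B <= psi b.
  by apply: le_trans hr _; rewrite /psi lerDl mulr_ge0 ?powR_ge0 ?(ltW s20).
have [|x] := @IVT R psi a b B ab cont.
  by rewrite ge_min psia/= le_max psib orbT.
rewrite in_itv/= => /andP[ax xb] psix.
exists x, (Y x); split => //; first by lra.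
  exact/ltW/Yx.
by rewrite /Y divfK ?gt_eqF//; ring.
Qed.

End two_values.

Section small_sets.
Context d (T : measurableType d) (R : realType) (mu : probability T R).
Variable F : nat -> set (set T).
Hypothesis filF : filtration F.

(** Iterated halving with factor 3/2: each step multiplies the measure by at most 3/4, and the lower
    bound in [halving] keeps it positive. *)
Lemma small_subset n E (e : R) : infinitely_refining mu F -> F n E ->
  (0 < mu E)%E -> 0 < e ->
  exists k S, [/\ F k S, S `<=` E, (0 < mu S)%E & (mu S < e%:E)%E].
Proof.
move=> refF FE E0 e0.
have H m : exists k S, [/\ F k S, S `<=` E, (0 < mu S)%E &
    (mu S <= ((3 / 4) ^+ m)%:E)%E].
  elim: m => [|m [k [S [FS SE S0 Sm]]]].
    exists n, E; split=> //; rewrite expr0; apply: probability_le1.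
    exact: filtration_measurable FE.
  have k1 : 1 < (3 / 2 : R) by lra.
  have [k' [E1 [_ [[_ FE1 _ [E1S _]] [_ up _ lo _]]]]] := halving filF refF FS k1.
  have mE1 := filtration_measurable filF FE1.
  exists k', E1; split=> //; first by move=> x /E1S/SE.
    rewrite lt0e measure_ge0 andbT; apply: contraTneq S0 => E10.
    by rewrite -leNgt; move: lo; rewrite E10 mule0.
  have := up _ (sigalgT (filtration_sigma filF k)); rewrite !setTI => h.
  apply: le_trans h _; rewrite exprS [leRHS]EFinM.
  have -> : (3 / 2 / 2 : R) = 3 / 4 by field.
  by rewrite lee_wpmul2l// lee_fin; lra.
have [m me] : exists m, (3 / 4 : R) ^+ m < e.
  have q : `|(3 / 4 : R)| < 1 by rewrite ger0_norm; lra.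
  have /cvgrPdist_lt/(_ e e0)[m _ /(_ m (leqnn m))] := cvg_expr q.
  by rewrite sub0r normrN ger0_norm ?exprn_ge0//; exists m.
have [k [S [FS SE S0 Sm]]] := H m.
by exists k, S; split=> //; apply: le_lt_trans Sm _; rewrite lte_fin.
Qed.

End small_sets.

Section powR_roots.
Context {R : realType}.
Implicit Types x y p : R.

Lemma powR_invK p x : 0 < p -> 0 <= x -> (x `^ p^-1) `^ p = x.
Proof. by move=> p0 x0; rewrite -powRrM mulVf ?powRr1// gt_eqF. Qed.

Lemma ler_powR2r p x y : 0 < p -> 0 <= x -> 0 <= y -> (x `^ p <= y `^ p) = (x <= y).
Proof.
move=> p0 x0 y0; apply/idP/idP => [|xy].
  by apply: contraTT; rewrite -!ltNge => yx; apply: gt0_ltr_powR; rewrite ?nnegrE.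
by apply: ge0_ler_powR; rewrite ?nnegrE// ltW.
Qed.

Lemma ltr_powR2r p x y : 0 < p -> 0 <= x -> 0 <= y -> (x `^ p < y `^ p) = (x < y).
Proof. by move=> p0 x0 y0; rewrite !ltNge ler_powR2r. Qed.

(** Take lam with lam^(2 + p) = min(1/q, 1/(1 - s)), which is greater than 1. *)
Lemma slack_exists (p q s : R) : 1 < p -> 0 < q < 1 -> 0 < s <= 2^-1 ->
  exists lam : R, [/\ 1 < lam, lam <= lam `^ p, lam * lam * (1 - s) <= 1 &
    q * lam `^ p * lam * lam <= 1].
Proof.
move=> p1 /andP[q0 q1] /andP[s0 s12]; have s1 : 0 < 1 - s by lra.
have [L [L1 Lq Ls]] : exists L : R, [/\ 1 < L, L * q <= 1 & L * (1 - s) <= 1].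
  exists (Num.min q^-1 (1 - s)^-1); split.
  - by rewrite lt_min !invf_gt1//; lra.
  - by rewrite -ler_pdivlMr// mul1r ge_min lexx.
  - by rewrite -ler_pdivlMr// mul1r ge_min lexx orbT.
have L0 : 0 < L by lra.
have p2 : 0 < 2 + p by lra.
have [lam lam0 lamE] : exists2 lam : R, 0 < lam & lam ^+ 2 * lam `^ p = L.
  exists (L `^ (2 + p)^-1); first by rewrite powR_gt0.
  rewrite -powR_mulrn ?powR_ge0// -powRD ?powR_invK ?(ltW L0)//.
  by apply/implyP => _; rewrite gt_eqF// powR_gt0.
have p0 : 0 < p by lra.
have lam1 : 1 < lam.
  rewrite ltNge; apply/negP => l1; move: L1; rewrite ltNge => /negP; apply.
  rewrite -lamE -[leRHS]mulr1 ler_pM// ?exprn_ge0 ?powR_ge0 ?(ltW lam0)//.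
    by rewrite expr_le1 ?(ltW lam0).
  have := @ler_powR2r p lam 1 p0 (ltW lam0) ler01.
  by rewrite powR1 l1 => ->.
have lamp : lam <= lam `^ p by rewrite le1r_powR ?ltW.
exists lam; split=> //.
- apply: le_trans Ls; rewrite ler_wpM2r ?(ltW s1)// -lamE expr2.
  by rewrite ler_peMr ?mulr_ge0 ?(ltW lam0)// (le_trans (ltW lam1)).
- by move: Lq; rewrite -lamE expr2; lra.
Qed.

(** The right-hand side equals (A/2)^p / s1^(p - 1), which is unbounded as s1 tends to 0 because p >
    1: a tall peak on a tiny set has large p-th moment. *)
Lemma peak_threshold_exists (p K Fv : R) : 1 < p -> 0 < K -> 0 < Fv ->
  exists2 tau : R, 0 < tau & forall s1 A, 0 < s1 -> s1 < tau -> K <= A ->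
    Fv <= (A / (2 * s1)) `^ p * s1.
Proof.
move=> p1 K0 Fv0; have p0 : 0 < p by lra.
have pp : 0 < p - 1 by lra.
have Q0 : 0 < (K / 2) `^ p / Fv by rewrite divr_gt0// powR_gt0// divr_gt0.
exists (((K / 2) `^ p / Fv) `^ (p - 1)^-1); first by rewrite powR_gt0.
move=> s1 A s10 s1tau KA; have A0 : 0 < A by lra.
have e1 : s1 `^ p = s1 * s1 `^ (p - 1) by rewrite mulr_powRB1// ltW.
have e2 : s1 `^ (p - 1) <= (K / 2) `^ p / Fv.
  rewrite -[leRHS](powR_invK pp (ltW Q0)) ler_powR2r ?powR_ge0 ?(ltW s10)//.
  exact: ltW.
have e3 : (K / 2) `^ p <= (A / 2) `^ p.
  by rewrite ler_powR2r ?divr_ge0 ?(ltW A0) ?(ltW K0)//; lra.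
have s1p : 0 < s1 `^ (p - 1) by rewrite powR_gt0.
have -> : A / (2 * s1) = A / 2 / s1 by field; rewrite gt_eqF.
rewrite powRM ?divr_ge0 ?invr_ge0 ?(ltW A0) ?(ltW s10)//.
rewrite -(powR_inv1 (ltW s10)) powRAC powR_inv1 ?powR_ge0// e1.
have -> : (A / 2) `^ p / (s1 * s1 `^ (p - 1)) * s1 = (A / 2) `^ p / s1 `^ (p - 1).
  by field; rewrite !gt_eqF.
by rewrite ler_pdivlMr//; move: e2; rewrite ler_pdivlMr//; lra.
Qed.

Lemma below_half (s1 sg : R) : 0 < sg -> s1 < sg / 2 -> 0 < sg - s1 /\ s1 <= sg - s1.
Proof. by split; lra. Qed.

(** The defects are what the reserved set of measure sg must supply to the first and p-th moments.
    With [Phi] the p-th root of [Fv], the four bounds place them in the range of [two_values_exist]: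
    the constant function on the reserved set has p-th moment at most sg [Fv], and a peak can reach
    [Fv]. *)
Lemma embedding_defects (fv Fv sg s lam lp Phi G1 G2 tp : R) :
  0 < fv -> 0 < sg -> sg < 1 -> 0 < s -> fv * s <= sg * (Phi - fv) ->
  1 < lam -> lam <= lp -> lam * lam * (1 - s) <= 1 ->
  G1 <= lam * fv * (1 - sg) -> fv * (1 - sg) <= lam * G1 ->
  0 <= G2 -> G2 <= lam * tp * (1 - sg) -> 0 <= tp -> tp <= Fv ->
  [/\ sg * fv <= fv - lam^-1 * G1, fv - lam^-1 * G1 <= sg * Phi,
      sg * Fv <= Fv - lp^-1 * G2 & Fv - lp^-1 * G2 <= Fv].
Proof.
move=> fv0 sg0 sg1 s0 sPhi lam1 lamp lam2 I1le I1ge G20 I2 tp0 tF.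
have lam0 : 0 < lam by lra.
have lp0 : 0 < lp by lra.
have sg10 : 0 <= 1 - sg by lra.
split.
- have : lam^-1 * G1 <= fv * (1 - sg) by rewrite [leLHS]mulrC ler_pdivrMr//; lra.
  lra.
- have : fv * (1 - sg) * (1 - s) <= lam^-1 * G1.
    rewrite [leRHS]mulrC ler_pdivlMr// -(ler_pM2r lam0).
    have h : 0 <= fv * (1 - sg) by rewrite mulr_ge0// ltW.
    have := ler_wpM2l h lam2; lra.
  have : 0 <= fv * sg * s by rewrite !mulr_ge0 ?ltW.
  nra.
- have : lp^-1 * G2 <= Fv * (1 - sg).
    rewrite [leLHS]mulrC ler_pdivrMr//; apply: le_trans I2 _.
    have h1 : lam * tp <= lp * Fv by rewrite ler_pM// ltW.
    have := ler_wpM2r sg10 h1; lra.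
  lra.
- by rewrite gerBl mulr_ge0// invr_ge0 ltW.
Qed.

(** Of the two factors q in rho, one pays for the reserved set of measure sg and the other for the
    powers of lam. *)
Lemma embedding_value_slack (lam lp q rho W sg tv : R) : 0 < lam -> 0 < lp ->
  0 < q -> q * q = rho -> sg < 1 - q -> q * lp * lam * lam <= 1 -> 0 <= tv ->
  tv * (1 - sg) <= lam * (lp * W) -> rho * tv <= lam^-1 * W.
Proof.
move=> lam0 lp0 q0 qE Sq lam3 tv0 V.
rewrite [leRHS]mulrC ler_pdivlMr// -qE.
have h1 : tv * q <= lam * (lp * W) by apply: le_trans V; rewrite ler_wpM2l//; lra.
have lp' : 0 < lam * lp by rewrite mulr_gt0.
rewrite -(ler_pM2l lp').
have tq : 0 <= tv * q by rewrite mulr_ge0// ltW.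
have := ler_wpM2l tq lam3; lra.
Qed.

End powR_roots.

(** * The dyadic function is at most the martingale one for refining filtrations *)

Section refining_lower_bound.
Local Open Scope ereal_scope.
Context d (T : measurableType d) (R : realType) (mu : probability T R).
Variable F : nat -> set (set T).
Hypothesis filF : filtration F.
Let mFE := filtration_measurable filF.

Lemma mart_bellman_ge_dtree (p C Fv fv M rho : R) (t : dtree R) :
  infinitely_refining mu F -> (1 < p)%R -> (0 < C)%R -> (0 <= M <= C)%R ->
  tcarleson C t -> tavg t = fv -> (tpow p t <= Fv)%R -> (tmass t <= M)%R ->
  (0 < fv)%R -> (fv `^ p < Fv)%R -> (0 < rho < 1)%R ->
  (rho * tvalue p t)%:E <= mart_bellman mu F p C Fv fv M.
Proof.
move=> refF p1 C0 MC ct tfv tF tM fv0 fF /andP[rho0 rho1].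
have p0 : (0 < p)%R by lra.
have [P PE] : exists P : set T -> R, forall A, measurable A -> mu A = (P A)%:E.
  by exists (fun A => fine (mu A)) => A mA; rewrite fineK// fin_num_measure.
have [q qE q0] : exists2 q : R, (q * q = rho)%R & (0 < q)%R.
  by exists (Num.sqrt rho); rewrite ?sqrtr_gt0// -expr2 sqr_sqrtr// ltW.
have q1 : (q < 1)%R by nra.
have Fv0 : (0 < Fv)%R by apply: le_lt_trans fF; rewrite powR_ge0.
have T0 : 0 < mu setT by rewrite probability_setT lte_fin.
have q10 : (0 < 1 - q)%R by lra.
have [n [S [FS _ S0 Sq]]] := small_subset filF refF
  (sigalgT (filtration_sigma filF 0)) T0 q10.
have mS := mFE FS; have muS := S0; rewrite !PE// !lte_fin in S0 Sq.
have [sg sgE] : exists sg : R, P S = sg by exists (P S).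
rewrite sgE in S0 Sq.
have [Phi PhiE Phi0] : exists2 Phi : R, (Phi `^ p = Fv)%R & (0 <= Phi)%R.
  by exists (Fv `^ p^-1)%R; rewrite ?powR_ge0// powR_invK// ltW.
have fPhi : (fv < Phi)%R by rewrite -(ltr_powR2r p0)// ?PhiE// ltW.
(* s is the share of the mean that scaling may lose while the mean left for S stays at most sg
   [Phi]. *)
have [s s0 sPhi] : exists2 s : R, (0 < s <= 2^-1)%R & (fv * s <= sg * (Phi - fv))%R.
  exists (Num.min (sg * (Phi - fv) / fv)%R 2^-1%R).
    rewrite ge_min lexx orbT andbT lt_min invr_gt0 ltr0n andbT.
    by rewrite divr_gt0// mulr_gt0// subr_gt0.
  by rewrite mulrC -ler_pdivlMr// ge_min lexx.
have q01 : (0 < q < 1)%R by rewrite q0.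
have [lam [lam1 lamp lam2 lam3]] := slack_exists p1 q01 s0.
have lam0 : (0 < lam)%R by lra.
have lamp0 : (0 < lam `^ p)%R by rewrite powR_gt0.
have {}s0 : (0 < s)%R by have /andP[] := s0.
have sgfv : (0 < sg * fv)%R by rewrite mulr_gt0.
have [tau tau0 peak] := peak_threshold_exists p1 sgfv Fv0.
have mintau : (0 < Num.min (sg / 2) tau)%R by rewrite lt_min tau0 andbT; lra.
(* [S'] carries the peak: below half of S so that it is the smaller of the two pieces, and below the
   threshold [tau] so that the peak can supply the whole of [Fv]. *)
have [n' [S' [FS' S'S S'0 S's]]] := small_subset filF refF FS muS mintau.
have mS' := mFE FS'; rewrite !PE// !lte_fin in S'0 S's.
have [s1 s1E] : exists s1 : R, P S' = s1 by exists (P S').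
rewrite s1E in S'0 S's.
have {S's}[s1sg s1tau] : (s1 < sg / 2)%R /\ (s1 < tau)%R.
  by apply/andP; rewrite -lt_min.
have mSS : measurable (S `\` S') by exact: measurableD.
have PSS : P (S `\` S') = (sg - s1)%R.
  apply: EFin_inj; rewrite -PE// measureD//; last by rewrite ltey_eq fin_num_measure.
  by rewrite setIidr// EFinB -sgE -s1E -!PE.
pose E := ~` S.
have FE : F n E by exact: sigalgC (filtration_sigma filF n) _ _.
have mE := mFE FE.
have PEE : P E = (1 - sg)%R.
  by apply: EFin_inj; rewrite -PE// probability_setC// PE// sgE.
have [g [b emb]] := embeds_exists filF refF p1 C0 lam1 FE ct.
have g0 := emb_ge0 emb; have mg := emb_meas emb.
have b0 := emb_bge0 emb.
have mb i := meas_wrt_measurable (@mFE i) (emb_bmeas emb i).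
have FT i := sigalgT (filtration_sigma filF i).
have sg1 : (sg < 1)%R by apply: lt_trans Sq _; rewrite gtrBl.
have I1le := emb_le emb (FT n); have I1ge := emb_ge emb; have I2 := emb_pow emb.
have int_fin (h : T -> R) (c : R) : (forall x, (0 <= h x)%R) ->
    \int[mu]_x (h x)%:E <= c%:E * mu E ->
    exists2 G : R, (0 <= G)%R & \int[mu]_x (h x)%:E = G%:E.
  move=> h0 hle; have i0 : 0 <= \int[mu]_x (h x)%:E.
    by apply: integral_ge0 => x _; rewrite lee_fin.
  exists (fine (\int[mu]_x (h x)%:E)); first exact: fine_ge0.
  rewrite fineK// ge0_fin_numE//.
  by apply: le_lt_trans hle _; rewrite PE// -EFinM ltry.
rewrite setTI in I1le.
have [G1 _ G1E] := int_fin g _ g0 I1le.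
have [G2 G20 G2E] := int_fin (fun x => g x `^ p)%R _ (fun x => powR_ge0 _ _) I2.
rewrite G1E tfv PE// PEE -EFinM lee_fin in I1le.
rewrite G1E tfv PE// PEE -!EFinM lee_fin in I1ge.
rewrite G2E PE// PEE -EFinM lee_fin in I2.
have [A AE] : exists A : R, A = (fv - lam^-1 * G1)%R by eexists.
have [B BE] : exists B : R, B = (Fv - (lam `^ p)^-1 * G2)%R by eexists.
have [A_ge A_le B_ge B_le] := embedding_defects fv0 S0 sg1 s0 sPhi lam1 lamp lam2
  I1le I1ge G20 I2 (tpow_ge0 p t) tF.
rewrite -AE -BE in A_ge A_le B_ge B_le.
have A0 : (0 < A)%R by apply: lt_le_trans A_ge.
have [s20 s12'] := below_half S0 s1sg.
have [||x [y [x0 y0 xyA xyB]]] := @two_values_exist R p A B s1 (sg - s1)%R p1 A0 S'0 s20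
  s12'.
- rewrite addrC subrK; apply: le_trans B_ge; rewrite mulrC ler_pM2l//.
  rewrite -PhiE ler_powR2r ?divr_ge0 ?(ltW A0) ?(ltW S0)//.
  by rewrite ler_pdivrMr// mulrC.
- by apply: le_trans B_le _; exact: peak.
pose SS := S `\` S'.
have ind0 (X : set T) z : (0 <= \1_X z :> R)%R by rewrite indicE.
have int3 (u : T -> R) (U c v w : R) : (forall z, (0 <= u z)%R) ->
    measurable_fun setT u -> \int[mu]_z (u z)%:E = U%:E ->
    (0 <= c)%R -> (0 <= v)%R -> (0 <= w)%R ->
    \int[mu]_z (c * u z + (v * \1_S' z + w * \1_SS z))%:E =
    (c * U + (v * s1 + w * (sg - s1)))%:E.
  move=> u0 mu_ uU c0 v0 w0.
  have mcu : measurable_fun setT (fun z => (c * u z)%:E).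
    by apply/measurable_EFinP; exact: measurable_funM.
  have mind (k : R) (X : set T) : measurable X -> measurable_fun setT (fun z => (k * \1_X z)%:E).
    by move=> mX; apply/measurable_EFinP; apply: measurable_funM => //; exact: measurable_indic.
  have Zind (k : R) (X : set T) : measurable X -> (0 <= k)%R ->
      \int[mu]_z (k * \1_X z)%:E = (k * P X)%:E.
    move=> mX k0; under eq_integral do rewrite EFinM.
    rewrite ge0_integralZl//; last first.
      by apply/measurable_EFinP; exact: measurable_indic.
    by rewrite integral_indic// setIT EFinM; congr (_ * _); exact: PE.
  under eq_integral do rewrite 2!EFinD.
  have mv := mind v _ mS'; have mw := mind w _ mSS.
  have nn0 z : 0 <= (c * u z)%:E by rewrite lee_fin mulr_ge0.
  have nn1 z : 0 <= (v * \1_S' z)%:E by rewrite lee_fin mulr_ge0.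
  have nn2 z : 0 <= (w * \1_SS z)%:E by rewrite lee_fin mulr_ge0.
  rewrite ge0_integralD//; [|by move=> z _; rewrite adde_ge0|exact: emeasurable_funD].
  rewrite ge0_integralD// !Zind// PSS s1E -!EFinD.
  under eq_integral do rewrite EFinM.
  rewrite ge0_integralZl//; [|exact/measurable_EFinP|by move=> z _; rewrite lee_fin].
  by rewrite uU -EFinM -EFinD.
(* g vanishes on S, so the three terms have disjoint supports and the p-th moments add. *)
pose f z := (lam^-1 * g z + (x * \1_S' z + y * \1_SS z))%R.
have li0 : (0 <= lam^-1)%R by rewrite invr_ge0 ltW.
have f0 z : (0 <= f z)%R by rewrite !addr_ge0// mulr_ge0.
have mf : measurable_fun setT f.
  apply: measurable_funD; first exact: measurable_funM.
  by apply: measurable_funD; apply: measurable_funM => //; exact: measurable_indic.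
have intf : \int[mu]_z (f z)%:E = fv%:E.
  by rewrite (int3 g G1)// xyA AE addrC subrK.
have intfp : \int[mu]_z (f z `^ p)%:E = Fv%:E.
  rewrite (eq_integral (fun z => ((lam `^ p)^-1 * g z `^ p +
     (x `^ p * \1_S' z + y `^ p * \1_SS z))%:E)); last first.
    move=> z _; congr (_%:E); rewrite /f.
    have pN0 : p != 0%R by rewrite gt_eqF.
    have gS : S z -> g z = 0%R by move=> Sz; apply: (emb_supp emb).
    have [S'z|nS'z] := pselect (S' z).
      rewrite (gS (S'S _ S'z)) !indicE mem_set// memNset; last by case.
      by rewrite powR0// !mulr0 !add0r !addr0 !mulr1.
    have [Sz|nSz] := pselect (S z).
      rewrite (gS Sz) !indicE memNset// mem_set//.
      by rewrite powR0// !mulr0 !add0r !mulr1.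
    rewrite !indicE memNset// memNset; last by case.
    rewrite !mulr0 !addr0 powRM//; congr (_ * _)%R.
    by rewrite -(powR_inv1 (ltW lam0)) powRAC powR_inv1// ltW.
  rewrite (int3 (fun z => g z `^ p)%R G2)//; last 5 first.
  - by move=> z; exact: powR_ge0.
  - exact: (measurableT_comp (measurable_powR p) mg).
  - by rewrite invr_ge0 ltW.
  - exact: powR_ge0.
  - exact: powR_ge0.
  by rewrite xyB BE addrC subrK.
have one0 i (z : T) : (0 <= (fun _ _ => 1%R : R) i z)%R by exact: ler01.
have mone i : measurable_fun setT ((fun _ _ => 1%R : R) i : T -> R) by exact: measurable_cst.
have lb0 i z : (0 <= lam^-1 * b i z)%R by rewrite mulr_ge0.
have mlb i : measurable_fun setT (fun z => lam^-1 * b i z)%R by exact: measurable_funM.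
have totM : wseries mu (fun i z => lam^-1 * b i z)%R (fun _ _ => 1%R) 0 setT <= M%:E.
  rewrite wseriesZ//; apply: le_trans (lee_wpmul2l _ (emb_mass emb (FT n))) _.
    by rewrite lee_fin.
  rewrite muleA -EFinM mulrA mulVf ?gt_eqF// mul1r setTI PE// PEE -EFinM lee_fin.
  by apply: le_trans tM; rewrite ler_piMr ?(tmass_ge0 ct)// gerBl ltW.
apply: (@mart_bellman_ge _ _ _ _ _ filF p C Fv fv M f (fun i z => lam^-1 * b i z)%R) => //.
- move=> i; apply: (meas_wrt_comp (h := fun y : R => lam^-1 * y)%R (emb_bmeas emb i)).
  exact: measurable_funM.
- move=> k A' _ FA'; have mA' := mFE FA'.
  rewrite wseriesZ//; apply: le_trans (lee_wpmul2l _ (emb_carl emb FA')) _.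
    by rewrite lee_fin.
  rewrite muleA -EFinM mulrA mulVf ?gt_eqF// mul1r.
  apply: lee_wpmul2l; first by rewrite lee_fin ltW.
  by apply: le_measure; rewrite ?inE//; exact: measurableI.
- move=> fn ce fn0.
  have mfnp i : measurable_fun setT (fun z => fn i z `^ p)%R.
    have [mfni _ _] := ce i; apply: (measurableT_comp (measurable_powR p)).
    exact: meas_wrt_measurable (@mFE i) _ _ _ mfni.
  have fnp0 i z : (0 <= fn i z `^ p)%R by exact: powR_ge0.
  set r := (M - _)%R.
  have r0 : (0 <= r)%R.
    rewrite /r subr_ge0 -lee_fin fineK// ge0_fin_numE; last exact: wseries_ge0.
    by apply: le_lt_trans totM _; rewrite ltry.
  apply: (@le_trans _ _ (wseries mu (fun i z => lam^-1 * b i z)%R (fun i z => fn i z `^ p)%R 0 setT)); last first.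
    rewrite (@wseriesD _ _ _ mu (fun i z => lam^-1 * b i z)%R (fun i _ => if i == 0%N then r else 0)%R)//.
      by rewrite leeDl// wseries_ge0// => i _; case: ifP.
    by move=> i _; case: ifP.
  rewrite wseriesZ//.
  set W := wseries mu b _ 0 setT.
  have W0 : 0 <= W by exact: wseries_ge0.
  have if_ : mu.-integrable setT (EFin \o f).
    apply/integrableP; split; first exact/measurable_EFinP.
    under eq_integral do rewrite /= ger0_norm//.
    by rewrite intf ltry.
  (* lam f majorises g on E, so [emb_val] applies to lam f; the scaling comes out of the series as
     lam^p. *)
  have V : (tvalue p t)%:E * mu E <= lam%:E * ((lam `^ p)%:E * W).
    have := @emb_val _ _ _ _ _ _ _ _ _ _ _ _ _ emb
      (fun z => lam * f z)%R (fun i z => lam * fn i z)%R.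
    rewrite (wseries_powRZ mu 0%N measurableT (ltW lam0) b0 fn0 mb mfnp); apply.
    + by move=> z; rewrite mulr_ge0// ltW.
    + exact: measurable_funM.
    + move=> z Ez; rewrite /f mulrDr mulrA divff ?gt_eqF// mul1r lerDl.
      by rewrite mulr_ge0 ?(ltW lam0)// addr_ge0// mulr_ge0.
    + by move=> i; apply: cond_expZ => //; exact: mFE.
    + by move=> i z; rewrite mulr_ge0// ltW.
  have tv0 := tvalue_ge0 p ct.
  move: V W0; case: W => [W| |] //; last first.
    by move=> _ _; rewrite gt0_muley ?lte_fin ?invr_gt0// leey.
  rewrite PE// PEE -!EFinM !lee_fin => V _.
  exact: embedding_value_slack lam0 lamp0 q0 qE Sq lam3 tv0 V.
Qed.

(** The constant function with the whole mass M placed at time 0. *)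
Lemma mart_bellman_ge_const (p C fv M : R) : (1 < p)%R -> (0 < C)%R ->
  (0 <= M <= C)%R -> (0 <= fv)%R ->
  (M * fv `^ p)%:E <= mart_bellman mu F p C (fv `^ p) fv M.
Proof.
move=> p1 C0 MC fv0; have [M0 _] := andP MC.
have ws w m D : wseries mu (fun _ _ => 0%R) w m D = 0.
  apply: eseries0 => i _ _; rewrite (eq_integral (cst 0)) ?integral0// => x _.
  by rewrite mul0r.
have int_cst (c : R) : \int[mu]_x c%:E = c%:E.
  rewrite [LHS](integral_cst mu measurableT) [X in _ * X](_ : _ = 1) ?mule1//.
  exact: probability_setT.
apply: (@mart_bellman_ge _ _ _ _ _ filF p C _ fv M (fun=> fv) (fun _ _ => 0%R)) => //.
- move=> i B mB; have [B0|B0] := pselect (B 0%R).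
    rewrite (_ : _ @^-1` _ = setT); first exact: (sigalgT (filtration_sigma filF _)).
    by apply/seteqP; split.
  rewrite (_ : _ @^-1` _ = set0); first exact: (sigalg0 (filtration_sigma filF _)).
  by apply/seteqP; split.
- by move=> n A _ _; rewrite ws mule_ge0// lee_fin ltW.
- by rewrite ws lee_fin.
- move=> fn ce fn0; rewrite ws subr0.
  have -> : (fun (i : nat) (_ : T) => 0 + (if i == 0%N then M else 0))%R =
      (fun (i : nat) (x : T) => if i == 0%N then cst M x else 0)%R.
    by apply/funext => i; apply/funext => x; rewrite add0r.
  rewrite (@wseries_single _ _ _ mu 0%N 0%N (cst M))//=; last by move=> i x; exact: powR_ge0.
  have [mfn ifn fnE] := ce 0%N.
  have mfn' := meas_wrt_measurable (@mFE 0%N) mfn.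
  under eq_integral do rewrite EFinM.
  rewrite ge0_integralZl//; last 2 first.
  - by apply/measurable_EFinP; exact: (measurableT_comp (measurable_powR p) mfn').
  - by move=> x _; rewrite lee_fin powR_ge0.
  rewrite EFinM; apply: lee_wpmul2l; first by rewrite lee_fin.
  have := @jensen_powR _ _ _ mu p fv 1%R setT (fn 0%N) p1 fv0 measurableT
    (probability_setT mu) mfn' (fun x _ => fn0 0%N x).
  rewrite !mulr1; apply; rewrite fnE ?int_cst//.
  exact: (sigalgT (filtration_sigma filF _)).
Qed.

Lemma lte_between (x : R) (v : \bar R) : x%:E < v ->
  exists2 b : R, (x < b)%R & b%:E < v.
Proof.
case: v => [v| |]//; last by move=> _; exists (x + 1)%R; rewrite ?ltry//; lra.
by rewrite lte_fin => xv; exists ((x + v) / 2)%R; rewrite ?lte_fin; lra.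
Qed.

(** Every dyadic value is approached by tree values, which are bounded separately in the boundary
    case f^p = F and in the interior. *)
Lemma dyadic_le_mart_bellman (p C Fv fv M : R) :
  infinitely_refining mu F -> (1 < p)%R -> (0 < C)%R -> (0 <= fv)%R ->
  (fv `^ p <= Fv)%R -> (0 <= M <= C)%R ->
  dyadic_bellman p C Fv fv M <= mart_bellman mu F p C Fv fv M.
Proof.
move=> refF p1 C0 fv0 fF MC; have [M0 _] := andP MC.
apply: ub_ereal_sup => v [f [a [mf [f0 [intF [intf [a0 [aM [aC vE]]]]]]]]].
have tree b := @dyadic_dtree_approx R p C Fv fv M f a p1 C0 mf f0 intF intf a0 aM aC v b vE.
(* If v exceeded X, a real strictly between them would be reached by a tree; [0 <= X] excludes the
   value minus infinity. *)
suff : exists2 X : \bar R, 0 <= X <= mart_bellman mu F p C Fv fv M &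
    forall t : dtree R, tcarleson C t -> tavg t = fv -> (tpow p t <= Fv)%R ->
      (tmass t <= M)%R -> (tvalue p t)%:E <= X.
  move=> [X /andP[X0 XB] XP]; apply: le_trans XB; rewrite leNgt; apply/negP.
  move: X0 XP; case: X => [X| |]//= _ XP; last by rewrite ltNge leey.
  move=> /lte_between[b Xb /tree[t [ct tfv tF tM bt]]].
  by have := XP t ct tfv tF tM; rewrite lee_fin; lra.
move: fF; rewrite le_eqVlt => /predU1P[fF|fF].
  exists (M * fv `^ p)%:E.
    by rewrite lee_fin mulr_ge0 ?powR_ge0//= -fF mart_bellman_ge_const.
  move=> t ct tfv tF tM; rewrite lee_fin.
  apply: le_trans (tvalue_le_of_tpow_eq p1 ct _) _; first by rewrite tfv fF.
  by rewrite tfv ler_wpM2r ?powR_ge0.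
(* A mean of zero would make f vanish almost everywhere and force [Fv] = 0, against the strict
   inequality. *)
have fv_gt0 : (0 < fv)%R.
  rewrite lt_neqAle fv0 andbT; apply/negP => /eqP fvE.
  have mI : measurable (@I01 R) by exact: measurable_itv.
  have f00 : ae_eq lebesgue_measure (@I01 R) (EFin \o f) (cst 0).
    apply/ae_eq_integral_abs => //; first exact/measurable_EFinP.
    rewrite -[RHS]/(0%:E) fvE -intf; apply: eq_integral => x /set_mem Ix.
    by rewrite gee0_abs// lee_fin f0.
  have : \int[lebesgue_measure]_(x in @I01 R) ((f x) `^ p)%:E = 0.
    rewrite (ae_eq_integral (cst 0)) ?integral0//.
      by apply/measurable_EFinP; exact: (measurableT_comp (measurable_powR p) mf).
    case: f00 => N [mN N0 NE]; exists N; split=> // x /= h; apply: NE => /= h'.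
    apply: h => Ix; have [->] := h' Ix; rewrite powR0// gt_eqF//; lra.
  rewrite intF => -[Fv0]; move: fF; rewrite Fv0 -fvE powR0 ?ltxx//.
  by rewrite gt_eqF//; lra.
have H t rho ct tfv tF tM h := @mart_bellman_ge_dtree p C Fv fv M rho t refF p1 C0 MC
  ct tfv tF tM fv_gt0 fF h.
(* The single leaf [fv] is a tree of value 0. *)
have B0 : 0 <= mart_bellman mu F p C Fv fv M.
  have := H (Leaf fv) 2^-1%R fv0 erefl (ltW fF) M0; rewrite /= mulr0; apply.
  by apply/andP; split; lra.
exists (mart_bellman mu F p C Fv fv M); first by rewrite B0 lexx.
move=> t ct tfv tF tM; rewrite leNgt; apply/negP.
move: B0 {H}(H t); case: (mart_bellman _ _ _ _ _ _ _) => [m| |]//.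
rewrite !lee_fin lte_fin => m0 H mt.
have t0 : (0 < tvalue p t)%R by lra.
(* With this rho, rho times the tree value is the midpoint of m and that value, which exceeds m. *)
have := H ((m + tvalue p t) / (2 * tvalue p t))%R ct tfv tF tM.
rewrite divr_gt0 ?ltr_pdivrMr ?mulr_gt0//; [|lra].
have -> : (m + tvalue p t < 1 * (2 * tvalue p t))%R by lra.
move=> /(_ isT); rewrite lee_fin.
have -> : ((m + tvalue p t) / (2 * tvalue p t) * tvalue p t = (m + tvalue p t) / 2)%R.
  by field; rewrite gt_eqF.
lra.
Qed.

End refining_lower_bound.

(** * Gluing two dyadic candidates on the halves of the unit interval *)

Section doubling.
Context {R : realType}.
Local Notation leb := (@lebesgue_measure R).

(** For c = 0 and c = 1 this maps the left and the right half of [0,1) onto [0,1). *)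
Definition dbl (c x : R) : R := 2 * x - c.

Lemma measurable_dbl c : measurable_fun setT (dbl c).
Proof. by apply: measurable_funB => //; exact: measurable_funM. Qed.

(** Twice the image of Lebesgue measure agrees with Lebesgue measure on half-open intervals, so
    uniqueness applies. *)
Lemma lebesgue_dbl c (X : set R) : measurable X ->
  (leb X = 2%:E * leb (dbl c @^-1` X))%E.
Proof.
move=> mX.
pose phi : measurableTypeR R -> measurableTypeR R := dbl c.
have mphi : measurable_fun setT phi by exact: measurable_dbl.
pose m0 : {measure set (measurableTypeR R) -> \bar R} := pushforward leb phi.
pose m1 := m0 mphi.
pose m2 : {measure set (measurableTypeR R) -> \bar R} := mscale (NngNum (ler0n R 2)) m1.
have -> : (2%:E * leb (dbl c @^-1` X) = m2 X)%E by [].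
apply: (@lebesgue_measure_unique R m2) => // _ [[a b] _ <-] /=.
rewrite -[RHS]/(2%:E * leb (dbl c @^-1` `]a, b]%classic))%E.
have -> : dbl c @^-1` `]a, b] = `](a + c) / 2, (b + c) / 2]%classic.
  by apply/seteqP; split=> x /=; rewrite !in_itv/= /dbl => /andP[h1 h2];
    apply/andP; split; lra.
rewrite !lebesgue_measure_itv/= !lte_fin.
have -> : ((a + c) / 2 < (b + c) / 2) = (a < b) by apply/idP/idP; lra.
case: ifP => _; last by rewrite mule0.
by rewrite -!EFinD -EFinM; congr (_%:E); field.
Qed.

Lemma integral_dbl c (D : set R) (h : R -> R) : measurable D ->
  measurable_fun D h -> (forall x, D x -> 0 <= h x) ->
  (\int[leb]_(x in dbl c @^-1` D) (h (dbl c x))%:E =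
   2^-1%:E * \int[leb]_(x in D) (h x)%:E)%E.
Proof.
move=> mD mh h0.
pose phi : measurableTypeR R -> measurableTypeR R := dbl c.
have mphi : measurable_fun setT phi by exact: measurable_dbl.
pose m0 : {measure set (measurableTypeR R) -> \bar R} := pushforward leb phi.
pose m1 := m0 mphi.
pose m2 : {measure set (measurableTypeR R) -> \bar R} := mscale (NngNum (ler0n R 2)) m1.
have -> : (\int[leb]_(x in D) (h x)%:E = \int[m2]_(x in D) (h x)%:E)%E.
  by apply: eq_measure_integral => A mA _; exact: (lebesgue_dbl c mA).
have mEh : measurable_fun (D : set (measurableTypeR R)) (EFin \o h) by exact/measurable_EFinP.
have h0E x : D x -> (0 <= (h x)%:E)%E by move=> Dx; rewrite lee_fin h0.
rewrite (@ge0_integral_mscale _ _ _ m1 D mD (NngNum (ler0n R 2)) (EFin \o h) mEh h0E).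
rewrite (@ge0_integral_pushforward _ _ _ _ _ _ mphi leb D (EFin \o h))//; last first.
  by move=> x /set_mem; exact: h0E.
by rewrite muleA -EFinM mulVf ?mul1e// pnatr_eq0.
Qed.

Lemma dbl0_dyad k j : dbl 0 @^-1` (dyad k j) = dyad k.+1 j.
Proof.
have k0 := exp2_gt0 (R := R) k.
have e i : (i%:R / 2 ^+ k.+1 : R) = i%:R / 2 ^+ k / 2.
  by rewrite exprSr; field; rewrite gt_eqF.
apply/seteqP; split=> x; rewrite /dyad /dbl /= !in_itv/= !e => /andP[h1 h2];
  apply/andP; split; lra.
Qed.

Lemma dbl1_dyad k j : dbl 1 @^-1` (dyad k j) = dyad k.+1 (2 ^ k + j).
Proof.
have k0 := exp2_gt0 (R := R) k.
have e i : ((2 ^ k + i)%:R / 2 ^+ k.+1 : R) = (1 + i%:R / 2 ^+ k) / 2.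
  by rewrite natrD natrX exprSr; field; rewrite gt_eqF.
apply/seteqP; split=> x; rewrite /dyad /dbl /= !in_itv/= -?addnS !e => /andP[h1 h2];
  apply/andP; split; lra.
Qed.

Lemma sum_exp2S_half k (u : nat -> \bar R) (P : pred nat) :
  (\sum_(j < 2 ^ k.+1 | P j) u j =
   \sum_(j < 2 ^ k | P j) u j + \sum_(j < 2 ^ k | P (2 ^ k + j)%N) u (2 ^ k + j)%N)%E.
Proof.
rewrite -(big_mkord P u) expnS mul2n -addnn.
rewrite (big_cat_nat (n := (2 ^ k)%N)) ?leq_addr//= !big_mkord.
congr (_ + _)%E; rewrite -{1}[(2 ^ k)%N]add0n big_addn addnK big_mkord.
by apply: eq_big => i; rewrite addnC.
Qed.

Lemma nneseries_shiftS (u : nat -> \bar R) k : (forall i, 0 <= u i)%E ->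
  (\sum_(k.+1 <= i <oo) u i = \sum_(k <= i <oo) u i.+1)%E.
Proof.
move=> u0; rewrite -nneseries_addn// -[RHS]nneseries_addn//.
by apply: eq_eseriesr => i _; rewrite addnS.
Qed.

End doubling.

Section glue.
Context {R : realType}.
Local Notation leb := (@lebesgue_measure R).

Definition glue (f1 f0 : R -> R) (x : R) : R :=
  if x < 2^-1 then f1 (dbl 0 x) else f0 (dbl 1 x).

(** Coefficients are halved together with the lengths; the root receives none, so that the masses
    are averaged. *)
Definition glue_seq (a1 a0 : nat -> nat -> R) (k j : nat) : R :=
  if k is k'.+1 then
    if (j < 2 ^ k')%N then a1 k' j / 2 else a0 k' (j - 2 ^ k')%N / 2
  else 0.

Variables (f1 f0 : R -> R).
Hypotheses (mf1 : measurable_fun I01 f1) (mf0 : measurable_fun I01 f0).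
Hypotheses (f10 : forall x, I01 x -> 0 <= f1 x) (f00 : forall x, I01 x -> 0 <= f0 x).

Lemma glueE1 x : dyad 1 0 x -> glue f1 f0 x = f1 (dbl 0 x).
Proof. by rewrite /glue /dyad /= in_itv/= expr1 mul1r => /andP[_ ->]. Qed.

Lemma glueE0 x : dyad 1 1 x -> glue f1 f0 x = f0 (dbl 1 x).
Proof. by rewrite /dyad /= in_itv/= expr1 mul1r /glue => /andP[h _]; rewrite ltNge h. Qed.

Let I01_split : (@I01 R) = dyad 1 0 `|` dyad 1 1.
Proof. by rewrite -dyad00 dyad_split. Qed.

Lemma dbl_I01 : dbl 0 @^-1` (@I01 R) = dyad 1 0 /\ dbl 1 @^-1` (@I01 R) = dyad 1 1.
Proof. by rewrite -dyad00 dbl0_dyad dbl1_dyad. Qed.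

Let mI : measurable (@I01 R). Proof. exact: measurable_itv. Qed.

Lemma measurable_glue : measurable_fun I01 (glue f1 f0).
Proof.
have [e1 e0] := dbl_I01.
rewrite I01_split; apply/(measurable_funU _ (dyad_measurable 1 0) (dyad_measurable 1 1)); split.
- apply: (@eq_measurable_fun _ _ _ _ _ (f1 \o dbl 0)).
    by move=> x /set_mem h; rewrite /= glueE1.
  apply: (measurable_comp mI _ mf1); last by apply: measurable_funTS; exact: measurable_dbl.
  by move=> _ [x h <-]; move: h; rewrite -e1.
- apply: (@eq_measurable_fun _ _ _ _ _ (f0 \o dbl 1)).
    by move=> x /set_mem h; rewrite /= glueE0.
  apply: (measurable_comp mI _ mf0); last by apply: measurable_funTS; exact: measurable_dbl.
  by move=> _ [x h <-]; move: h; rewrite -e0.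
Qed.

Lemma glue_ge0 x : I01 x -> 0 <= glue f1 f0 x.
Proof.
have [e1 e0] := dbl_I01; rewrite I01_split => -[h|h].
  by rewrite glueE1//; apply: f10; move: h; rewrite -e1.
by rewrite glueE0//; apply: f00; move: h; rewrite -e0.
Qed.

Lemma integral_glue1 k j : (j < 2 ^ k)%N ->
  (\int[leb]_(x in dyad k.+1 j) (glue f1 f0 x)%:E =
   2^-1%:E * \int[leb]_(x in dyad k j) (f1 x)%:E)%E.
Proof.
have [e1 _] := dbl_I01; move=> jk; have sub := @dyad_sub R _ _ jk.
rewrite -(@integral_dbl R 0); [|exact: dyad_measurable|exact: measurable_funS mf1|
  by move=> x /sub; exact: f10].
rewrite dbl0_dyad; apply: eq_integral => x /set_mem; rewrite -dbl0_dyad => h.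
by rewrite glueE1// -e1; exact: sub.
Qed.

Lemma integral_glue0 k j : (j < 2 ^ k)%N ->
  (\int[leb]_(x in dyad k.+1 (2 ^ k + j)) (glue f1 f0 x)%:E =
   2^-1%:E * \int[leb]_(x in dyad k j) (f0 x)%:E)%E.
Proof.
have [_ e0] := dbl_I01; move=> jk; have sub := @dyad_sub R _ _ jk.
rewrite -(@integral_dbl R 1); [|exact: dyad_measurable|exact: measurable_funS mf0|
  by move=> x /sub; exact: f00].
rewrite dbl1_dyad; apply: eq_integral => x /set_mem; rewrite -dbl1_dyad => h.
by rewrite glueE0// -e0; exact: sub.
Qed.

Lemma integral_glue :
  (\int[leb]_(x in I01) (glue f1 f0 x)%:E =
   2^-1%:E * \int[leb]_(x in I01) (f1 x)%:E +
   2^-1%:E * \int[leb]_(x in I01) (f0 x)%:E)%E.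
Proof.
have z : (0 < 2 ^ 0)%N by [].
rewrite -dyad00 (dyad_int_split measurable_glue glue_ge0 z).
by rewrite (integral_glue1 z) -(integral_glue0 z).
Qed.

Lemma dyad_avg_glue1 k j : (j < 2 ^ k)%N ->
  dyad_avg (glue f1 f0) k.+1 j = dyad_avg f1 k j.
Proof.
move=> jk; rewrite /dyad_avg integral_glue1// muleA -EFinM exprSr mulfK//.
Qed.

Lemma dyad_avg_glue0 k j : (j < 2 ^ k)%N ->
  dyad_avg (glue f1 f0) k.+1 (2 ^ k + j) = dyad_avg f0 k j.
Proof.
move=> jk; rewrite /dyad_avg integral_glue0// muleA -EFinM exprSr mulfK//.
Qed.

End glue.

Section glue_sums.
Context {R : realType}.
Variables (a1 a0 : nat -> nat -> R).
Hypotheses (a10 : forall k j, 0 <= a1 k j) (a00 : forall k j, 0 <= a0 k j).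
Local Notation a := (glue_seq a1 a0).

Lemma glue_seq_ge0 k j : 0 <= a k j.
Proof. by case: k => //= k; case: ifP => _; rewrite divr_ge0. Qed.

Lemma glue_seq1 k j : (j < 2 ^ k)%N -> a k.+1 j = a1 k j / 2.
Proof. by move=> /= ->. Qed.

Lemma glue_seq0 k j : a k.+1 (2 ^ k + j) = a0 k j / 2.
Proof. by rewrite /= ltnNge leq_addr/= addKn. Qed.

(** The weights cover two uses: w = 1 for the total mass and the powers of the averages for the
    value. *)
Lemma nneseries_glue (w w1 w0 : nat -> nat -> \bar R) :
  (forall k j, (0 <= w k j)%E) ->
  (forall k j, (j < 2 ^ k)%N -> w k.+1 j = w1 k j) ->
  (forall k j, (j < 2 ^ k)%N -> w k.+1 (2 ^ k + j)%N = w0 k j) ->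
  (forall k j, (j < 2 ^ k)%N -> (0 <= w1 k j)%E) ->
  (forall k j, (j < 2 ^ k)%N -> (0 <= w0 k j)%E) ->
  (\sum_(0 <= k <oo) \sum_(j < 2 ^ k) ((a k j)%:E * w k j) =
   2^-1%:E * \sum_(0 <= k <oo) \sum_(j < 2 ^ k) ((a1 k j)%:E * w1 k j) +
   2^-1%:E * \sum_(0 <= k <oo) \sum_(j < 2 ^ k) ((a0 k j)%:E * w0 k j))%E.
Proof.
move=> w_ge0 ww1 ww0 w1_ge0 w0_ge0.
have t_ge0 k : (0 <= \sum_(j < 2 ^ k) ((a k j)%:E * w k j))%E.
  by apply: sume_ge0 => j _; rewrite mule_ge0// lee_fin glue_seq_ge0.
have t1_ge0 k : (0 <= \sum_(j < 2 ^ k) ((a1 k j)%:E * w1 k j))%E.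
  by apply: sume_ge0 => -[j jk] _; rewrite mule_ge0 ?lee_fin ?w1_ge0.
have t0_ge0 k : (0 <= \sum_(j < 2 ^ k) ((a0 k j)%:E * w0 k j))%E.
  by apply: sume_ge0 => -[j jk] _; rewrite mule_ge0 ?lee_fin ?w0_ge0.
rewrite nneseries_recl// expn0 big_ord_recl big_ord0 /= mul0e !add0e.
rewrite nneseries_shiftS//= -(nneseriesZl _ _ (fun i _ => t1_ge0 i)).
rewrite -(nneseriesZl _ _ (fun i _ => t0_ge0 i)) -nneseriesD; last 2 first.
- by move=> i _ _; rewrite mule_ge0// lee_fin.
- by move=> i _ _; rewrite mule_ge0// lee_fin.
apply: eq_eseriesr => k _.
rewrite (sum_exp2S_half k (fun j => (a k.+1 j)%:E * w k.+1 j)%E xpredT).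
rewrite !ge0_sume_distrr; last 2 first.
- by move=> [j jk] _; rewrite mule_ge0 ?lee_fin ?w0_ge0.
- by move=> [j jk] _; rewrite mule_ge0 ?lee_fin ?w1_ge0.
congr (_ + _)%E; apply: eq_bigr => -[j jk] _ /=.
  by rewrite jk ww1// mulrC EFinM muleA.
by rewrite -[X in (X%:E * _)%E]/(a k.+1 (2 ^ k + j)) glue_seq0 ww0// mulrC EFinM muleA.
Qed.

Lemma dyad_subsum_glue1 k j : (j < 2 ^ k)%N ->
  (dyad_subsum a k.+1 j = 2^-1%:E * dyad_subsum a1 k j)%E.
Proof.
move=> jk; rewrite /dyad_subsum nneseries_shiftS; last first.
  by move=> i; apply: sume_ge0 => j' _; rewrite lee_fin glue_seq_ge0.
rewrite -nneseriesZl; last by move=> i _; apply: sume_ge0 => j' _; rewrite lee_fin.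
rewrite eseries_cond [RHS]eseries_cond; apply: eq_eseriesr => k' /andP[_ kk'].
rewrite (sum_exp2S_half k' (fun j' => (a k'.+1 j')%:E)
  (fun j' => (j' %/ 2 ^ (k'.+1 - k.+1) == j)%N)) subSS.
have kE : (k' = k + (k' - k))%N by rewrite subnKC.
rewrite [X in (_ + X)%E]big_pred0 ?adde0; last first.
  move=> j'; rewrite {1}kE expnD divnMDl ?expn_gt0//.
  by apply/eqP; move: (_ %/ _)%N => q; lia.
rewrite ge0_sume_distrr; last by move=> j' _; rewrite lee_fin.
by apply: eq_bigr => -[j' jk'] _; rewrite glue_seq1//= mulrC EFinM.
Qed.

Lemma dyad_subsum_glue0 k j : (j < 2 ^ k)%N ->
  (dyad_subsum a k.+1 (2 ^ k + j) = 2^-1%:E * dyad_subsum a0 k j)%E.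
Proof.
move=> jk; rewrite /dyad_subsum nneseries_shiftS; last first.
  by move=> i; apply: sume_ge0 => j' _; rewrite lee_fin glue_seq_ge0.
rewrite -nneseriesZl; last by move=> i _; apply: sume_ge0 => j' _; rewrite lee_fin.
rewrite eseries_cond [RHS]eseries_cond; apply: eq_eseriesr => k' /andP[_ kk'].
rewrite (sum_exp2S_half k' (fun j' => (a k'.+1 j')%:E)
  (fun j' => (j' %/ 2 ^ (k'.+1 - k.+1) == 2 ^ k + j)%N)) subSS.
have kE : (k' = k + (k' - k))%N by rewrite subnKC.
rewrite [X in (X + _)%E]big_pred0 ?add0e; last first.
  move=> [j' jk'] /=; apply/eqP => h.
  have : (j' %/ 2 ^ (k' - k) < 2 ^ k)%N by rewrite ltn_divLR ?expn_gt0// -expnD -kE.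
  by rewrite h; lia.
rewrite ge0_sume_distrr; last by move=> j' _; rewrite lee_fin.
apply: eq_big => [j'|j' _].
  by rewrite {1}kE expnD divnMDl ?expn_gt0// eqn_add2l.
by rewrite glue_seq0 mulrC EFinM.
Qed.

End glue_sums.

Section midpoint.
Context {R : realType}.
Variables p C : R.

(** The glued candidate inherits the Carleson condition on all proper subintervals by scaling; at
    the root it is the average of two masses bounded by C. *)
Lemma dyad_vals_midpoint F1 f1 M1 F0 f0 M0 v1 v0 :
  dyad_vals p C F1 f1 M1 v1 -> dyad_vals p C F0 f0 M0 v0 -> M1 <= C -> M0 <= C ->
  dyad_vals p C ((F1 + F0) / 2) ((f1 + f0) / 2) ((M1 + M0) / 2)
    (2^-1%:E * v1 + 2^-1%:E * v0)%E.
Proof.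
move=> [g1 [a1 [mg1 [g10 [gF1 [gf1 [a10 [aM1 [aC1 ->]]]]]]]]].
move=> [g0 [a0 [mg0 [g00 [gF0 [gf0 [a00 [aM0 [aC0 ->]]]]]]]]] M1C M0C.
have half (x y : R) : (2^-1%:E * x%:E + 2^-1%:E * y%:E = ((x + y) / 2)%:E)%E.
  by rewrite -!EFinM -EFinD; congr (_%:E); field.
exists (glue g1 g0), (glue_seq a1 a0); split; first exact: measurable_glue.
split; first exact: glue_ge0.
split.
  rewrite -half -gF1 -gF0.
  rewrite -(@integral_glue R (fun x => g1 x `^ p) (fun x => g0 x `^ p)).
  - by apply: eq_integral => x _; rewrite /glue; case: ifP.
  - exact: (measurableT_comp (measurable_powR p) mg1).
  - exact: (measurableT_comp (measurable_powR p) mg0).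
  - by move=> x _; exact: powR_ge0.
  - by move=> x _; exact: powR_ge0.
split; first by rewrite integral_glue// gf1 gf0 half.
split; first exact: glue_seq_ge0.
have tot : (\sum_(0 <= k <oo) \sum_(j < 2 ^ k) (glue_seq a1 a0 k j)%:E =
    ((M1 + M0) / 2)%:E)%E.
  have := @nneseries_glue R a1 a0 a10 a00 (fun _ _ => 1%E) (fun _ _ => 1%E) (fun _ _ => 1%E).
  have e (b : nat -> nat -> R) : (\sum_(0 <= k <oo) \sum_(j < 2 ^ k) ((b k j)%:E * 1) =
      \sum_(0 <= k <oo) \sum_(j < 2 ^ k) (b k j)%:E)%E.
    by apply: eq_eseriesr => k _; apply: eq_bigr => j _; rewrite mule1.
  by rewrite !e aM1 aM0 half; apply.
split=> //; split; last first.
  rewrite (@nneseries_glue R a1 a0 a10 a00 (fun k j => poweR (dyad_avg (glue g1 g0) k j) p)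
    (fun k j => poweR (dyad_avg g1 k j) p)
    (fun k j => poweR (dyad_avg g0 k j) p))//.
  - by move=> k j; exact: poweR_ge0.
  - by move=> k j jk; rewrite dyad_avg_glue1.
  - by move=> k j jk; rewrite dyad_avg_glue0.
  - by move=> k j _; exact: poweR_ge0.
  - by move=> k j _; exact: poweR_ge0.
move=> [|k] j jk.
  move: jk; rewrite expn0 ltnS leqn0 => /eqP ->; rewrite expr0 divr1.
  rewrite /dyad_subsum (_ : \big[_/_]_(_ <= _ <oo) _ = ((M1 + M0) / 2)%:E)%E.
    by rewrite lee_fin; lra.
  rewrite -tot; apply: eq_eseriesr => k _; apply: eq_bigl => j'.
  by rewrite subn0 divn_small.
have e : (C / 2 ^+ k.+1)%:E = (2^-1%:E * (C / 2 ^+ k)%:E)%E.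
  by rewrite -EFinM exprSr; congr (_%:E); field; rewrite gt_eqF// exp2_gt0.
rewrite e; have [jk1|jk1] := ltnP j (2 ^ k).
  by rewrite dyad_subsum_glue1// lee_wpmul2l// aC1.
have jE : (j = 2 ^ k + (j - 2 ^ k))%N by rewrite subnKC.
have jk2 : (j - 2 ^ k < 2 ^ k)%N by move: jk; rewrite expnS; lia.
by rewrite jE dyad_subsum_glue0// lee_wpmul2l// aC0.
Qed.

End midpoint.

(** * Concavity and jump inequality of the dyadic Bellman function *)

Section dyadic_bellman_properties.
Context {R : realType}.
Variables p C : R.
Hypotheses (p1 : 1 < p) (C0 : 0 < C).
Let p0 : 0 < p. Proof. exact: lt_trans p1. Qed.
Let pm1 : 0 < p - 1. Proof. by rewrite subr_gt0. Qed.
Implicit Types F f M b q : R.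

(** The coefficient of the root is raised by al. Only the Carleson condition of the root sees the
    change, and the average there is f. *)
Lemma dyad_vals_jump F f M al v : 0 <= al -> M + al <= C ->
  dyad_vals p C F f M v -> dyad_vals p C F f (M + al) (v + (al * f `^ p)%:E)%E.
Proof.
move=> al0 MC [g [a [mg [g0 [gF [gf [a0 [aM [aC ->]]]]]]]]].
pose a' k j := a k j + (if k == 0%N then al else 0).
have a'0 k j : 0 <= a' k j by rewrite addr_ge0//; case: ifP.
have sum (w : nat -> nat -> \bar R) : (forall k j, (0 <= w k j)%E) ->
    (\sum_(0 <= k <oo) \sum_(j < 2 ^ k) ((a' k j)%:E * w k j) =
     \sum_(0 <= k <oo) \sum_(j < 2 ^ k) ((a k j)%:E * w k j) + al%:E * w 0%N 0%N)%E.
  move=> w0.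
  have t0 (b : nat -> nat -> R) k : (forall k j, 0 <= b k j) ->
      (0 <= \sum_(j < 2 ^ k) ((b k j)%:E * w k j))%E.
    by move=> b0; apply: sume_ge0 => j _; rewrite mule_ge0// lee_fin.
  rewrite nneseries_recl//; last by move=> k _; exact: t0.
  rewrite [in RHS]nneseries_recl//; last by move=> k _; exact: t0.
  rewrite expn0 !big_ord_recl !big_ord0 !adde0 /= {1}/a' /= EFinD.
  rewrite ge0_muleDl ?lee_fin// -!addeA; congr (_ + _)%E; rewrite addeC; congr (_ + _)%E.
  rewrite eseries_cond [RHS]eseries_cond; apply: eq_eseriesr => k /andP[_ k0].
  by apply: eq_bigr => j _; rewrite /a' gtn_eqF// addr0.
have tot : (\sum_(0 <= k <oo) \sum_(j < 2 ^ k) (a' k j)%:E = (M + al)%:E)%E.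
  have := sum (fun _ _ => 1%E) (fun _ _ => lee01).
  have e (b : nat -> nat -> R) : (\sum_(0 <= k <oo) \sum_(j < 2 ^ k) ((b k j)%:E * 1) =
      \sum_(0 <= k <oo) \sum_(j < 2 ^ k) (b k j)%:E)%E.
    by apply: eq_eseriesr => k _; apply: eq_bigr => j _; rewrite mule1.
  by rewrite !e aM mule1 EFinD.
exists g, a'; do 6 split=> //.
split; last first.
  rewrite (sum (fun k j => poweR (dyad_avg g k j) p)); last by move=> k j; exact: poweR_ge0.
  by rewrite /dyad_avg dyad00 gf expr0 mul1e poweR_EFin EFinM.
move=> [|k] j jk.
  move: jk; rewrite expn0 ltnS leqn0 => /eqP ->; rewrite expr0 divr1.
  rewrite /dyad_subsum (_ : \big[_/_]_(_ <= _ <oo) _ = (M + al)%:E)%E ?lee_fin//.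
  rewrite -tot; apply: eq_eseriesr => k _; apply: eq_bigl => j'.
  by rewrite subn0 divn_small.
apply: le_trans (aC _ _ jk); rewrite le_eqVlt; apply/orP; left; apply/eqP.
rewrite /dyad_subsum eseries_cond [RHS]eseries_cond; apply: eq_eseriesr => k' /andP[_ kk'].
by apply: eq_bigr => j' _; rewrite /a' gtn_eqF ?addr0// (leq_trans _ kk').
Qed.

(** The clause for f = 0 excludes the points that admit no candidate, where the supremum is minus
    infinity and the lower bound 0 fails. *)
Definition bdom F f M := [/\ 0 <= f, f `^ p <= F, f = 0 -> F = 0 & 0 <= M <= C].

(** Height and width of a step function with the prescribed moments: t^(p - 1) = F / f and s = f /
    t, where s <= 1 amounts to f^p <= F. *)
Lemma two_valued_step F f : 0 <= f -> f `^ p <= F -> (f = 0 -> F = 0) ->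
  exists t s, [/\ 0 <= t, 0 <= s <= 1, t * s = f & t `^ p * s = F].
Proof.
rewrite le_eqVlt => /predU1P[<- _ /(_ erefl) ->|f0 fF _].
  have pN0 : p != 0 by rewrite gt_eqF.
  by exists 0, 1; split; rewrite ?powR0// ?mul0r// ler01 lexx.
have pp := pm1.
have F0 : 0 < F by apply: lt_le_trans fF; rewrite powR_gt0.
pose t := (F / f) `^ (p - 1)^-1.
have tE : t `^ (p - 1) = F / f by rewrite powR_invK// divr_ge0 ?ltW.
have t0 : 0 < t by rewrite powR_gt0// divr_gt0.
exists t, (f / t); split; first exact: ltW.
- rewrite divr_ge0 ?(ltW f0) ?(ltW t0)//= ler_pdivrMr// mul1r.
  rewrite -(ler_powR2r pp) ?(ltW f0) ?(ltW t0)// tE ler_pdivlMr// mulrC.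
  by rewrite mulr_powRB1 ?(ltW f0).
- by rewrite mulrC divfK// gt_eqF.
- rewrite -(@mulr_powRB1 _ t p) ?(ltW t0)//.
  by rewrite tE; field; rewrite !gt_eqF.
Qed.

Lemma dyad_vals_exists F f M : bdom F f M ->
  exists2 v, dyad_vals p C F f M v & (0 <= v)%E.
Proof.
move=> [f0 fF fF0 /andP[M0 MC]].
have [t [s [t0 /andP[s0 s1] tsf tsF]]] := two_valued_step f0 fF fF0.
suff : dyad_vals p C F f 0 0%E.
  move=> /(dyad_vals_jump M0); rewrite add0r => /(_ MC) h.
  by eexists; first exact: h; rewrite add0e lee_fin mulr_ge0 ?powR_ge0.
pose S : set R := `[0, s[%classic.
have mS : measurable S by exact: measurable_itv.
have mI : measurable (@I01 R) by exact: measurable_itv.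
have leS : lebesgue_measure S = s%:E.
  rewrite lebesgue_measure_itv/= lte_fin; case: ltP => h; first by rewrite sube0.
  by congr (_%:E); apply/eqP; rewrite eq_le s0 h.
have int (c : R) : 0 <= c ->
    (\int[lebesgue_measure]_(x in I01) (c * \1_S x)%:E = (c * s)%:E)%E.
  move=> c0; under eq_integral do rewrite EFinM.
  rewrite ge0_integralZl//; last first.
    by apply/measurable_EFinP; exact: measurable_indic.
  rewrite integral_indic//.
  rewrite (_ : S `&` I01 = S); last first.
    rewrite setIidl// => x; rewrite /S /I01 /= !in_itv/= => /andP[-> h] /=.
    exact: lt_le_trans h s1.
  by rewrite -[X in (_ * X)%E]/(lebesgue_measure S) leS -EFinM.
have zero (u : nat -> \bar R) k0 : (forall k, u k = 0%E) -> (\sum_(k0 <= k <oo) u k = 0)%E.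
  by move=> u0; apply: eseries0.
exists (fun x => t * \1_S x), (fun _ _ => 0); split.
  by apply: measurable_funM => //; exact: measurable_indic.
split; first by move=> x _; rewrite mulr_ge0// indicE.
split.
  rewrite -tsF -int ?powR_ge0//; apply: eq_integral => x _; rewrite indicE.
  by case: (x \in S); rewrite ?mulr1// !mulr0 powR0// gt_eqF.
split; first by rewrite int// tsf.
split=> //; split; first by apply: zero => k; rewrite big1.
split; last by rewrite zero// => k; rewrite big1// => j _; rewrite mul0e.
move=> k j _; rewrite /dyad_subsum zero; last by move=> k'; rewrite big1.
by rewrite lee_fin divr_ge0 ?exprn_ge0// ltW.
Qed.

(** Real lower bounds keep the concavity argument in real arithmetic, although the supremum is an
    extended real. *)
Definition bellman_lb F f M b := (b%:E <= dyadic_bellman p C F f M)%E.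

Lemma bellman_lb_approx F f M b e : bellman_lb F f M b -> 0 < e ->
  exists2 v, dyad_vals p C F f M v & ((b - e)%:E < v)%E.
Proof.
move=> h e0; have : ((b - e)%:E < dyadic_bellman p C F f M)%E.
  by apply: lt_le_trans h; rewrite lte_fin; lra.
by move=> /ereal_sup_gt[v V bv]; exists v.
Qed.

Lemma bellman_lb_limit F f M b (c : R) : 0 <= c ->
  (forall e, 0 < e -> bellman_lb F f M (b - c * e)) -> bellman_lb F f M b.
Proof.
move=> c0 h; rewrite /bellman_lb; apply/lee_addgt0Pr => e e0.
have c1 : 0 < c + 1 by lra.
have := h (e / (c + 1)) (divr_gt0 e0 c1); rewrite /bellman_lb => h'.
rewrite -leeBlDr// -EFinB; apply: le_trans h'; rewrite lee_fin lerB//.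
rewrite mulrA ler_pdivrMr//; nra.
Qed.

Lemma bellman_lb_dom F f M : bdom F f M -> bellman_lb F f M 0.
Proof.
by move=> /dyad_vals_exists[v V v0]; apply: le_trans v0 _; exact: ereal_sup_ubound.
Qed.

Lemma bellman_lb_le F f M b c : c <= b -> bellman_lb F f M b -> bellman_lb F f M c.
Proof. by move=> cb; apply: le_trans; rewrite lee_fin. Qed.

Lemma bellman_lb_jump F f M al b : 0 <= al -> M + al <= C ->
  bellman_lb F f M b -> bellman_lb F f (M + al) (b + al * f `^ p).
Proof.
move=> al0 MC lb; apply: (@bellman_lb_limit _ _ _ _ 1) => // e e0.
have [v V bv] := bellman_lb_approx lb e0.
apply: (@le_trans _ _ (v + (al * f `^ p)%:E)%E); last first.
  by apply: ereal_sup_ubound; exact: dyad_vals_jump.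
have -> : b + al * f `^ p - 1 * e = (b - e) + al * f `^ p by ring.
by rewrite EFinD leeD2r// ltW.
Qed.

Lemma bellman_lb_midpoint F1 f1 M1 F0 f0 M0 b1 b0 : M1 <= C -> M0 <= C ->
  bellman_lb F1 f1 M1 b1 -> bellman_lb F0 f0 M0 b0 ->
  bellman_lb ((F1 + F0) / 2) ((f1 + f0) / 2) ((M1 + M0) / 2) ((b1 + b0) / 2).
Proof.
move=> M1C M0C lb1 lb0; apply: (@bellman_lb_limit _ _ _ _ 1) => // e e0.
have [v1 V1 bv1] := bellman_lb_approx lb1 e0.
have [v0 V0 bv0] := bellman_lb_approx lb0 e0.
apply: le_trans (ereal_sup_ubound (dyad_vals_midpoint V1 V0 M1C M0C)).
have -> : (b1 + b0) / 2 - 1 * e = 2^-1 * (b1 - e) + 2^-1 * (b0 - e) by field.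
by rewrite EFinD !EFinM; apply: leeD; apply: lee_wpmul2l; rewrite ?lee_fin ?invr_ge0// ltW.
Qed.

Lemma bdom_convex F1 f1 M1 F0 f0 M0 q : 0 <= q <= 1 ->
  bdom F1 f1 M1 -> bdom F0 f0 M0 ->
  bdom (q * F1 + (1 - q) * F0) (q * f1 + (1 - q) * f0) (q * M1 + (1 - q) * M0).
Proof.
move=> /andP[q0 q1] [f10 fF1 z1 /andP[M10 M1C]] [f00 fF0 z0 /andP[M00 M0C]].
have q'0 : 0 <= 1 - q by lra.
have c0 : 0 <= q * f1 + (1 - q) * f0 by rewrite addr_ge0// mulr_ge0.
have e1 : 0 <= q * f1 by rewrite mulr_ge0.
have e0 : 0 <= (1 - q) * f0 by rewrite mulr_ge0.
split=> //.
- set c := q * f1 + _ in c0 *.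
  have t1 := ler_wpM2l q0 (powR_tangent p1 c0 f10).
  have t0 := ler_wpM2l q'0 (powR_tangent p1 c0 f00).
  have cE : p * c `^ (p - 1) * c = p * c `^ p.
    by rewrite -mulrA [c `^ _ * c]mulrC mulr_powRB1.
  have cD : p * c `^ (p - 1) * c = q * (p * c `^ (p - 1) * f1) +
      (1 - q) * (p * c `^ (p - 1) * f0) by rewrite {2}/c; ring.
  have := ler_wpM2l q0 fF1; have := ler_wpM2l q'0 fF0; lra.
- move=> h.
  have : q * f1 == 0 by apply/eqP; lra.
  have : (1 - q) * f0 == 0 by apply/eqP; lra.
  rewrite !mulf_eq0 => /orP[/eqP h0|/eqP/z0 h0] /orP[/eqP h1|/eqP/z1 h1];
    rewrite ?h0 ?h1 ?mul0r ?mulr0 ?addr0//; lra.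
- apply/andP; split; first by rewrite addr_ge0// mulr_ge0.
  by have := ler_wpM2l q0 M1C; have := ler_wpM2l q'0 M0C; lra.
Qed.

(* Approximating the weight q by binary digits: one midpoint step consumes one
   digit, and the error term is absorbed by the nonnegativity of the Bellman
   function. *)
Lemma bellman_lb_dyadic_concave F1 f1 M1 F0 f0 M0 b1 b0 n q : 0 <= q <= 1 ->
  0 <= b1 -> 0 <= b0 -> bdom F1 f1 M1 -> bdom F0 f0 M0 ->
  bellman_lb F1 f1 M1 b1 -> bellman_lb F0 f0 M0 b0 ->
  bellman_lb (q * F1 + (1 - q) * F0) (q * f1 + (1 - q) * f0)
    (q * M1 + (1 - q) * M0)
    ((q - (2 ^+ n)^-1) * b1 + (1 - q - (2 ^+ n)^-1) * b0).
Proof.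
move=> + b10 b00 d1 d0 lb1 lb0.
have [_ _ _ /andP[_ M1C]] := d1; have [_ _ _ /andP[_ M0C]] := d0.
elim: n q => [|n ih] q q01.
  apply: bellman_lb_le (bellman_lb_dom (bdom_convex q01 d1 d0)).
  by move/andP: q01 => [q0 q1]; rewrite expr0 invr1; nra.
move/andP: (q01) => [q0 q1]; have e2 : (2 ^+ n.+1)^-1 = (2 ^+ n)^-1 / 2 :> R.
  by rewrite exprSr invfM.
have [q2|q2] := leP q 2^-1.
  have q' : 0 <= 2 * q <= 1 by apply/andP; split; lra.
  have [_ _ _ /andP[_ M'C]] := bdom_convex q' d1 d0.
  have := bellman_lb_midpoint M0C M'C lb0 (ih _ q').
  by congr bellman_lb; rewrite ?e2; field.
have q' : 0 <= 2 * q - 1 <= 1 by apply/andP; split; lra.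
have [_ _ _ /andP[_ M'C]] := bdom_convex q' d1 d0.
have := bellman_lb_midpoint M1C M'C lb1 (ih _ q').
by congr bellman_lb; rewrite ?e2; field.
Qed.

(** The number of binary digits tends to infinity; the error is (b1 + b0) / 2^n. *)
Lemma bellman_lb_concave F1 f1 M1 F0 f0 M0 b1 b0 q : 0 <= q <= 1 ->
  0 <= b1 -> 0 <= b0 -> bdom F1 f1 M1 -> bdom F0 f0 M0 ->
  bellman_lb F1 f1 M1 b1 -> bellman_lb F0 f0 M0 b0 ->
  bellman_lb (q * F1 + (1 - q) * F0) (q * f1 + (1 - q) * f0)
    (q * M1 + (1 - q) * M0) (q * b1 + (1 - q) * b0).
Proof.
move=> q01 b10 b00 d1 d0 lb1 lb0.
apply: (@bellman_lb_limit _ _ _ _ (b1 + b0)); first by rewrite addr_ge0.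
move=> e e0; have [n ne] : exists n, (2 ^+ n)^-1 < e :> R.
  have q2 : `|(2^-1 : R)| < 1 by rewrite ger0_norm; lra.
  have /cvgrPdist_lt/(_ e e0)[m _ /(_ m (leqnn m))] := cvg_expr q2.
  by rewrite sub0r normrN ger0_norm ?exprn_ge0 ?invr_ge0// exprVn; exists m.
apply: bellman_lb_le (bellman_lb_dyadic_concave n q01 b10 b00 d1 d0 lb1 lb0).
nra.
Qed.

(* The lower bounds in homogeneous form: m is a mass, and F, f, M, S are
   integrals over a set of mass m instead of averages. *)
Definition hom_lb m F f M S := 0 <= S /\
  ([/\ m = 0, F = 0, f = 0, M = 0 & S = 0] \/
   [/\ 0 < m, bdom (F / m) (f / m) (M / m) & bellman_lb (F / m) (f / m) (M / m) (S / m)]).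

(** Concavity with weights m1 / (m1 + m0) and m0 / (m1 + m0) becomes additivity in homogeneous form;
    pieces of mass zero contribute nothing. *)
Lemma hom_lbD m1 F1 f1 M1 S1 m0 F0 f0 M0 S0 :
  hom_lb m1 F1 f1 M1 S1 -> hom_lb m0 F0 f0 M0 S0 ->
  hom_lb (m1 + m0) (F1 + F0) (f1 + f0) (M1 + M0) (S1 + S0).
Proof.
move=> [s1 [[-> -> -> -> ->]|[m1p d1 lb1]]] [s0 [[-> -> -> -> ->]|[m0p d0 lb0]]].
- by split; [rewrite addr0|left; rewrite !addr0].
- by rewrite !add0r; split=> //; right.
- by rewrite !addr0; split=> //; right.
split; first exact: addr_ge0.
have mp : 0 < m1 + m0 by lra.
pose q := m1 / (m1 + m0).
have q01 : 0 <= q <= 1.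
  rewrite divr_ge0 ?(ltW m1p) ?(ltW mp)//= ler_pdivrMr//; lra.
have e x1 x0 : q * (x1 / m1) + (1 - q) * (x0 / m0) = (x1 + x0) / (m1 + m0).
  by rewrite /q; field; rewrite !gt_eqF.
right; split=> //; first by rewrite -!e; exact: bdom_convex.
by rewrite -!e; apply: bellman_lb_concave => //; rewrite divr_ge0// ltW.
Qed.

(** The jump inequality with f / m weakened to a lower bound c, as supplied by a discretized
    conditional expectation. *)
Lemma hom_lb_jump m F f M S al c : 0 <= al -> 0 <= c -> c * m <= f ->
  M + al <= C * m -> hom_lb m F f M S -> hom_lb m F f (M + al) (S + al * c `^ p).
Proof.
move=> al0 c0 cf MC [s [[m0 F0 f0 M0 S0]|[mp d lb]]].
  have -> : al = 0 by move: MC; rewrite m0 M0 mulr0; lra.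
  by rewrite mul0r !addr0; split=> //; left.
split; first by rewrite addr_ge0// mulr_ge0 ?powR_ge0.
right; have [f0 fF fz /andP[M0 M1]] := d.
have MC' : M / m + al / m <= C by rewrite -mulrDl ler_pdivrMr.
have am0 : 0 <= al / m by rewrite divr_ge0// ltW.
rewrite mulrDl; split=> //.
  by split=> //; rewrite MC' addr_ge0.
apply: bellman_lb_le (bellman_lb_jump am0 MC' lb).
rewrite mulrDl lerD2l mulrAC ler_wpM2l//.
by rewrite ler_powR2r// ler_pdivlMr.
Qed.

Lemma hom_lb_le m F f M S S' : 0 <= S' -> S' <= S -> hom_lb m F f M S ->
  hom_lb m F f M S'.
Proof.
move=> S'0 S'S [s [[m0 F0 f0 M0 S0]|[mp d lb]]]; split=> //.
  by left; split=> //; apply/eqP; rewrite eq_le S'0 -S0 S'S.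
by right; split=> //; apply: bellman_lb_le lb; rewrite ler_pM2r ?invr_gt0.
Qed.

End dyadic_bellman_properties.

(** * Backward induction along a discretized martingale *)

Section finite_integrals.
Local Open Scope ereal_scope.
Context d (T : measurableType d) (R : realType) (mu : probability T R).
Implicit Types (h : T -> \bar R) (A B : set T).

Definition summable_fun h := [/\ forall x, 0 <= h x, measurable_fun setT h &
  \int[mu]_x h x < +oo].

Definition fint h A : R := fine (\int[mu]_(x in A) h x).

Lemma fintE h A : summable_fun h -> measurable A ->
  \int[mu]_(x in A) h x = (fint h A)%:E.
Proof.
move=> [h0 mh hoo] mA; rewrite /fint fineK// ge0_fin_numE; last first.
  by apply: integral_ge0 => x _.
by apply: le_lt_trans hoo; apply: ge0_subset_integral => // x _.
Qed.

Lemma fint_ge0 h A : summable_fun h -> (0 <= fint h A)%R.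
Proof. by move=> [h0 _ _]; apply: fine_ge0; apply: integral_ge0 => x _. Qed.

Lemma fint_setU h A B : summable_fun h -> measurable A -> measurable B ->
  [disjoint A & B] -> fint h (A `|` B) = (fint h A + fint h B)%R.
Proof.
move=> sh mA mB AB; apply: EFin_inj; have [h0 mh hoo] := sh.
rewrite EFinD -!fintE//; last exact: measurableU.
by rewrite ge0_integral_setU//; exact: measurable_funTS.
Qed.

Lemma fint_null h A : summable_fun h -> measurable A -> mu A = 0 -> fint h A = 0%R.
Proof.
move=> [h0 mh _] mA A0; rewrite /fint null_set_integral//; exact: measurable_funTS.
Qed.

Lemma integral_powR_eq0 (m : {measure set T -> \bar R}) (p : R) A (f : T -> R) :
  (0 < p)%R -> measurable A -> measurable_fun A f ->
  (forall x, A x -> (0 <= f x)%R) -> \int[m]_(x in A) (f x)%:E = 0 ->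
  \int[m]_(x in A) (f x `^ p)%:E = 0.
Proof.
move=> p0 mA mf f0 int0.
have f00 : ae_eq m A (EFin \o f) (cst 0).
  apply/ae_eq_integral_abs => //; first exact/measurable_EFinP.
  rewrite -[RHS]int0; apply: eq_integral => x /set_mem Ax.
  by rewrite gee0_abs// lee_fin f0.
rewrite (ae_eq_integral (cst 0)) ?integral0//.
  by apply/measurable_EFinP; exact: (measurableT_comp (measurable_powR p) mf).
case: f00 => N [mN N0 NE]; exists N; split=> // x /= h; apply: NE => /= h'.
by apply: h => Ax; have [->] := h' Ax; rewrite powR0// gt_eqF.
Qed.

End finite_integrals.

Section discretized_martingale.
Local Open Scope ereal_scope.
Context d (T : measurableType d) (R : realType) (mu : probability T R).
Variable F : nat -> set (set T).
Hypothesis filF : filtration F.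
Let mFE := filtration_measurable filF.
Variables (p C : R).
Hypotheses (p1 : (1 < p)%R) (C0 : (0 < C)%R).
Variables (f : T -> R) (a : nat -> T -> R).
Hypotheses (mf : measurable_fun setT f) (f0 : forall x, (0 <= f x)%R).
Hypotheses (fF : \int[mu]_x (f x `^ p)%:E < +oo) (ff : \int[mu]_x (f x)%:E < +oo).
Hypothesis car : carleson mu F C a.
Variables (idx : nat -> T -> nat) (K : nat) (c : nat -> R) (cmax : R).
Hypotheses (midx : forall k, meas_wrt (F k) (idx k)) (idxK : forall k x, (idx k x < K)%N).
Hypotheses (c0 : forall i, (0 <= c i)%R) (ccmax : forall i, (i < K)%N -> (c i <= cmax)%R).
Hypothesis cell : forall k i A, F k A -> A `<=` [set x | idx k x = i] ->
  (c i)%:E * mu A <= \int[mu]_(x in A) (f x)%:E.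

Let a0 k x : (0 <= a k x)%R. Proof. by case: car. Qed.
Let ma k : measurable_fun setT (a k).
Proof. by case: car => _ /(_ k) mak _; exact: meas_wrt_measurable (@mFE k) _ _ _ mak. Qed.

Let hF x := (f x `^ p)%:E.
Let hf x := (f x)%:E.
Let tail n x := \sum_(n <= k <oo) (a k x)%:E.
Let ha k x := (a k x)%:E.
Let hv k x := (a k x * c (idx k x) `^ p)%:E.

Let sF : summable_fun mu hF.
Proof.
split=> //; first by move=> x; rewrite lee_fin powR_ge0.
by apply/measurable_EFinP; exact: (measurableT_comp (measurable_powR p) mf).
Qed.

Let sf : summable_fun mu hf.
Proof. by split=> //; apply/measurable_EFinP. Qed.

Let tail_recl n x : tail n x = (a n x)%:E + tail n.+1 x.
Proof.
rewrite /tail (nneseries_split n 1)//= ?addn1 ?big_nat1// => k _.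
by rewrite lee_fin.
Qed.

Let tail_ge0 n x : 0 <= tail n x.
Proof. by apply: nneseries_ge0 => k _ _; rewrite lee_fin. Qed.

Let tail_le n A : F n A -> \int[mu]_(x in A) tail n x <= C%:E * mu A.
Proof.
move=> FA; case: car => _ _ /(_ n)[h [[h0 mh hE] hC]]; rewrite -hE//.
have mA := mFE FA; rewrite -integral_cst//; apply: ge0_le_integral => //.
by apply: measurable_funTS; exact: meas_wrt_measurable (@mFE n) _ _ _ mh.
Qed.

Let mtail n : measurable_fun setT (tail n).
Proof.
rewrite (_ : tail n = (fun x => \sum_(0 <= i <oo) (a (i + n)%N x)%:E)).
  apply: ge0_emeasurable_sum => //; first by move=> i x _ _; rewrite lee_fin.
  by move=> i _; apply/measurable_EFinP.
by apply/funext => x; rewrite /tail -nneseries_addn// => i; rewrite lee_fin.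
Qed.

Let stail n : summable_fun mu (tail n).
Proof.
split=> //; apply: le_lt_trans (tail_le (sigalgT (filtration_sigma filF n))) _.
by rewrite probability_setT mule1 ltry.
Qed.

Let sa n : summable_fun mu (ha n).
Proof.
have [_ _ h] := stail n; split; [by move=> x; rewrite lee_fin|exact/measurable_EFinP|].
apply: le_lt_trans h; apply: ge0_le_integral => //.
- by move=> x _; rewrite lee_fin.
- exact/measurable_EFinP.
- by move=> x _; rewrite tail_recl leeDl.
Qed.

Let cidx_le k x : (c (idx k x) `^ p <= cmax `^ p)%R.
Proof.
have h := ccmax (idxK k x).
by rewrite ler_powR2r ?(lt_trans ltr01 p1)// (le_trans (c0 _) h).
Qed.

Let mcidx k : measurable_fun setT (fun x => c (idx k x) `^ p)%R.
Proof.
apply: (measurableT_comp (measurable_powR p)).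
have mi := meas_wrt_measurable (@mFE k) (midx k).
by apply: (measurableT_comp (f := c) _ mi).
Qed.

Let sv n : summable_fun mu (hv n).
Proof.
have [_ _ h] := sa n.
have mv : measurable_fun setT (hv n) by apply/measurable_EFinP; exact: measurable_funM.
split=> //; first by move=> x; rewrite lee_fin mulr_ge0 ?powR_ge0.
apply: (@le_lt_trans _ _ (\int[mu]_x ((cmax `^ p)%:E * ha n x))).
  apply: ge0_le_integral => //.
  - by move=> x _; rewrite lee_fin mulr_ge0 ?powR_ge0.
  - by apply: emeasurable_funM => //; apply/measurable_EFinP.
  - by move=> x _; rewrite -EFinM lee_fin mulrC ler_wpM2r// cidx_le.
rewrite ge0_integralZl//; [|exact/measurable_EFinP|by move=> x _; rewrite lee_fin|
  by rewrite lee_fin powR_ge0].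
by rewrite lte_mul_pinfty// lee_fin powR_ge0.
Qed.

Let mass A : R := fine (mu A).
Let massE A : measurable A -> mu A = (mass A)%:E.
Proof. by move=> mA; rewrite /mass fineK// fin_num_measure. Qed.

Let V N n A : R := (\sum_(n <= k < n + N) fint mu (hv k) A)%R.

(** The induction invariant: the N discretized terms from time n on, integrated over A, are bounded
    by the dyadic Bellman function at the averages over A, in homogeneous form. *)
Definition cell_lb N n A : Prop :=
  hom_lb p C (mass A) (fint mu hF A) (fint mu hf A) (fint mu (tail n) A) (V N n A).

Let V_ge0 N n A : (0 <= V N n A)%R.
Proof. by apply: sumr_ge0 => k _; exact: fint_ge0. Qed.

Lemma cell_lbU N n A B : F n A -> F n B -> A `&` B = set0 ->
  cell_lb N n A -> cell_lb N n B -> cell_lb N n (A `|` B).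
Proof.
move=> FA FB AB lA lB; have mA := mFE FA; have mB := mFE FB.
have dAB : [disjoint A & B] by rewrite disj_set2E AB.
have := hom_lbD p1 C0 lA lB; rewrite /cell_lb.
rewrite -!fint_setU// /V -big_split/=.
rewrite (eq_bigr (fun k => fint mu (hv k) (A `|` B))); last by move=> k _; rewrite fint_setU.
congr hom_lb; apply: EFin_inj; rewrite EFinD -!massE//; last exact: measurableU.
by rewrite measureU.
Qed.

Lemma cell_lb_null N n A : F n A -> mu A = 0 -> cell_lb N n A.
Proof.
move=> FA A0; have mA := mFE FA.
have V0 : V N n A = 0%R by rewrite /V big1// => k _; rewrite fint_null.
split; first by rewrite V0.
by left; split=> //; rewrite ?fint_null// /mass A0.
Qed.

(** With no terms the bound is 0, so only membership in the domain is at stake: Jensen gives f^p <=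
    F and the Carleson condition bounds the tail. *)
Lemma cell_lb0 n A : F n A -> cell_lb 0 n A.
Proof.
move=> FA; have mA := mFE FA.
have [A0|A0] := eqVneq (mu A) 0; first exact: cell_lb_null.
have m0 : (0 < mass A)%R by rewrite fine_gt0// lt0e A0 measure_ge0/= ltey_eq fin_num_measure.
have dom : bdom p C (fint mu hF A / mass A) (fint mu hf A / mass A)
    (fint mu (tail n) A / mass A).
  split.
  - by rewrite divr_ge0 ?fint_ge0// ltW.
  - rewrite ler_pdivlMr// -lee_fin -fintE//.
    apply: (jensen_powR p1) => //; first by rewrite divr_ge0 ?fint_ge0// ltW.
    + exact: massE.
    + exact: measurable_funTS.
    + by rewrite divfK ?gt_eqF// -fintE.
  - move=> /eqP; rewrite mulf_eq0 invr_eq0 (gt_eqF m0) orbF => /eqP h.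
    suff -> : fint mu hF A = 0%R by rewrite mul0r.
    rewrite /fint (integral_powR_eq0 (lt_trans ltr01 p1))//; first exact: measurable_funTS.
    by rewrite fintE// h.
  - rewrite divr_ge0 ?fint_ge0 ?(ltW m0)//= ler_pdivrMr//.
    by rewrite -lee_fin EFinM -fintE// -massE// tail_le.
split; first exact: V_ge0.
right; split=> //; rewrite /V addn0 big_geq// mul0r.
exact: bellman_lb_dom.
Qed.

(** Passing from the tail at n + 1 to the tail at n raises the mass by the integral of a_n. The
    discretized f_n is the constant c_i on A and lies below the average of f, so the jump inequality
    covers the new term. *)
Lemma cell_lbS N n A i : F n A -> A `<=` [set x | idx n x = i] ->
  cell_lb N n.+1 A -> cell_lb N.+1 n A.
Proof.
move=> FA Ai lA; have mA := mFE FA.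
have mha : measurable_fun A (ha n) by apply: measurable_funTS; have [] := sa n.
have mt : measurable_fun A (tail n.+1) by exact: measurable_funTS.
have ha0 x : A x -> 0 <= ha n x by rewrite lee_fin.
have tE : fint mu (tail n) A = (fint mu (tail n.+1) A + fint mu (ha n) A)%R.
  apply: EFin_inj; rewrite EFinD -!fintE// addeC -ge0_integralD//.
  by apply: eq_integral => x _; rewrite tail_recl.
have vE : fint mu (hv n) A = (fint mu (ha n) A * c i `^ p)%R.
  apply: EFin_inj; rewrite mulrC EFinM -!fintE// -ge0_integralZl ?lee_fin ?powR_ge0//.
  by apply: eq_integral => x /set_mem/Ai/= ix; rewrite /hv ix mulrC EFinM.
have VE : V N.+1 n A = (V N n.+1 A + fint mu (ha n) A * c i `^ p)%R.
  have nN : (n < n + N.+1)%N by rewrite addnS ltnS leq_addr.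
  rewrite /V [LHS](big_ltn nN) vE [LHS]addrC; congr (_ + _)%R.
  by rewrite addSnnS.
rewrite /cell_lb tE VE; apply: hom_lb_jump => //.
- exact: fint_ge0.
- by rewrite -lee_fin EFinM -massE// -fintE//; exact: cell FA Ai.
- by rewrite -tE -lee_fin EFinM -fintE// -massE// tail_le.
Qed.

(** A is split into the finitely many cells of [idx n]. Each cell also belongs to F_(n+1), where the
    induction hypothesis applies. *)
Lemma cell_lb_all N n A : F n A -> cell_lb N n A.
Proof.
elim: N n A => [|N ih] n A FA; first exact: cell_lb0.
have Fs := filtration_sigma filF n.
have Fidx (Q : set nat) : F n (idx n @^-1` Q) by apply: midx.
(* The cells are added one index at a time; at j = K they exhaust A. *)
have H j : cell_lb N.+1 n (A `&` [set x | (idx n x < j)%N]).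
  elim: j => [|j ihj].
    rewrite (_ : _ `&` _ = set0); last by apply/seteqP; split=> x // [].
    by apply: cell_lb_null; [exact: sigalg0|rewrite measure0].
  have -> : A `&` [set x | (idx n x < j.+1)%N] =
      (A `&` [set x | (idx n x < j)%N]) `|` (A `&` [set x | idx n x = j]).
    rewrite -setIUr; congr (_ `&` _); apply/seteqP; split=> x /=.
      by rewrite ltnS leq_eqVlt => /predU1P[|]; [right|left].
    by move=> [/ltnW//|->].
  have FB : F n (A `&` [set x | (idx n x < j)%N]) by apply: sigalgI => //; exact: (Fidx [set i | (i < j)%N]).
  have FC : F n (A `&` [set x | idx n x = j]) by apply: sigalgI => //; exact: (Fidx [set j]).
  apply: cell_lbU => //.
    by apply/seteqP; split=> x //= [[_ h] [_ h']]; rewrite h' ltnn in h.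
  apply: (@cell_lbS N n _ j FC (fun x h => h.2)).
  by apply: ih; exact: (filtration_mono filF (leqnSn n) FC).
have := H K; congr cell_lb; apply/seteqP; split=> x; first by case.
by move=> Ax; split=> //=.
Qed.

Lemma discretized_bellman_le N (Fv fv M : R) :
  \int[mu]_x (f x `^ p)%:E = Fv%:E -> \int[mu]_x (f x)%:E = fv%:E ->
  \int[mu]_x (\sum_(0 <= k <oo) (a k x)%:E) = M%:E ->
  \sum_(0 <= k < N) \int[mu]_x (a k x * c (idx k x) `^ p)%:E <=
  dyadic_bellman p C Fv fv M.
Proof.
move=> eF ef eM.
have [_ [[m0 _ _ _ _]|[_ _]]] := cell_lb_all N (sigalgT (filtration_sigma filF 0)).
  by move: m0; rewrite /mass probability_setT => /eqP; rewrite /= oner_eq0.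
have -> : mass setT = 1%R by rewrite /mass probability_setT.
rewrite !divr1 /fint eF ef /tail eM /bellman_lb /=; apply: le_trans.
rewrite /V add0n -sumEFin; apply: lee_sum => k _.
by rewrite -fintE.
Qed.

End discretized_martingale.

(** * Finitely valued approximation from below *)

Section dyadic_truncation.
Context {R : realType}.

(** The grid has mesh 2^-m and is capped at height 2^m, so there are finitely many values. Negative
    y receive index 0. *)
Definition trunc_idx (m : nat) (y : R) : nat := minn (Num.truncn (2 ^+ m * y)) (4 ^ m).

Definition trunc_val (m i : nat) : R := i%:R / 2 ^+ m.

Lemma trunc_idx_lt m y : (trunc_idx m y < (4 ^ m).+1)%N.
Proof. by rewrite ltnS geq_minr. Qed.

Lemma trunc_val_ge0 m i : 0 <= trunc_val m i.
Proof. by rewrite divr_ge0// exprn_ge0. Qed.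

(** A positive index forces y to be positive; at index 0 the value 0 could exceed a negative y. *)
Lemma trunc_val_le m y i : trunc_idx m y = i -> (0 < i)%N -> trunc_val m i <= y.
Proof.
move=> <- i0; rewrite /trunc_val ler_pdivrMr ?exp2_gt0// mulrC.
apply: (@le_trans _ _ (Num.truncn (2 ^+ m * y))%:R); first by rewrite ler_nat geq_minl.
rewrite truncn_le; move: i0; rewrite leq_min truncn_gt0 => /andP[h _].
exact: le_trans h.
Qed.

Lemma measurable_trunc_idx m : measurable_fun setT (trunc_idx m).
Proof.
move=> _ B _; rewrite setTI.
have le_meas i : measurable [set y | (trunc_idx m y <= i)%N].
  have [mi|im] := leqP (4 ^ m) i.
    rewrite (_ : [set _ | _] = setT)//; apply/seteqP; split=> y //= _.
    by rewrite geq_min mi orbT.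
  rewrite (_ : [set _ | _] = `]-oo, i.+1%:R / 2 ^+ m[%classic); first exact: measurable_itv.
  apply/seteqP; split=> y /=; rewrite in_itv/= geq_min [(4 ^ m <= i)%N]leqNgt im orbF truncn_le_nat
    ltr_pdivlMr ?exp2_gt0// mulrC//.
have eq_meas i : measurable [set y | trunc_idx m y = i].
  case: i => [|i].
    rewrite (_ : [set _ | _] = [set y | (trunc_idx m y <= 0)%N])//.
    by apply/seteqP; split=> y /=; rewrite leqn0 => /eqP.
  rewrite (_ : [set _ | _] = [set y | (trunc_idx m y <= i.+1)%N] `\`
      [set y | (trunc_idx m y <= i)%N]); first exact: measurableD.
  apply/seteqP; split=> y /=.
    by move=> ->; rewrite leqnn; split=> //; rewrite ltnn.
  by move=> [h /negP]; rewrite -ltnNge => h'; apply/eqP; rewrite eqn_leq h h'.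
rewrite (_ : _ @^-1` B = \bigcup_(i in B) [set y | trunc_idx m y = i]).
  by apply: bigcup_measurable => i _.
by apply/seteqP; split=> [y By|y [i Bi /= yi]]; [exists (trunc_idx m y)|rewrite /preimage/= yi].
Qed.

Lemma exp2_large (y : R) : \forall m \near \oo, y <= 2 ^+ m.
Proof.
exists (Num.truncn y).+1 => // k /= hk; apply: le_trans (ltW (truncnS_gt y)) _.
by rewrite -natrX ler_nat (leq_trans hk)// ltnW// ltn_expl.
Qed.

Lemma trunc_cvg y : 0 <= y -> trunc_val m (trunc_idx m y) @[m --> \oo] --> y.
Proof.
move=> y0; apply/cvgrPdist_le => e e0.
have q2 : `|(2^-1 : R)| < 1 by rewrite ger0_norm; lra.
have /cvgrPdist_lt/(_ e e0) He := cvg_expr q2.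
near=> m.
have me : (2 ^+ m)^-1 < e.
  have : `|0 - 2^-1 ^+ m| < e by near: m.
  by rewrite sub0r normrN ger0_norm ?exprn_ge0 ?invr_ge0// exprVn.
have ym : y <= 2 ^+ m by near: m; exact: exp2_large.
have m0 := exp2_gt0 (R := R) m.
have z0 : 0 <= 2 ^+ m * y by rewrite mulr_ge0// ltW.
(* Once y <= 2^m the cap is inactive, and the error is that of rounding down, at most 2^-m. *)
have tr : (Num.truncn (2 ^+ m * y) <= 4 ^ m)%N.
  rewrite -(ler_nat R); apply: le_trans (_ : 2 ^+ m * y <= _); first by rewrite truncn_le.
  by rewrite natrX (_ : 4 = 2 * 2 :> R)%R ?exprMn ?ler_pM2l//; ring.
have /andP[h1 h2] := truncn_itv z0.
rewrite /trunc_val /trunc_idx (minn_idPl tr).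
have -> : y - (Num.truncn (2 ^+ m * y))%:R / 2 ^+ m =
    (2 ^+ m * y - (Num.truncn (2 ^+ m * y))%:R) / 2 ^+ m.
  by field; rewrite gt_eqF.
rewrite normrM [X in _ * X]ger0_norm ?invr_ge0 ?(ltW m0)//.
rewrite ger0_norm ?subr_ge0//; apply: le_trans (ltW me).
rewrite ler_piMl ?invr_ge0 ?(ltW m0)//; move: h2; rewrite -natr1; lra.
Unshelve. all: by end_near. Qed.

Lemma trunc_powR_cvg (p y : R) : 0 < p -> 0 <= y ->
  trunc_val m (trunc_idx m y) `^ p @[m --> \oo] --> y `^ p.
Proof.
move=> p0; rewrite le_eqVlt => /predU1P[<-|y0].
  rewrite (_ : (fun _ => _) = cst (0 `^ p)); first exact: cvg_cst.
  by apply/funext => m; rewrite /trunc_idx mulr0 truncn0 min0n /trunc_val mul0r.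
apply: (@cvg_comp _ _ _ (fun m => trunc_val m (trunc_idx m y)) (fun z : R => z `^ p)
  _ _ _ (trunc_cvg (ltW y0))).
exact: powR_continuous.
Qed.

End dyadic_truncation.

(** * Passage to the limit in the upper bound *)

Section martingale_le_dyadic.
Local Open Scope ereal_scope.
Context d (T : measurableType d) (R : realType) (mu : probability T R).
Variable F : nat -> set (set T).
Hypothesis filF : filtration F.
Let mFE := filtration_measurable filF.

(** The discretized bound is uniform in the mesh and in the number of terms; Fatou removes the
    first, and the limit of the partial sums the second. *)
Lemma mart_bellman_le_dyadic (p C Fv fv M : R) : (1 < p)%R -> (0 < C)%R ->
  mart_bellman mu F p C Fv fv M <= dyadic_bellman p C Fv fv M.
Proof.
move=> p1 C0; have p0 : (0 < p)%R by exact: lt_trans p1.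
apply: ub_ereal_sup => _ [f [fn [a [mf [f0 [eF [ef [ce [car [eM ->]]]]]]]]]].
set B := dyadic_bellman p C Fv fv M.
have a0 k x : (0 <= a k x)%R by case: car.
have ma k : measurable_fun setT (a k).
  by case: car => _ /(_ k) mak _; exact: meas_wrt_measurable (@mFE k) _ _ _ mak.
have mfn k : measurable_fun setT (fn k).
  by have [h _ _] := ce k; exact: meas_wrt_measurable (@mFE k) _ _ _ h.
pose s m k x := trunc_val m (trunc_idx m (fn k x)) : R.
have sB m N : \sum_(0 <= k < N) \int[mu]_x (a k x * s m k x `^ p)%:E <= B.
  apply: (@discretized_bellman_le _ _ _ mu F filF p C p1 C0 f a mf f0 _ _ car
    (fun k x => trunc_idx m (fn k x)) (4 ^ m).+1 (trunc_val m) (trunc_val m (4 ^ m))) => //.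
  - by rewrite eF ltry.
  - by rewrite ef ltry.
  - move=> k; have [h _ _] := ce k; apply: (meas_wrt_comp h).
    exact: measurable_trunc_idx.
  - by move=> k x; exact: trunc_idx_lt.
  - by move=> i; exact: trunc_val_ge0.
  - by move=> i iK; rewrite ler_pM2r ?invr_gt0 ?exp2_gt0// ler_nat.
  (* Index 0 has value 0 and needs only f >= 0. For a positive index f_k lies above the grid value
     on the cell, and its integral there is that of f. *)
  - move=> k [|i] A FA Ai.
      rewrite /trunc_val mul0r mul0e; apply: integral_ge0 => x _; by rewrite lee_fin.
    have mA := mFE FA; have [_ ifn fnE] := ce k; rewrite -fnE// -integral_cst//.
    have v0 := trunc_val_ge0 m i.+1 (R := R).
    have h x : A x -> (trunc_val m i.+1 <= fn k x)%R.
      by move=> /Ai/= ix; exact: trunc_val_le ix _.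
    apply: ge0_le_integral => //.
    + by apply/measurable_EFinP; exact: measurable_funTS.
(* The given version of f_k is nonnegative only almost everywhere, whereas the truncations converge
   at nonnegative arguments. The positive part has the same truncations and the same integrals. *)
pose gn k x := Num.max (fn k x) 0%R.
have gn0 k x : (0 <= gn k x)%R by rewrite le_max lexx orbT.
have mgn k : measurable_fun setT (gn k) by apply: measurable_maxr.
have mpow (u : T -> R) : measurable_fun setT u -> measurable_fun setT (fun x => u x `^ p)%R.
  by move=> mu_; exact: (measurableT_comp (measurable_powR p) mu_).
have gfE k : \int[mu]_x (a k x * fn k x `^ p)%:E = \int[mu]_x (a k x * gn k x `^ p)%:E.
  apply: ge0_ae_eq_integral => //.
  - by apply/measurable_EFinP; apply: measurable_funM => //; exact: mpow.
  - by apply/measurable_EFinP; apply: measurable_funM => //; exact: mpow.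
  - by move=> x _; rewrite lee_fin mulr_ge0 ?powR_ge0.
  - by move=> x _; rewrite lee_fin mulr_ge0 ?powR_ge0.
  - exists [set x | (fn k x < 0)%R]; split.
    + by apply: (@mFE k); have [h _ _] := ce k; exact: meas_wrt_lt.
    + exact: (cond_exp_ge0_ae (@mFE k) f0 (ce k)).
    + move=> x /=; apply: contra_notP => /negP; rewrite -leNgt => h _.
      by rewrite /gn max_l.
have ms m k : measurable_fun setT (fun x => s m k x `^ p)%R.
  apply: mpow; apply: (measurableT_comp (f := trunc_val m)); first by [].
  exact: (measurableT_comp (measurable_trunc_idx m) (mfn k)).
have sidx m k x : s m k x = trunc_val m (trunc_idx m (gn k x)).
  rewrite /s /gn; case: (leP 0%R (fn k x)) => [h|h]//.
  rewrite /trunc_idx mulr0 truncn0.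
  suff -> : Num.truncn (2 ^+ m * fn k x) = 0%N by [].
  apply/truncn0Pn; rewrite -ltNge; apply: lt_trans ltr01.
  by rewrite pmulr_rlt0// exp2_gt0.
have gB N : \sum_(0 <= k < N) \int[mu]_x (a k x * gn k x `^ p)%:E <= B.
  pose h m x := \sum_(0 <= k < N) (a k x * s m k x `^ p)%:E.
  have h0 m x : 0 <= h m x.
    by apply: sume_ge0 => k _; rewrite lee_fin mulr_ge0 ?powR_ge0.
  have mh m : measurable_fun setT (h m).
    by apply: emeasurable_sum => k; apply/measurable_EFinP; exact: measurable_funM.
  have hlim x : h m x @[m --> \oo] --> \sum_(0 <= k < N) (a k x * gn k x `^ p)%:E.
    rewrite /h; under eq_fun do rewrite sumEFin.
    rewrite sumEFin; apply: cvg_EFin; first by near=> m.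
    rewrite (_ : _ \o _ = fun m => \sum_(0 <= k < N) a k x * s m k x `^ p)%R//.
    elim: N {h h0 mh} => [|n ih].
      rewrite big_geq// (_ : (fun _ => _) = cst 0%R); first exact: cvg_cst.
      by apply/funext => m; rewrite big_geq.
    rewrite big_nat_recr//= (_ : (fun _ => _) =
      (fun m => \sum_(0 <= k < n) a k x * s m k x `^ p + a n x * s m n x `^ p)%R).
      apply: cvgD => //; apply: cvgM; first exact: cvg_cst.
      rewrite (_ : (fun _ => _) = fun m => trunc_val m (trunc_idx m (gn n x)) `^ p)%R.
        exact: trunc_powR_cvg.
      by apply/funext => m; rewrite sidx.
    by apply/funext => m; rewrite big_nat_recr.
  rewrite -ge0_integral_sum//; last 2 first.
  - move=> k; apply/measurable_EFinP; apply: measurable_funM => //; exact: mpow.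
  - by move=> k x _; rewrite lee_fin mulr_ge0 ?powR_ge0.
  (* The integrand is the pointwise limit of the discretized ones, written as a lower limit for
     Fatou's lemma. *)
  rewrite (eq_integral (fun x => limn_einf (h ^~ x))); last first.
    move=> x _; rewrite is_cvg_limn_einfE; last by apply/cvg_ex; eexists; exact: hlim.
    by apply/esym/cvg_lim => //; exact: hlim.
  apply: le_trans (fatou mu measurableT mh (fun m x _ => h0 m x)) _.
  rewrite limn_einf_lim; apply: lime_le; first exact: is_cvg_einfs.
  apply: nearW => m; apply: le_trans (sB m N).
  apply: ereal_inf_lbound; exists m => //=.
  rewrite -ge0_integral_sum//.
  - by move=> k; apply/measurable_EFinP; exact: measurable_funM.
  - by move=> k x _; rewrite lee_fin mulr_ge0 ?powR_ge0.
rewrite (integral_series_wseries mu 0%N measurableT a0 (fun i x => powR_ge0 _ _) ma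
  (fun i => mpow _ (mfn i))).
apply: lime_le.
  apply: is_cvg_nneseries => k _ _; apply: integral_ge0 => x _.
  by rewrite lee_fin mulr_ge0 ?powR_ge0.
by apply: nearW => N; under eq_bigr do rewrite gfE; exact: gB.
Unshelve. all: by end_near. Qed.

End martingale_le_dyadic.

Unset Implicit Arguments.

Theorem theoremA (R : realType) (d : measure_display) (T : measurableType d)
    (mu : probability T R) (F : nat -> set (set T)) (p C : R) :
  1 < p -> 0 < C -> filtration F ->
  (forall Fv fv M : R, 0 <= fv -> fv `^ p <= Fv -> 0 <= M <= C ->
     (mart_bellman mu F p C Fv fv M <= dyadic_bellman p C Fv fv M)%E) /\
  (infinitely_refining mu F ->
   forall Fv fv M : R, 0 <= fv -> fv `^ p <= Fv -> 0 <= M <= C ->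
     mart_bellman mu F p C Fv fv M = dyadic_bellman p C Fv fv M).
Proof.
move=> p1 C0 filF; split=> [Fv fv M _ _ _|refF Fv fv M fv0 fF MC].
  exact: mart_bellman_le_dyadic.
apply/eqP; rewrite eq_le mart_bellman_le_dyadic//=.
exact: dyadic_le_mart_bellman.
Qed.
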